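(* Let $d \in \{0,1,\ldots,5\}$ be a constant and let $D(n)$ be a monotonically non-decreasing integer-valued function that for all sufficiently large $n$ satisfies $D(n) \geq \max\{d,3\}$ and $(d,D(n)) \notin \{(3,3),(5,5)\}$. Then there exists a finite constant $\gamma_{d,D} > 0$ such that $$\left( \frac{|\mathcal{P}(n,d,D)|}{n!} \right)^{1/n} \to \gamma_{d,D} \quad \text{as } n \to \infty.$$
   Context: For a positive integer $n$, a constant $d$ and a function $D$, $\mathcal{P}(n,d,D)$ denotes the set of all labelled (simple) planar graphs on the vertex set $\{1,2,\ldots,n\}$ with minimum degree at least $d$ and maximum degree at most $D(n)$. *)

(* Defs.v *)
From HB Require Import structures.
From mathcomp Require Import all_boot all_order all_algebra.
From mathcomp Require Import all_classical all_reals all_analysis.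

Set Implicit Arguments.
Unset Strict Implicit.
Unset Printing Implicit Defensive.

Import Order.TTheory GRing.Theory Num.Theory.
Import numFieldNormedType.Exports.

Local Open Scope classical_set_scope.
Local Open Scope ring_scope.

(* A labelled graph is given by its edge set, a set of 2-element sets of
   vertices; the vertex set {1, ..., n} is represented by 'I_n. *)
Definition simple_graph (n : nat) (E : {set {set 'I_n}}) : bool :=
  [forall e in E, #|e| == 2%N].

Definition degree (n : nat) (E : {set {set 'I_n}}) (v : 'I_n) : nat :=
  #|[set e in E | v \in e]%SET|.

(* The edge e is drawn as the arc c e @` `[0, 1], parametrized from either
   endpoint to the other; values of c e outside [0, 1] are irrelevant. *)
Definition plane_drawing (R : realType) (n : nat) (E : {set {set 'I_n}})
    (p : 'I_n -> R * R) (c : {set 'I_n} -> R -> R * R) : Prop :=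
  [/\ injective p,
      (forall e, e \in E ->
         {within `[0, 1], continuous (c e)} /\
         {in `[0, 1] &, injective (c e)}),
      (forall e, e \in E -> [set c e 0; c e 1] = p @` [set` e]),
      (forall e v t, e \in E -> t \in `]0, 1[ -> c e t <> p v) &
      (forall e e' s t, e \in E -> e' \in E -> e != e' ->
         s \in `]0, 1[ -> t \in `]0, 1[ -> c e s <> c e' t)].

Definition planar (R : realType) (n : nat) (E : {set {set 'I_n}}) : Prop :=
  exists (p : 'I_n -> R * R) (c : {set 'I_n} -> R -> R * R),
    plane_drawing E p c.

Definition planar_graphs (R : realType) (n d : nat) (D : nat -> int) :
    {set {set {set 'I_n}}} :=
  [set E | [&& simple_graph E,
               [forall v, (d <= degree E v)%N],
               [forall v, (degree E v)%:Z <= D n] &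
               `[< planar R E >]]]%SET.

(* Main.v *)
(* Call u(n) the number of connected graphs of the class divided by n!, and a(n) the number of
   all graphs of the class divided by n!.
   - A planar graph has no K5 minor: in a drawing of K5, adding up the parities of the winding
     numbers of differences of pairs of disjoint edges gives 0 = 1 modulo 2. Graphs without a
     K5 minor number at most C^n n!: contracting a large matching (or a large set of vertices
     with few distinct neighbourhoods) is nearly injective, whence a recursion.
   - An inversion followed by a bending of the half-plane redraws a planar graph inside a
     triangle, with a new vertex on a chosen edge as apex. So two connected graphs can be hung on
     two vertices of a fixed straight-line gadget with s vertices (K2, a subdivided octahedron
     or an icosahedron minus an edge according to d) that respects the degree bounds, and
     u(m) u(n) <= u(m+n+s) (m+n+s)^s. Cutting out the component of a vertex gives
     n a(n) <= sum_k k u(k) a(n-k).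
   - Small graphs whose orders are coprime after adding s make u eventually positive. The two
     inequalities then force a(n)^(1/n) to converge to the supremum of the normalised values
     u(m)^(1/(m+s)), taken over m and over all values of the degree bound. *)
Require Import Defs.
From HB Require Import structures.
From mathcomp Require Import all_boot all_order all_algebra.
From mathcomp Require Import zify ring lra.

Set Implicit Arguments.
Unset Strict Implicit.
Unset Printing Implicit Defensive.

Import Order.TTheory GRing.Theory Num.Theory.

(** * Graphs without a complete minor *)

(** Topology enters twice, and both times little of it is used. For the upper bound, excluding one
    fixed complete minor replaces Euler's formula, and the exclusion is a parity count on finite
    chains of points, without the Jordan curve theorem. For the lower bound, two arbitrary drawings
    have to be placed side by side and connected. Their arcs may be wild, and neither an outer face
    nor a straight-line redrawing is at hand; hence the detour through a point of an edge that can
    be touched by an empty disc. Degrees shape the gluing: when D(n) is as small as allowed, no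
    vertex of a part can afford a new neighbour. Subdividing an edge changes no old degree, and only
    a gadget vertex gains 2. The pairs (3,3) and (5,5) would force regular graphs of odd degree,
    which exist for even orders only. Since D may vary with n, both inequalities are used at a fixed
    stage of the bound: lower estimates pass to later stages by monotonicity and upper estimates are
    uniform in the stage, so D may grow at any speed. *)

Section Minors.
Variable V : finType.
Implicit Types (A B C X : {set V}) (g : {set V * V}) (s : seq {set V}).

(* A graph on the vertex set A is given by the set of its arcs. *)
Definition arcs_on A g :=
  [forall x, forall y, ((x, y) \in g) ==> [&& x != y, x \in A, y \in A & (y, x) \in g]].

Lemma arcs_onP A g :
  reflect (forall x y, (x, y) \in g -> [/\ x != y, x \in A, y \in A & (y, x) \in g])
          (arcs_on A g).
Proof.
apply: (iffP forallP) => [H x y xy|H x].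
  by have /forallP/(_ y)/implyP/(_ xy)/and4P[] := H x.
by apply/forallP=> y; apply/implyP=> /H[] -> -> -> ->.
Qed.

Definition step g B : rel V := [rel x y | [&& (x, y) \in g, x \in B & y \in B]].

Definition conn g B := (B != set0) && [forall x in B, forall y in B, connect (step g B) x y].

Definition touch g B C := [exists x in B, exists y in C, (x, y) \in g].

Definition complete_model g A s :=
  [&& all [pred B : {set V} | (B \subset A) && conn g B] s &
      pairwise (fun B C => [disjoint B & C] && touch g B C) s].

Definition has_Kminor k A g := exists2 s, size s = k & complete_model g A s.

Lemma connP g B : reflect (B != set0 /\ {in B &, forall x y, connect (step g B) x y}) (conn g B).
Proof.
apply: (iffP andP) => -[B0 H]; split=> //.
  by move=> x y xB yB; move/forall_inP: H => /(_ x xB)/forall_inP/(_ y yB).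
by apply/forall_inP=> x xB; apply/forall_inP=> y; apply: H.
Qed.

Lemma touchP g B C : reflect (exists x y, [/\ x \in B, y \in C & (x, y) \in g]) (touch g B C).
Proof.
apply: (iffP exists_inP) => [[x xB /exists_inP[y yC xy]]|[x [y [xB yC xy]]]].
  by exists x, y.
by exists x => //; apply/exists_inP; exists y.
Qed.

Lemma step_sym A g B : arcs_on A g -> symmetric (step g B).
Proof.
move=> /arcs_onP gA x y; rewrite /step /= [X in _ && X]andbC.
by congr andb; apply/idP/idP=> /gA[].
Qed.

Lemma step_connect_mono g g' B B' :
  g \subset g' -> B \subset B' -> subrel (connect (step g B)) (connect (step g' B')).
Proof.
move=> /subsetP gg /subsetP BB; apply: connect_sub => x y /and3P[xy xB yB].
by apply: connect1; rewrite /step /= gg ?BB.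
Qed.

Lemma has_Kminor_mono k A A' g g' :
  A \subset A' -> g \subset g' -> has_Kminor k A g -> has_Kminor k A' g'.
Proof.
move=> AA gg [s sk /andP[sA sp]]; exists s => //; apply/andP; split.
  apply/allP=> B /(allP sA) /= /andP[BA /connP[B0 Bc]].
  rewrite (subset_trans BA AA); apply/connP; split=> // x y xB yB.
  exact: (step_connect_mono gg (subxx B) (Bc _ _ xB yB)).
apply: sub_pairwise sp => B C /andP[-> /touchP[x [y [xB yC xy]]]] /=.
by apply/touchP; exists x, y; rewrite (subsetP gg).
Qed.

Definition quotient_arcs (h : V -> V) g : {set V * V} :=
  [set u | (u.1 != u.2) && [exists x, exists y, [&& (x, y) \in g, h x == u.1 & h y == u.2]]].

Lemma quotient_arcsP h g a b :
  reflect (a != b /\ exists x y, [/\ (x, y) \in g, h x = a & h y = b])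
          ((a, b) \in quotient_arcs h g).
Proof.
rewrite inE /=; apply: (iffP andP) => -[ab].
  by move=> /existsP[x /existsP[y /and3P[xy /eqP hx /eqP hy]]]; split=> //; exists x, y.
move=> [x [y [xy hx hy]]]; split=> //; apply/existsP; exists x; apply/existsP; exists y.
by rewrite xy hx hy !eqxx.
Qed.

(* h contracts disjoint stars: each vertex of X is merged into a neighbour outside X. *)
Definition star_contraction A g X (h : V -> V) :=
  [&& X \subset A, [forall v, (v \notin X) ==> (h v == v)] &
      [forall v in X, (h v \in A :\: X) && ((v, h v) \in g)]].

Lemma star_contractionP A g X h :
  reflect [/\ X \subset A, (forall v, v \notin X -> h v = v) &
             forall v, v \in X -> [/\ h v \in A, h v \notin X & (v, h v) \in g]]
          (star_contraction A g X h).
Proof.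
apply: (iffP and3P) => -[XA hid hX]; split=> //.
- by move=> v /(implyP (forallP hid v))/eqP.
- by move=> v /(forall_inP hX)/andP[/setDP[-> ->] ->].
- by apply/forallP=> v; apply/implyP=> /hid ->.
- by apply/forall_inP=> v /hX[hA hN vh]; rewrite vh andbT; apply/setDP.
Qed.

Section Contraction.
Variables (A X : {set V}) (g : {set V * V}) (h : V -> V).
Hypotheses (gA : arcs_on A g) (hc : star_contraction A g X h).

Lemma contraction_in v : v \in A -> h v \in A :\: X.
Proof.
have [XA hid hX] := star_contractionP _ _ _ _ hc.
move=> vA; case: (boolP (v \in X)) => [/hX[hA hN _]|vX]; first by apply/setDP.
by rewrite hid //; apply/setDP.
Qed.

Lemma contraction_arcs_on : arcs_on (A :\: X) (quotient_arcs h g).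
Proof.
apply/arcs_onP=> a b /quotient_arcsP[ab [x [y [xy hx hy]]]].
have [xny xA yA yx] := arcs_onP _ _ gA _ _ xy.
rewrite ab -{1}hx -{1}hy !contraction_in //; split=> //.
by apply/quotient_arcsP; rewrite eq_sym; split=> //; exists y, x.
Qed.

(** A path of the quotient lifts arc by arc. Two lifts over the same vertex are joined through that
    vertex itself, since every vertex equals or is adjacent to its image, which lies in the same
    fibre. *)
Lemma contraction_connect (B : {set V}) x y :
  B \subset A :\: X -> h x \in B -> x \in A -> h y \in B -> y \in A ->
  connect (step (quotient_arcs h g) B) (h x) (h y) ->
  connect (step g (A :&: h @^-1: B)) x y.
Proof.
have [XA hid hX] := star_contractionP _ _ _ _ hc.
move=> BA.
have csym : connect_sym (step g (A :&: h @^-1: B)) by apply: sym_connect_sym; apply: step_sym gA.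
have hh z : z \in A -> h (h z) = h z.
  by move=> /contraction_in/setDP[_ /hid].
have toh z : z \in A -> h z \in B -> connect (step g (A :&: h @^-1: B)) z (h z).
  move=> zA hz; case: (boolP (z \in X)) => [zX|/hid -> //].
  have [hA hN zh] := hX _ zX.
  by apply: connect1; rewrite /step /= zh !inE hz zA hA hh.
have main a b : a \in B -> connect (step (quotient_arcs h g) B) a b ->
    connect (step g (A :&: h @^-1: B)) a b.
  move=> aB /connectP[p]; elim: p a aB => [a _ _ -> //|c p IH a aB /= /andP[/and3P[ac _ cB] pp lb]].
  apply: connect_trans (IH c cB pp lb).
  have /quotient_arcsP[_ [x' [y' [xy hx hy]]]] := ac.
  have [_ xA yA _] := arcs_onP _ _ gA _ _ xy.
  apply: (connect_trans (y := x')); first by rewrite csym -hx; apply: toh => //; rewrite hx.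
  apply: (connect_trans (y := y')); last by rewrite -hy; apply: toh => //; rewrite hy.
  by apply: connect1; rewrite /step /= xy !inE hx hy xA yA aB cB.
move=> hx xA hy yA hxy.
apply: connect_trans (toh x xA hx) _; apply: connect_trans (main _ _ hx hxy) _.
by rewrite csym toh.
Qed.

(** The preimages of the branch sets, cut with [A], are branch sets again. *)
Lemma contraction_Kminor k : has_Kminor k (A :\: X) (quotient_arcs h g) -> has_Kminor k A g.
Proof.
have [XA hid hX] := star_contractionP _ _ _ _ hc.
move=> [s sk /andP[/allP sA sp]].
exists [seq A :&: h @^-1: (B : {set V}) | B <- s]; first by rewrite size_map.
apply/andP; split.
  rewrite all_map; apply/allP=> B /sA /= /andP[BA /connP[/set0Pn[b bB] Bc]].
  rewrite subsetIl; apply/connP; split.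
    apply/set0Pn; exists b; have /setDP[bA bX] := subsetP BA _ bB.
    by rewrite !inE bA hid.
  move=> x y /setIP[xA]; rewrite inE => hx /setIP[yA]; rewrite inE => hy.
  by apply: contraction_connect => //; apply: Bc.
rewrite pairwise_map; apply: sub_pairwise sp => B C /andP[dBC /touchP[a [b [aB bC]]]].
move=> /quotient_arcsP[ab [x [y [xy hx hy]]]] /=.
have [_ xA yA _] := arcs_onP _ _ gA _ _ xy.
apply/andP; split.
  rewrite -setI_eq0; apply/eqP/setP=> z; rewrite !inE.
  by case: (z \in A) => //=; apply/negP=> /andP[zB zC]; rewrite (disjointFr dBC zB) in zC.
by apply/touchP; exists x, y; rewrite !inE hx hy aB bC xA yA.
Qed.
End Contraction.

Definition nbr g x : {set V} := [set y | (x, y) \in g].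

Definition restrict g B : {set V * V} := [set u in g | (u.1 \in B) && (u.2 \in B)].

Lemma restrict_arcs_on A g B : arcs_on A g -> arcs_on B (restrict g B).
Proof.
move=> /arcs_onP gA; apply/arcs_onP=> x y; rewrite !inE /= => /and3P[xy xB yB].
by have [? ? ? yx] := gA _ _ xy; rewrite xB yB yx.
Qed.

Lemma restrict_sub g B : restrict g B \subset g.
Proof. by apply/subsetP=> u; rewrite inE => /andP[]. Qed.

Lemma card_arcs A g : arcs_on A g -> #|g| = \sum_(x in A) #|nbr g x|.
Proof.
move=> /arcs_onP gA; rewrite -sum1_card (partition_big fst (mem A)) /=; last first.
  by move=> [x y] /gA[].
apply: eq_bigr => x xA; rewrite -sum1_card.
rewrite (reindex_onto (fun y => (x, y)) snd) /=; last by move=> [a b] /= /andP[_ /eqP ->].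
by apply: eq_bigl => y; rewrite inE !eqxx !andbT.
Qed.

(** Contracting the edge loses its own two arcs and, for each common neighbour, the two arcs at [y]
    that become parallel to those at [x]; on all other arcs the contraction is injective. *)
Lemma contract_edge_card A g x y (h := fun v => if v == y then x else v) :
  arcs_on A g -> (x, y) \in g ->
  star_contraction A g [set y] h /\
  #|g| <= #|quotient_arcs h g| + (2 + 2 * #|nbr g x :&: nbr g y|).
Proof.
move=> gA xy; have [xNy xA yA yx] := arcs_onP _ _ gA _ _ xy.
split.
  apply/star_contractionP; split; first by rewrite sub1set.
    by move=> v; rewrite inE /h => /negPf ->.
  by move=> v; rewrite inE /h => /eqP ->; rewrite eqxx inE.
set N := nbr g x :&: nbr g y.
pose bad := [set (x, y); (y, x)] :|: (setX [set y] N :|: setX N [set y]).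
have badc : #|bad| <= 2 + 2 * #|N|.
  rewrite (leq_trans (leq_card_setU _ _)) // leq_add //.
    by rewrite cards2; case: (_ == _).
  by rewrite (leq_trans (leq_card_setU _ _)) // !cardsX cards1 mul1n muln1 mul2n addnn.
apply: leq_trans (leq_add (leqnn _) badc).
rewrite -(cardsID bad g) addnC leq_add //; last by rewrite subset_leq_card // subsetIr.
pose H (u : V * V) := (h u.1, h u.2).
have inj : {in g :\: bad &, injective H}.
  move=> [a b] [a' b']; rewrite !inE /= !xpair_eqE !negb_or !negb_and.
  move=> /andP[Hab ab] /andP[Hab' ab'].
  have [aNb _ _ ba] := arcs_onP _ _ gA _ _ ab.
  have [aNb' _ _ ba'] := arcs_onP _ _ gA _ _ ab'.
  rewrite /H /= /h => -[].
  case: (eqVneq a y) => [ay|aNy]; case: (eqVneq a' y) => [ay'|aNy'];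
  case: (eqVneq b y) => [by_|bNy]; case: (eqVneq b' y) => [by'|bNy'];
  move=> E1 E2; subst; rewrite ?eqxx // in aNb aNb' *; move: Hab Hab';
  rewrite ?ab ?ba ?ab' ?ba' ?eqxx ?orbT ?andbT ?andbF /= ?andbF //.
rewrite -(card_in_imset inj) subset_leq_card //; apply/subsetP=> _ /imsetP[[a b] + ->].
rewrite !inE /= !xpair_eqE !negb_or !negb_and => /andP[Hab ab].
apply/andP; split; last by apply/existsP; exists a; apply/existsP; exists b; rewrite ab !eqxx.
have [aNb _ _ ba] := arcs_onP _ _ gA _ _ ab.
rewrite /h; case: (eqVneq a y) => [ay|aNy]; case: (eqVneq b y) => [by_|bNy] //; subst; move: Hab.
- by rewrite eqxx in aNb.
- by rewrite eqxx /= => /andP[/andP[_ +] _]; rewrite eq_sym.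
- by rewrite eqxx orbF => /andP[/andP[+ _] _].
Qed.

(** The singleton of [x] touches every branch set inside the neighbourhood of [x], so it extends the
    model. *)
Lemma Kminor_cone k A g x :
  arcs_on A g -> x \in A -> has_Kminor k (nbr g x) (restrict g (nbr g x)) -> has_Kminor k.+1 A g.
Proof.
move=> gA xA [s sk /andP[/allP sA sp]].
have NA : nbr g x \subset A by apply/subsetP=> y; rewrite inE => /(arcs_onP _ _ gA)[].
exists ([set x] :: s); first by rewrite /= sk.
rewrite /complete_model /=; apply/andP; split; [apply/andP; split; [apply/andP; split|]|apply/andP; split].
- by rewrite sub1set.
- apply/connP; split; first by apply/set0Pn; exists x; rewrite inE.
  by move=> a b /set1P -> /set1P ->.
- apply/allP=> B /sA /= /andP[BN /connP[B0 Bc]].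
  rewrite (subset_trans BN NA); apply/connP; split=> // a b aB bB.
  by apply: (step_connect_mono _ _ (Bc _ _ aB bB)) => //; apply: restrict_sub.
- apply/allP=> B /sA /= /andP[BN /connP[/set0Pn[b bB] Bc]].
  have := subsetP BN _ bB; rewrite inE => xb.
  apply/andP; split; last by apply/touchP; exists x, b; rewrite inE.
  rewrite disjoints1; apply/negP=> /(subsetP BN); rewrite inE => /(arcs_onP _ _ gA)[].
  by rewrite eqxx.
- apply: sub_pairwise sp => B C /andP[-> /touchP[a [b [aB bC ab]]]].
  by apply/touchP; exists a, b; split=> //; apply: (subsetP (restrict_sub _ _) _ ab).
Qed.

(* Contract an edge with few common neighbours; if every edge has many, then the neighbourhood
   of a vertex is dense. *)
Lemma dense_Kminor k A g :
  arcs_on A g -> A != set0 -> 2 ^ k.+1 * #|A| <= #|g| -> has_Kminor k A g.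
Proof.
elim: k A g => [|k IHk] A g; first by exists [::].
have [n] := ubnP #|A|; elim: n => // n IHn in A g *; rewrite ltnS => An gA A0 dense.
(* The threshold is the loss that the density allows: one vertex disappears, so up to 2^(k+2) arcs
   may. If no edge qualifies, every vertex in the neighbourhood of [x] has at least 2^(k+1)
   neighbours there, which is the density demanded one level lower. *)
case: (boolP [exists u in g, 2 + 2 * #|nbr g u.1 :&: nbr g u.2| <= 2 ^ k.+2]).
  move=> /exists_inP[[x y] xy /= few].
  have [hc hcard] := contract_edge_card gA xy.
  have [xNy xA yA yx] := arcs_onP _ _ gA _ _ xy.
  have cA : #|A| = #|A :\: [set y]|.+1 by rewrite (cardsD1 y A) yA.
  apply: (contraction_Kminor gA hc); apply: IHn.
  - by rewrite -ltnS -cA.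
  - exact: contraction_arcs_on gA hc.
  - by apply/set0Pn; exists x; rewrite !inE xNy.
  - rewrite -(leq_add2r (2 ^ k.+2)) -mulnSr -cA.
    by apply: leq_trans dense _; apply: leq_trans hcard _; rewrite leq_add2l.
move=> /exists_inPn many.
have /set0Pn[[x y] xy] : g != set0.
  rewrite -card_gt0; apply: leq_trans dense; by rewrite muln_gt0 expn_gt0 card_gt0.
have [xNy xA yA yx] := arcs_onP _ _ gA _ _ xy.
apply: (Kminor_cone gA xA); apply: IHk.
- exact: restrict_arcs_on gA.
- by apply/set0Pn; exists y; rewrite inE.
rewrite (card_arcs (restrict_arcs_on _ gA)) mulnC -sum_nat_const leq_sum // => z.
rewrite inE => xz; have := many _ xz; rewrite -ltnNge /= expnS -mulnS ltn_mul2l /= ltnS => H.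
apply: leq_trans H _; rewrite subset_leq_card //; apply/subsetP=> w; rewrite !inE /= => /andP[-> ->].
by rewrite xz.
Qed.

(** Quantifying over tuples, a finite type, makes the property boolean, so that the graphs having it
    form a finite set to be counted. *)
Definition Kfree k A g := arcs_on A g && ~~ [exists s : k.-tuple {set V}, complete_model g A s].

Lemma KfreeP k A g : reflect (arcs_on A g /\ ~ has_Kminor k A g) (Kfree k A g).
Proof.
apply: (iffP andP) => -[gA N]; split=> //.
  move=> [s /eqP sk sm]; move/existsP: N; apply.
  by exists (Tuple sk).
by apply/existsP=> -[s sm]; apply: N; exists s; rewrite ?size_tuple.
Qed.

Lemma Kfree_restrict k A B g : B \subset A -> Kfree k A g -> Kfree k B (restrict g B).
Proof.
move=> BA /KfreeP[gA N]; apply/KfreeP; split; first exact: restrict_arcs_on gA.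
by move=> H; apply: N; apply: has_Kminor_mono H => //; apply: restrict_sub.
Qed.

Lemma Kfree_contraction k A X g h :
  star_contraction A g X h -> Kfree k A g -> Kfree k (A :\: X) (quotient_arcs h g).
Proof.
move=> hc /KfreeP[gA N]; apply/KfreeP; split; first exact: contraction_arcs_on gA hc.
by move=> /(contraction_Kminor gA hc).
Qed.

Lemma Kfree_card k A g : Kfree k A g -> #|g| <= 2 ^ k.+1 * #|A|.
Proof.
move=> /KfreeP[gA N]; rewrite leqNgt; apply/negP=> H; apply: N; apply: dense_Kminor (ltnW H) => //.
apply/set0Pn; have /set0Pn[[x y] xy] : g != set0 by rewrite -card_gt0 (leq_trans _ H).
by have [_ xA] := arcs_onP _ _ gA _ _ xy; exists x.
Qed.

Definition clique g (Q : {set V}) := [forall x in Q, forall y in Q, (x != y) ==> ((x, y) \in g)].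

Lemma cliqueP g (Q : {set V}) :
  reflect {in Q &, forall x y, x != y -> (x, y) \in g} (clique g Q).
Proof.
apply: (iffP forall_inP) => [H x y xQ yQ xy|H x xQ].
  by move/forall_inP: (H x xQ) => /(_ y yQ)/implyP; apply.
by apply/forall_inP=> y yQ; apply/implyP; apply: H.
Qed.

(** By [Kfree_card] some vertex has at most 2^(k+1) neighbours. A clique through it is determined by
    a subset of these neighbours; all other cliques live in the graph without it. *)
Lemma card_cliques k A g : Kfree k A g ->
  #|[set Q : {set V} | (Q \subset A) && clique g Q]| <= 1 + 2 ^ (2 ^ k.+1) * #|A|.
Proof.
have [n] := ubnP #|A|; elim: n => // n IHn in A g *; rewrite ltnS => An gA.
have [A0|A0] := eqVneq A set0.
  rewrite A0 cards0 muln0 addn0 -(cards1 (set0 : {set V})) subset_leq_card //.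
  by apply/subsetP=> Q; rewrite !inE subset0 => /andP[].
have /exists_inP[x xA xd] : [exists x in A, #|nbr g x| <= 2 ^ k.+1].
  apply: contraT; rewrite negb_exists_in => /forall_inP H.
  suff: ~~ (#|g| <= 2 ^ k.+1 * #|A|) by rewrite (Kfree_card gA).
  rewrite -ltnNge.
  apply: (@leq_trans ((2 ^ k.+1).+1 * #|A|)); first by rewrite ltn_mul2r card_gt0 A0 ltnSn.
  have /andP[gA1 _] := gA; rewrite (card_arcs gA1) mulnC -sum_nat_const leq_sum // => x xA.
  by rewrite ltnNge H.
have cA : #|A| = #|A :\ x|.+1 by rewrite (cardsD1 x A) xA.
have A1n : #|A :\ x| < n by rewrite -cA.
have := IHn _ _ A1n (Kfree_restrict (subsetDl A [set x]) gA).
rewrite cA mulnSr addnA; set Q1 := [set _ | _] => HQ1.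
apply: (@leq_trans (#|Q1| + #|[set x |: Q | Q : {set V} in powerset (nbr g x)]|)); last first.
  rewrite leq_add //; apply: leq_trans (leq_imset_card _ _) _.
  by rewrite card_powerset leq_exp2l.
apply: leq_trans (leq_card_setU _ _); apply: subset_leq_card.
apply/subsetP=> Q; rewrite !inE => /andP[QA /cliqueP Qc].
case: (boolP (x \in Q)) => xQ; [apply/orP; right|apply/orP; left].
  apply/imsetP; exists (Q :\ x); last by rewrite setD1K.
  by rewrite inE; apply/subsetP=> y; rewrite !inE => /andP[yx yQ]; apply: Qc => //; rewrite eq_sym.
have QA' : Q \subset A :\ x by rewrite subsetD1 QA.
rewrite QA'; apply/cliqueP=> y z yQ zQ yz.
by rewrite inE Qc //= !(subsetP QA').
Qed.

Definition matching_contraction A g X h :=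
  star_contraction A g X h && [forall x in X, forall y in X, (h x == h y) ==> (x == y)].

Definition twin_deletion A g X (h : V -> V) :=
  [&& X \subset A, [forall v, (v \notin X) ==> (h v == v)] &
      [forall v in X, (h v \in A :\: X) && (nbr g (h v) == nbr g v)]].

(** An arc between two uncovered vertices would extend a matching of maximal size. *)
Lemma maximal_matching A g : arcs_on A g -> exists X (h : {ffun V -> V}),
  matching_contraction A g X h /\
  {in A :\: (X :|: h @: X) &, forall x y, (x, y) \notin g}.
Proof.
move=> gA.
pose P (u : {set V} * {ffun V -> V}) := matching_contraction A g u.1 u.2.
have P0 : P (set0, [ffun x => x]).
  rewrite /P /=; apply/andP; split; last by apply/forall_inP => x; rewrite inE.
  apply/star_contractionP; split; first exact: sub0set.
    by move=> v; rewrite ffunE.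
  by move=> v; rewrite inE.
case: (arg_maxnP (fun u : {set V} * {ffun V -> V} => #|u.1|) P0) => -[X h] /=.
move=> Pm maxm; exists X, h; split=> // x y; rewrite !inE !negb_or -!andbA.
move=> /and3P[xX xh xA] /and3P[yX yh yA]; apply/negP=> xy.
have [xNy _ _ yx] := arcs_onP _ _ gA _ _ xy.
have /andP[/star_contractionP[XA hid hX] /forall_inP hinj] := Pm.
have := maxm (x |: X, [ffun v => if v == x then y else h v]).
rewrite /P /matching_contraction /= cardsU1 xX /= add1n ltnn => H; apply: notF; apply: H.
apply/andP; split.
  apply/star_contractionP; split.
  - by rewrite subUset sub1set xA.
  - by move=> v; rewrite !inE negb_or ffunE => /andP[/negPf -> /hid].
  - move=> v; rewrite !inE ffunE; case: (eqVneq v x) => [-> _|vx /= vX].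
      by rewrite yA xy (negPf yX) eq_sym (negPf xNy).
    have [hA hN vh] := hX v vX; rewrite hA vh (negPf hN) orbF; split=> //.
    by apply: contra xh => /eqP <-; rewrite imset_f.
apply/forall_inP=> a; rewrite !inE => aX; apply/forall_inP=> b; rewrite !inE => bX.
move: aX bX; rewrite !ffunE; case: (eqVneq a x) => [->|ax] /=; case: (eqVneq b x) => [->|bx] //=.
- by rewrite eqxx implybT.
- move=> _ bX; apply/implyP=> /eqP E; by rewrite E imset_f in yh.
- by move=> aX _; apply/implyP=> /eqP E; rewrite -E imset_f in yh.
- by move=> aX bX; move/forall_inP: (hinj a aX) => /(_ b bX).
Qed.

(** Merge a vertex outside [B] into a neighbour in [B] when this creates an arc inside [B]. The
    merges are paid for by arcs of a graph on [B] without the minor, so there are only linearly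
    many. When none is possible any more, the neighbourhood of each remaining vertex is a clique of
    the contracted graph. *)
Lemma maximal_absorption k A B g :
  Kfree k A g -> B \subset A -> {in A :\: B &, forall x y, (x, y) \notin g} ->
  exists (Y : {set V}) g', [/\ Y \subset A :\: B, #|Y| <= 2 ^ k.+1 * #|B|, Kfree k B g' &
    {in A :\: B :\: Y, forall v, clique g' (nbr g v)}].
Proof.
move=> gF BA ind; have /KfreeP[gA _] := gF.
pose G (u : {set V} * {ffun V -> V}) := quotient_arcs u.2 (restrict g (B :|: u.1)).
(* The last clause is the accounting: the contracted graph has at least as many arcs as there are
   absorbed vertices. *)
pose P (u : {set V} * {ffun V -> V}) :=
  [&& u.1 \subset A :\: B, [forall v, (v \notin u.1) ==> (u.2 v == v)],
      [forall v in u.1, (u.2 v \in B) && ((v, u.2 v) \in g)] & #|u.1| <= #|G u|].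
have P0 : P (set0, [ffun x => x]).
  rewrite /P /= sub0set cards0 leq0n /= andbT; apply/andP; split.
    by apply/forallP=> v; rewrite ffunE eqxx implybT.
  by apply/forall_inP=> v; rewrite inE.
case: (arg_maxnP (fun u : {set V} * {ffun V -> V} => #|u.1|) P0) => -[Y f] /=.
rewrite {1}/P /= => /and4P[YI /forallP fid /forall_inP fY YG] maxY.
have fid' v : v \notin Y -> f v = v by move=> vY; apply/eqP; apply: (implyP (fid v)).
have YB v : v \in Y -> (v \in A) && (v \notin B) by move/(subsetP YI); rewrite inE andbC.
have BYA : B :|: Y \subset A by rewrite subUset BA (subset_trans YI) ?subsetDl.
have BYB : (B :|: Y) :\: Y = B.
  by rewrite setDUl setDv setU0; apply/setDidPl; rewrite disjoint_sym disjoints_subset (subset_trans YI) // setDE subsetIr.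
have GF : Kfree k B (G (Y, f)).
  rewrite -BYB; apply: Kfree_contraction (Kfree_restrict BYA gF).
  apply/star_contractionP; split=> //; first exact: subsetUr.
  move=> v vY; have /andP[fB vf] := fY v vY; rewrite !inE /= fB vf vY orbT; split=> //.
  by apply/negP=> /YB/andP[_]; rewrite fB.
exists Y, (G (Y, f)); split=> //; first exact: leq_trans YG (Kfree_card GF).
move=> v /setDP[/setDP[vA vB] vY].
have NB b : (v, b) \in g -> b \in B.
  move=> vb; have [_ _ bA _] := arcs_onP _ _ gA _ _ vb.
  by apply: contraT => bB; have := ind v b; rewrite vb; apply; rewrite inE ?vA ?bA ?vB ?bB.
apply/cliqueP=> b b'; rewrite [b \in _]inE [b' \in _]inE => vb vb' bb'.
apply: contraT => nbb; have bB := NB _ vb; have bB' := NB _ vb'.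
have [_ _ _ bv] := arcs_onP _ _ gA _ _ vb.
(* If [b] and [b'] are still not adjacent, merging [v] into [b] adds this arc and contradicts
   maximality. *)
pose u := (v |: Y, [ffun w => if w == v then b else f w]).
have := maxY u; rewrite /= cardsU1 vY /= add1n ltnn; apply.
rewrite /P /= cardsU1 vY /= add1n; apply/and4P; split.
- by rewrite subUset sub1set inE vA vB.
- apply/forallP=> w; rewrite !inE negb_or ffunE; apply/implyP=> /andP[/negPf -> /fid' ->].
  by rewrite eqxx.
- apply/forall_inP=> w; rewrite !inE ffunE; case: (eqVneq w v) => [-> _|_ /= wY]; first by rewrite bB.
  exact: fY.
- apply: (@leq_trans #|(b, b') |: G (Y, f)|); first by rewrite cardsU1 nbb.
  apply: subset_leq_card; rewrite subUset sub1set; apply/andP; split.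
    apply/quotient_arcsP; split=> //; exists v, b'; rewrite !inE /= vb' eqxx bB' orbT /=.
    split=> //; first by rewrite ffunE eqxx.
    rewrite ffunE; case: eqP => [E|_]; first by rewrite E (negPf vB) in bB'.
    by rewrite fid' //; apply/negP=> /YB/andP[_]; rewrite bB'.
  apply/subsetP=> -[a a'] /quotient_arcsP[aa [x [y [xyr fx fy]]]].
  have /and3P[xy] : [&& (x, y) \in g, x \in B :|: Y & y \in B :|: Y] by move: xyr; rewrite !inE.
  rewrite [x \in _]inE [y \in _]inE => xBY yBY.
  have xv : x != v by apply/eqP=> E; rewrite E (negPf vB) (negPf vY) in xBY.
  have yv : y != v by apply/eqP=> E; rewrite E (negPf vB) (negPf vY) in yBY.
  apply/quotient_arcsP; split=> //; exists x, y; rewrite !ffunE (negPf xv) (negPf yv).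
  by rewrite !inE /= xy (negPf xv) (negPf yv) xBY yBY.
Qed.

(** Vertices with equal neighbourhoods get the same representative because [pick] depends only on
    the values of its predicate; [X] collects the vertices that do not represent themselves. *)
Lemma twin_representatives (L : {set V}) g : exists X (h : {ffun V -> V}),
  [/\ X \subset L, {in L :\: X &, injective (nbr g)} &
      [forall v, (v \notin X) ==> (h v == v)] &&
      [forall v in X, (h v \in L :\: X) && (nbr g (h v) == nbr g v)]].
Proof.
pose r v := odflt v [pick u in L | nbr g u == nbr g v].
have rP v : v \in L -> r v \in L /\ nbr g (r v) = nbr g v.
  rewrite /r; case: pickP => [u /andP[uL /eqP E] _ //|/(_ v)].
  by rewrite eqxx andbT => /= ->.
have rE u v : u \in L -> v \in L -> nbr g u = nbr g v -> r u = r v.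
  move=> uL vL E; rewrite /r; have -> : [pick w in L | nbr g w == nbr g u] = [pick w in L | nbr g w == nbr g v].
    by apply: eq_pick => w; rewrite E.
  by case: pickP => // /(_ v); rewrite vL eqxx.
exists [set v in L | r v != v], [ffun v => if v \in L then r v else v]; split.
- by apply/subsetP=> v; rewrite inE => /andP[].
- move=> u v; rewrite !inE => /andP[+ uL] /andP[+ vL]; rewrite uL vL /= !negbK => /eqP ru /eqP rv E.
  by rewrite -ru -rv; apply: rE.
apply/andP; split.
  apply/forallP=> v; rewrite inE ffunE; apply/implyP; case: ifP => //= _; by rewrite negbK.
apply/forall_inP=> v; rewrite inE ffunE => /andP[vL rv]; rewrite vL.
have [rL rN] := rP v vL; rewrite !inE rL rN eqxx !andbT /= negbK; apply/eqP; exact: rE.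
Qed.

(** Let x be the number of contracted vertices of the matching, t = 2^(k+1) and c = 2^t. Up to an
    additive 1, the vertices that are not deletable twins number at most (2 + 2t + 2c)x, the
    summands standing for the cover, the absorbed vertices and the cliques. The factor 4 makes this
    less than a quarter of [A] when the matching is too small. *)
Definition reduction_ratio k := 4 * (2 + 2 * 2 ^ k.+1 + 2 * 2 ^ (2 ^ k.+1)).

(** A small maximal matching yields a small vertex cover. After absorption, the remaining
    neighbourhoods are cliques of a graph on the cover, and these are linearly many in its size, so
    most remaining vertices are twins. *)
Lemma matching_or_twins k A g : Kfree k A g -> 3 < #|A| ->
  exists X (h : {ffun V -> V}), #|A| <= reduction_ratio k * #|X| /\
    matching_contraction A g X h || twin_deletion A g X h.
Proof.
move=> gF A3; have /KfreeP[gA _] := gF.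
have [X [h [Xm ind]]] := maximal_matching gA.
have [XA|] := leqP #|A| (reduction_ratio k * #|X|); first by exists X, h; rewrite Xm.
set B := X :|: h @: X in ind * => XA.
have BX : #|B| <= 2 * #|X|.
  by rewrite (leq_trans (leq_card_setU _ _)) // mul2n -addnn leq_add2l leq_imset_card.
have BA : B \subset A.
  have /andP[/star_contractionP[XsA _ hX] _] := Xm; rewrite subUset XsA /=.
  by apply/subsetP=> _ /imsetP[x xX ->]; have [] := hX x xX.
have [Y [g' [YI Yc gF' Ncl]]] := maximal_absorption gF BA ind.
set L := A :\: B :\: Y in Ncl.
have [Z [r [ZL rinj rtw]]] := twin_representatives L g.
have LA : L \subset A by apply: subset_trans (subsetDl _ _) (subsetDl _ _).
have LZ : #|L :\: Z| <= 1 + 2 ^ (2 ^ k.+1) * #|B|.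
  apply: leq_trans (card_cliques gF'); rewrite -(card_in_imset rinj) subset_leq_card //.
  apply/subsetP=> _ /imsetP[v /setDP[vL _] ->]; rewrite inE (Ncl _ vL) andbT.
  apply/subsetP=> b; rewrite inE => vb; have [_ vA bA _] := arcs_onP _ _ gA _ _ vb.
  move: vL => /setDP[/setDP[_ vB] _].
  by apply: contraT => bB; have := ind v b; rewrite vb; apply; rewrite in_setD ?vA ?bA ?vB ?bB.
exists Z, r; split; last first.
  apply/orP; right; rewrite /twin_deletion (subset_trans ZL LA) /=.
  have /andP[-> /forall_inP H] := rtw; apply/forall_inP=> v vZ.
  have /andP[/setDP[rL rZ] ->] := H v vZ; by rewrite andbT inE rZ (subsetP LA).
have cA : #|A| = #|B| + (#|Y| + (#|Z| + #|L :\: Z|)).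
  rewrite -(cardsID B A) (setIidPr BA) -(cardsID Y (A :\: B)) (setIidPr YI).
  by rewrite -[#|A :\: B :\: Y|](cardsID Z) (setIidPr ZL).
move: XA; rewrite /reduction_ratio -!mulnA; move: cA LZ Yc BX A3.
set a := #|A|; set b := #|B|; set x := #|X|; set z := #|Z|; set y := #|Y|; set l := #|L :\: Z|.
move: (2 ^ k.+1) => t; move: (2 ^ t) => c cA LZ Yc BX A3 XA.
have H1 : a <= z + 1 + (2 + 2 * t + 2 * c) * x.
  have : t * b <= t * (2 * x) by rewrite leq_mul2l BX orbT.
  have : c * b <= c * (2 * x) by rewrite leq_mul2l BX orbT.
  rewrite !mulnDl; lia.
have H2 : a <= 2 * z by lia.
apply: leq_trans H2 _; rewrite mulnA leq_mul2r; apply/orP; right; lia.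
Qed.

Definition Kfree_graphs k A := [set g | Kfree k A g].

(** Adjacency of [x] and [y] can be read at [h x] and [h y], replacing one end after the other by
    symmetry; so the restriction determines the graph. *)
Lemma card_twin_deletion k A X (h : V -> V) :
  #|[set g in Kfree_graphs k A | twin_deletion A g X h]| <= #|Kfree_graphs k (A :\: X)|.
Proof.
set D := [set g in _ | _].
have inj : {in D &, injective (fun g => restrict g (A :\: X))}.
  move=> g1 g2; rewrite !inE => /andP[/KfreeP[gA1 _] tw1] /andP[/KfreeP[gA2 _] tw2] E.
  suff H g g' : arcs_on A g -> arcs_on A g' -> twin_deletion A g X h -> twin_deletion A g' X h ->
      restrict g (A :\: X) = restrict g' (A :\: X) -> g \subset g'.
    by apply/eqP; rewrite eqEsubset !H.
  move=> {g1 g2 gA1 gA2 tw1 tw2 E} gA gA' tw tw' E.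
  have hin f x : twin_deletion A f X h -> x \in A -> (h x \in A :\: X) /\ nbr f (h x) = nbr f x.
    move=> /and3P[_ /forallP fid /forall_inP fX] xA; case: (boolP (x \in X)) => xX.
      by have /andP[-> /eqP] := fX _ xX.
    by rewrite (eqP (implyP (fid x) xX)) inE xX.
  have red f x y : arcs_on A f -> twin_deletion A f X h -> x \in A -> y \in A ->
      ((x, y) \in f) = ((h x, h y) \in restrict f (A :\: X)).
    move=> fA ftw xA yA; have [hx Nx] := hin f x ftw xA; have [hy Ny] := hin f y ftw yA.
    have symf a b : ((a, b) \in f) = ((b, a) \in f) by apply/idP/idP=> /(arcs_onP _ _ fA)[].
    have nbrE a b : ((a, b) \in f) = (b \in nbr f a) by rewrite inE.
    rewrite [in RHS]inE /= hx hy !andbT.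
    by rewrite nbrE -Nx -nbrE symf nbrE -Ny -nbrE symf.
  apply/subsetP=> -[x y] xy; have [_ xA yA _] := arcs_onP _ _ gA _ _ xy.
  by rewrite (red g' x y) // -E -red.
rewrite -(card_in_imset inj) subset_leq_card //; apply/subsetP=> _ /imsetP[g + ->].
by rewrite !inE => /andP[gF _]; apply: Kfree_restrict gF; apply: subsetDl.
Qed.

(** A fibre of [h] has at most one vertex in [X] and one outside, so an arc is known from its image
    and two bits. Contracted edges have loops as images, whence the diagonal in [T]; the exponent
    bounds the size of [T]. *)
Lemma card_matching_contraction k A X (h : V -> V) :
  #|[set g in Kfree_graphs k A | matching_contraction A g X h]| <=
    #|Kfree_graphs k (A :\: X)| * 2 ^ (4 * ((2 ^ k.+1).+1 * #|A|)).
Proof.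
set D := [set g in _ | _].
pose kap (u : V * V) := ((u.1 \in X, u.2 \in X), (h u.1, h u.2)).
rewrite -sum1_card (partition_big (quotient_arcs h) (mem (Kfree_graphs k (A :\: X)))) /=; last first.
  by move=> g; rewrite !inE => /andP[gF /andP[sc _]]; apply: Kfree_contraction gF.
rewrite -sum_nat_const leq_sum // => g' ; rewrite inE => gF'.
rewrite sum1dep_card; set D' := [set g | _].
pose T := [set u : (bool * bool) * (V * V) | u.2 \in g' :|: [set (x, x) | x in A]].
have Tc : #|T| <= 4 * ((2 ^ k.+1).+1 * #|A|).
  have -> : T = setX [set: bool * bool] (g' :|: [set (x, x) | x in A]).
    by apply/setP=> -[a b]; rewrite !inE.
  rewrite cardsX cardsT card_prod card_bool leq_mul2l /= mulSn addnC.
  rewrite (leq_trans (leq_card_setU _ _)) // leq_add ?leq_imset_card //.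
  by apply: leq_trans (Kfree_card gF') _; rewrite leq_mul2l subset_leq_card ?orbT ?subsetDl.
apply: (@leq_trans #|powerset T|); last by rewrite card_powerset leq_exp2l.
have kinj g : g \in D' -> {in setX A A &, injective kap}.
  rewrite !inE => /andP[/andP[_ /andP[/star_contractionP[_ hid hX] /forall_inP hinj]] _].
  have one x y : x \in A -> y \in A -> (x \in X) = (y \in X) -> h x = h y -> x = y.
    move=> xA yA; case: (boolP (x \in X)) => xX; case: (boolP (y \in X)) => yX // _ E.
      by apply/eqP; move/forall_inP: (hinj x xX) => /(_ y yX)/implyP; apply; rewrite E.
    by rewrite -(hid x xX) -(hid y yX).
  move=> [x y] [x' y'] /setXP[/= xA yA] /setXP[/= xA' yA'] [e1 e2 e3 e4].
  by congr pair; apply: one.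
have sub g : g \in D' -> g \subset setX A A.
  rewrite !inE => /andP[/andP[/KfreeP[gA _] _] _]; apply/subsetP=> -[x y] /(arcs_onP _ _ gA)[_ xA yA _].
  by apply/setXP.
have inj : {in D' &, injective (fun g => kap @: g)}.
  move=> g1 g2 g1D g2D E.
  have H g g2' : g \in D' -> g2' \in D' -> kap @: g = kap @: g2' -> g \subset g2'.
    move=> gD gD2 EE; apply/subsetP=> u ug.
    have /imsetP[w wg E'] : kap u \in kap @: g2' by rewrite -EE imset_f.
    by rewrite (kinj _ gD u w) //; [apply: (subsetP (sub _ gD))|apply: (subsetP (sub _ gD2))].
  by apply/eqP; rewrite eqEsubset !H.
rewrite -(card_in_imset inj) subset_leq_card //; apply/subsetP=> _ /imsetP[g gD ->].
rewrite inE; apply/subsetP=> _ /imsetP[[x y] xy ->]; rewrite inE /= in_setU.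
have /setXP[/= xA yA] := subsetP (sub _ gD) _ xy.
move: gD; rewrite inE => /andP[gD /eqP <-].
case: (eqVneq (h x) (h y)) => [E|hxy]; last first.
  by apply/orP; left; apply/quotient_arcsP; split=> //; exists x, y.
apply/orP; right; rewrite E; apply: imset_f.
move: gD; rewrite inE => /andP[_ /andP[sc _]].
have /setDP[] // := contraction_in sc yA.
Qed.
End Minors.

(** It combines n^m n! <= (n+m)!, (n+m)! (n-m)! <= (2n)! and (2n)! <= 4^n (n!)^2. In the recursion,
    the n^m maps that contract m vertices are thus paid for by the drop of the factorial. *)
Lemma expn_fact_le n m : m <= n -> n ^ m * (n - m)`! <= 4 ^ n * n`!.
Proof.
move=> mn.
have H1 : n ^ m * n`! <= (n + m)`!.
  elim: m {mn} => [|m IH]; first by rewrite expn0 mul1n addn0.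
  rewrite addnS factS expnS -mulnA; apply: leq_mul => //; lia.
have H2 : (n + m)`! * (n - m)`! <= (n + n)`!.
  rewrite -(@bin_fact (n + n) (n + m)) ?leq_add2l //.
  have -> : n + n - (n + m) = n - m by lia.
  by rewrite leq_pmull // bin_gt0 leq_add2l.
have H3 : (n + n)`! <= 4 ^ n * n`! * n`!.
  rewrite -(@bin_fact (n + n) n) ?leq_addr // addnK mulnA -!mulnA leq_mul2r.
  apply/orP; right; rewrite (_ : 4 ^ n = 2 ^ (n + n)); last by rewrite addnn -mul2n expnM.
  rewrite -[2 ^ _]/((1 + 1) ^ (n + n)) expnDn (bigD1 (inord n)) //= inordK ?ltnS ?leq_addr //.
  by rewrite !exp1n !muln1 leq_addr.
rewrite -(leq_pmul2r (fact_gt0 n)) mulnAC.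
apply: leq_trans (leq_mul H1 (leqnn _)) _; exact: leq_trans H2 H3.
Qed.

(** Induction on the size of [A], summing over all candidates for the reduction of
    [matching_or_twins]. The removed set contains at least a fraction 1/q of [A], so [C ^ #|X|]
    absorbs every factor that is exponential in the size of [A]. *)
Lemma count_Kfree k : exists2 C, 0 < C &
  forall (V : finType) (A : {set V}), #|Kfree_graphs k A| <= C ^ #|A| * #|A|`!.
Proof.
set q := reduction_ratio k; set t := (2 ^ k.+1).+1.
(* With a the size of [A], the power [b ^ a] covers, in this order, the choice of [X], the two kinds
   of reduction, the loss in [expn_fact_le] and the subsets counted by
   [card_matching_contraction]. *)
set b := 2 * (2 * (4 * 2 ^ (4 * t))).
have b0 : 0 < b by rewrite /b !muln_gt0 expn_gt0.
(* The factor 8 serves sets of a <= 3 vertices, where 2^(a^2) <= 8^a. *)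
exists (b ^ q * 8); first by rewrite muln_gt0 expn_gt0 b0.
move=> V A; set C := b ^ q * 8.
have [n] := ubnP #|A|; elim: n => // n IHn in A *; rewrite ltnS => An.
have [A3|A3] := leqP #|A| 3.
  apply: (@leq_trans #|powerset (setX A A)|).
    apply: subset_leq_card; apply/subsetP=> g; rewrite !inE => /KfreeP[gA _].
    by apply/subsetP=> -[x y] /(arcs_onP _ _ gA)[_ xA yA _]; apply/setXP.
  rewrite card_powerset cardsX; apply: (@leq_trans (C ^ #|A|)); last by rewrite leq_pmulr ?fact_gt0.
  have [->|a0] := posnP #|A|; first by rewrite muln0.
  rewrite expnM leq_exp2r //; apply: (@leq_trans (2 ^ 3)); first by rewrite leq_exp2l.
  by rewrite leq_pmull // expn_gt0 b0.
set a := #|A| in An A3 *.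
pose E := 2 ^ (4 * (t * a)).
(* The map is free on [X] only, with values in [A], which leaves a^m maps when [X] has m
   elements. *)
pose FX (X : {set V}) (v : V) : pred V := if v \in X then [in A] else pred1 v.
pose Q (u : {set V} * {ffun V -> V}) :=
  [&& u.1 \subset A, a <= q * #|u.1| & u.2 \in family (FX u.1)].
pose P g (u : {set V} * {ffun V -> V}) := matching_contraction A g u.1 u.2 || twin_deletion A g u.1 u.2.
apply: (@leq_trans (\sum_(u | Q u) #|[set g in Kfree_graphs k A | P g u]|)).
  under eq_bigr => u _ do rewrite -sum1_card.
  rewrite -sum1_card (exchange_big_dep (mem (Kfree_graphs k A))) /=; last first.
    by move=> u g _; rewrite !inE => /andP[].
  apply: leq_sum => g gK; have gF : Kfree k A g by rewrite inE in gK.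
  have [X [h [aq Pg]]] := matching_or_twins gF A3.
  have Qu : Q (X, h).
    have [XA hid hX] : [/\ X \subset A, forall v, v \notin X -> h v = v & forall v, v \in X -> h v \in A].
      case/orP: Pg => [/andP[/star_contractionP[-> hid hX] _]|/and3P[-> /forallP hid /forall_inP hX]].
        by split=> // v /hX[].
      by split=> // v vX; [apply/eqP/(implyP (hid v))|case/andP: (hX v vX) => /setDP[]].
    rewrite /Q /= XA aq; apply/familyP => v; rewrite /FX.
    by case: ifP => [/hX //|/negbT/hid hv]; rewrite inE hv.
  by rewrite (bigD1 (X, h)) //= Qu !inE gF.
have bnd u : Q u -> #|[set g in Kfree_graphs k A | P g u]| <= 2 * E * (C ^ (a - #|u.1|) * (a - #|u.1|)`!).
  case: u => X h /and3P[/= XA aq _].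
  have cX : #|A :\: X| = a - #|X| by rewrite cardsD (setIidPr XA).
  have IH : #|Kfree_graphs k (A :\: X)| <= C ^ (a - #|X|) * (a - #|X|)`!.
    rewrite -cX; apply: IHn; rewrite cX; apply: leq_trans An.
    rewrite ltn_subrL (leq_trans _ A3) // andbT lt0n; apply/eqP=> X0.
    by move: A3; rewrite ltnNge (leq_trans aq) // X0 muln0.
  have -> : [set g in Kfree_graphs k A | P g (X, h)] =
      [set g in Kfree_graphs k A | matching_contraction A g X h] :|:
      [set g in Kfree_graphs k A | twin_deletion A g X h].
    by apply/setP=> g; rewrite !inE andb_orr.
  apply: leq_trans (leq_card_setU _ _) _; rewrite -mulnA mul2n -addnn; apply: leq_add.
    by apply: leq_trans (card_matching_contraction _ _ _ _) _; rewrite mulnC leq_mul2l IH orbT.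
  apply: leq_trans (card_twin_deletion _ _ _ _) _; apply: leq_trans IH _.
  by rewrite leq_pmull // expn_gt0.
apply: leq_trans (leq_sum _ bnd) _.
have -> : \sum_(u | Q u) 2 * E * (C ^ (a - #|u.1|) * (a - #|u.1|)`!) =
    \sum_(X : {set V} | (X \subset A) && (a <= q * #|X|)) \sum_(h in family (FX X))
      2 * E * (C ^ (a - #|X|) * (a - #|X|)`!).
  by rewrite pair_big_dep /=; apply: eq_bigl => -[X h]; rewrite /Q /= andbA.
(* As [2 ^ a] is the number of subsets of [A], the two sides become sums over the same subsets and
   are compared term by term. *)
rewrite -(@leq_pmul2l (2 ^ a)) ?expn_gt0 // -[X in _ <= X * _]card_powerset.
rewrite -sum_nat_const big_distrr /= big_mkcondr /=.
under [X in _ <= X]eq_bigl => X do rewrite inE.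
apply: leq_sum => X XA; case: ifP => // aq.
have mX : #|X| <= a by apply: subset_leq_card.
rewrite sum_nat_const card_family foldrE big_map big_enum /=.
have -> : \prod_v #|FX X v| = a ^ #|X|.
  rewrite (bigID (mem X)) /= [X in _ * X]big1 ?muln1; last first.
    by move=> v /negPf vX; rewrite /FX vX card1.
  by rewrite -prod_nat_const; apply: eq_bigr => v vX; rewrite /FX vX.
have Cm : 2 ^ a * (2 * E * 4 ^ a) <= C ^ #|X|.
  apply: (@leq_trans (b ^ a)).
    rewrite /E /b !expnMn -expnM -mulnA leq_mul2l; apply/orP; right.
    rewrite -[4 * t * a]mulnA [4 ^ a * _]mulnC; apply: leq_mul => //.
    by rewrite -[X in X <= _]expn1 leq_exp2l // (leq_trans _ A3).
  apply: (@leq_trans (b ^ (q * #|X|))); first by rewrite leq_pexp2l.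
  rewrite expnM; apply: leq_trans (leq_pmulr _ _) _; last by rewrite /C expnMn.
  by rewrite expn_gt0.
have cE : C ^ a = C ^ #|X| * C ^ (a - #|X|) by rewrite -expnD subnKC.
have fE := expn_fact_le mX.
rewrite cE; move: Cm fE; move: (a - #|X|)`! (C ^ (a - #|X|)) (a ^ #|X|) (C ^ #|X|) (a`!) => u v w x y Cm fE.
have -> : 2 ^ a * (w * (2 * E * (v * u))) = (2 ^ a * (2 * E)) * v * (w * u) by lia.
have -> : x * v * y = x * (v * y) by lia.
apply: leq_trans (leq_mul (leqnn _) fE) _.
have -> : 2 ^ a * (2 * E) * v * (4 ^ a * y) = 2 ^ a * (2 * E * 4 ^ a) * (v * y) by lia.
by rewrite leq_mul2r Cm orbT.
Qed.

(** * Parity of winding numbers *)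

(** Here [n i j k] stands for the crossings of the edge ij seen from k, and [H a b] for the
    half-plane of the difference of a and b. Add the 15 relations, one for each pair of disjoint
    edges. Every [n i j k] occurs twice, as two edges at k avoid i and j. Every pair {a, b} occurs
    six times under [H], in either order; 15 of these 60 terms have the smaller index first, three
    for each choice of four vertices. So the sum is odd. *)
Lemma K5_parity (n : nat -> nat -> nat -> bool) (H : nat -> nat -> bool) :
  (forall a b, a < b < 5 -> H b a = ~~ H a b) ->
  (forall i j k l, i < j < 5 -> k < l < 5 -> i < k -> (k != j) && (l != j) ->
     n i j k (+) n i j l (+) (n k l j (+) H k j (+) H l j) (+) (n k l i (+) H k i (+) H l i) = false) ->
  False.
Proof.
move=> HN E.
(* A vanishing exclusive or is restated as an even sum of naturals, so that [lia] can add up the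
   relations. *)
have P (a b c d e f g h : bool) : (a (+) b (+) (c (+) d (+) e) (+) (f (+) g (+) h) = false) ->
  exists m : nat, a + b + c + d + e + f + g + h = 2 * m.
  move=> h0; exists (a + b + c + d + e + f + g + h)./2.
  by move: h0; case: a; case: b; case: c; case: d; case: e; case: f; case: g; case: h.
have Q i j k l a b c d := P _ _ _ _ _ _ _ _ (E i j k l a b c d).
have N a b : a < b < 5 -> (H b a + H a b = 1 :> nat) by move=> /HN ->; case: (H a b).
have := (N 0 1 isT, N 0 2 isT, N 0 3 isT, N 0 4 isT, N 1 2 isT, N 1 3 isT, N 1 4 isT, N 2 3 isT, N 2 4 isT, N 3 4 isT).
have [m1 e1] := Q 0 1 2 3 isT isT isT isT.
have [m2 e2] := Q 0 1 2 4 isT isT isT isT.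
have [m3 e3] := Q 0 1 3 4 isT isT isT isT.
have [m4 e4] := Q 0 2 1 3 isT isT isT isT.
have [m5 e5] := Q 0 2 1 4 isT isT isT isT.
have [m6 e6] := Q 0 2 3 4 isT isT isT isT.
have [m7 e7] := Q 0 3 1 2 isT isT isT isT.
have [m8 e8] := Q 0 3 1 4 isT isT isT isT.
have [m9 e9] := Q 0 3 2 4 isT isT isT isT.
have [m10 e10] := Q 0 4 1 2 isT isT isT isT.
have [m11 e11] := Q 0 4 1 3 isT isT isT isT.
have [m12 e12] := Q 0 4 2 3 isT isT isT isT.
have [m13 e13] := Q 1 2 3 4 isT isT isT isT.
have [m14 e14] := Q 1 3 2 4 isT isT isT isT.
have [m15 e15] := Q 1 4 2 3 isT isT isT isT.
move=> [[[[[[[[[f1 f2] f3] f4] f5] f6] f7] f8] f9] f10].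
clear Q P E N HN.
move: e1 e2 e3 e4 e5 e6 e7 e8 e9 e10 e11 e12 e13 e14 e15 f1 f2 f3 f4 f5 f6 f7 f8 f9 f10.
repeat match goal with |- context [nat_of_bool ?b] => move: (nat_of_bool b) => ? end.
lia.
Qed.

Lemma antisymmetric_of_disjoint (H : nat -> nat -> bool) :
  (forall i j k l, i < j < 5 -> k < l < 5 -> i < k -> (k != j) && (l != j) ->
    [/\ H k i = ~~ H i k, H l i = ~~ H i l, H k j = ~~ H j k & H l j = ~~ H j l]) ->
  forall a b, a < b < 5 -> H b a = ~~ H a b.
Proof.
move=> E.
have [a1 a2 a3 a4] := E 0 2 1 3 isT isT isT isT.
have [b1 b2 b3 b4] := E 0 1 2 3 isT isT isT isT.
have [c1 c2 c3 c4] := E 0 1 3 4 isT isT isT isT.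
have [d1 d2 d3 d4] := E 0 2 3 4 isT isT isT isT.
have [g1 g2 g3 g4] := E 0 3 1 4 isT isT isT isT.
have N x y : H x y = ~~ H y x -> H y x = ~~ H x y by move=> ->; rewrite negbK.
by move=> [|[|[|[|[|a]]]]] [|[|[|[|[|b]]]]] /andP[] // _ _; first [assumption|apply: N].
Qed.

Local Open Scope ring_scope.

Section Winding.
Variable R : realFieldType.
Implicit Types (z w : R * R) (e : R) (s t : seq (R * R)).

Definition near_pt e z w := (`|z.1 - w.1| < e) && (`|z.2 - w.2| < e).

Definition far_pt e z := (2 * e <= `|z.1|) || (2 * e <= `|z.2|).

(** On the horizontal axis only the positive half counts as upper, so that exactly one of z and -z
    is upper for every nonzero z ([upperN]). *)
Definition upper z := (0 < z.2) || ((z.2 == 0) && (0 < z.1)).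

(* Crossings of the positive horizontal half-axis: summed modulo 2 along a closed
   chain, they give the parity of its winding number around the origin. *)
Definition crossing z w := (upper z (+) upper w) && (0 < z.1).

Lemma near_ptP e z w :
  reflect [/\ - e < z.1 - w.1, z.1 - w.1 < e, - e < z.2 - w.2 & z.2 - w.2 < e] (near_pt e z w).
Proof.
rewrite /near_pt !ltr_norml; apply: (iffP andP) => [[/andP[? ?] /andP[? ?]] //|[-> -> -> ->] //].
Qed.

Lemma near_pt_sym e z w : near_pt e z w = near_pt e w z.
Proof. by rewrite /near_pt distrC [`|z.2 - _|]distrC. Qed.

Lemma far_ptP e z : reflect [\/ 2 * e <= z.1, 2 * e <= - z.1, 2 * e <= z.2 | 2 * e <= - z.2] (far_pt e z).
Proof.
rewrite /far_pt !ler_normr; apply: (iffP orP) => [[/orP[h|h]|/orP[h|h]]|[h|h|h|h]].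
- exact: Or41.
- exact: Or42.
- exact: Or43.
- exact: Or44.
- by left; rewrite h.
- by left; rewrite h orbT.
- by right; rewrite h.
- by right; rewrite h orbT.
Qed.

Lemma upperT z : upper z -> 0 <= z.2.
Proof. by move=> /orP[/ltW|/andP[/eqP -> _]]. Qed.

Lemma upperF z : ~~ upper z -> z.2 <= 0.
Proof. by rewrite negb_or -leNgt => /andP[]. Qed.

Lemma upper_near e z w : near_pt e z w -> upper z (+) upper w -> - e < z.2 < e.
Proof.
move=> /near_ptP[_ _ h1 h2].
case: (boolP (upper z)) => [/upperT hz|/upperF hz]; case: (boolP (upper w)) => [/upperT hw|/upperF hw] //= _.
all: apply/andP; split; lra.
Qed.

(** A far point less than e from the horizontal axis is at least 2e from the vertical one. So nearby
    points of this kind agree on the sign of the first coordinate, and each of them can evaluate the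
    crossing. *)
Lemma crossing_same_side e z w a : near_pt e z w -> near_pt e z a -> far_pt e z -> far_pt e a ->
  - e < a.2 < e -> crossing z w = (upper z (+) upper w) && (0 < a.1).
Proof.
move=> zw za fz fa /andP[a1 a2]; rewrite /crossing.
case E: (_ (+) _) => //=; have /andP[z1 z2] := upper_near zw E.
move/near_ptP: za => [h1 h2 h3 h4]; move/near_ptP: zw => [g1 g2 g3 g4].
case/far_ptP: fz => fz; case/far_ptP: fa => fa; try (exfalso; lra).
all: apply/idP/idP => h; try lra.
Qed.

(** A small quadrilateral away from the origin does not wind around it. If some point lies on the
    other side of the axis than [z1], all crossings can be evaluated with the sign at [z1], and a
    closed walk changes side an even number of times. *)
Lemma crossing_cell e z1 z2 z3 z4 :
  all (far_pt e) [:: z1; z2; z3; z4] ->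
  pairwise (near_pt e) [:: z1; z2; z3; z4] ->
  crossing z1 z2 (+) crossing z2 z3 (+) crossing z3 z4 (+) crossing z4 z1 = false.
Proof.
move=> /= /and5P[f1 f2 f3 f4 _]; rewrite !andbT => /andP[/and3P[n12 n13 n14] /andP[/andP[n23 n24] n34]].
have ns := near_pt_sym.
have e0 : 0 < e by move/near_ptP: n12 => [? ? ? ?]; lra.
have nn z : near_pt e z z by apply/near_ptP; split; lra.
have H w : near_pt e z1 w -> upper z1 (+) upper w ->
    crossing z1 z2 (+) crossing z2 z3 (+) crossing z3 z4 (+) crossing z4 z1 = false.
  move=> n1w /(upper_near n1w) b; rewrite !(@crossing_same_side e _ _ z1) // 1?ns //.
  by case: (0 < _); case: (upper z1); case: (upper z2); case: (upper z3); case: (upper z4).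
have [/(H _ n12) //|E12] := boolP (upper z1 (+) upper z2).
have [/(H _ n13) //|E13] := boolP (upper z1 (+) upper z3).
have [/(H _ n14) //|E14] := boolP (upper z1 (+) upper z4).
rewrite /crossing; move: E12 E13 E14.
by case: (upper z1); case: (upper z2); case: (upper z3); case: (upper z4).
Qed.

Lemma upperN z : z != 0 -> upper (- z) = ~~ upper z.
Proof.
move=> z0; rewrite /upper /= oppr_eq0 !oppr_gt0 negb_or negb_and -!leNgt.
have : (z.1 != 0) || (z.2 != 0).
  by rewrite -negb_and; apply: contra z0 => /andP[/eqP h1 /eqP h2]; rewrite [z]surjective_pairing h1 h2.
by case: (ltgtP z.2 0) => //= _; case: (ltgtP z.1 0).
Qed.

Lemma far_ptW e d z : d <= e -> far_pt e z -> far_pt d z.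
Proof. by move=> de /orP[] h; apply/orP; [left|right]; apply: le_trans h; rewrite ler_pM2l. Qed.

Lemma far_pt_neq0 e z : 0 < e -> far_pt e z -> z != 0.
Proof. by move=> e0 fz; apply/eqP=> zz; case/far_ptP: fz; rewrite zz /=; lra. Qed.

(** Crossings of the positive and of the negative half-axis add up to crossings of the whole axis,
    that is, to changes of side. *)
Lemma crossingN e z w : near_pt e z w -> far_pt e z ->
  crossing (- z) (- w) = crossing z w (+) upper z (+) upper w.
Proof.
move=> zw fz; have e0 : 0 < e by move/near_ptP: zw => [? ? ? ?]; lra.
have z0 := far_pt_neq0 e0 fz.
have w0 : w != 0.
  apply/eqP=> zz; move/near_ptP: zw; rewrite zz /= => -[? ? ? ?]; case/far_ptP: fz; lra.
rewrite /crossing !upperN //; case E: (upper z (+) upper w); last first.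
  by move: E; case: (upper z); case: (upper w).
have /andP[z1 z2] := upper_near zw E.
have : (0 < (- z).1) = ~~ (0 < z.1).
  rewrite /= oppr_gt0 -leNgt; case/far_ptP: fz => ?; apply/idP/idP => ?; lra.
by move=> ->; move: E; case: (upper z); case: (upper w); case: (0 < z.1).
Qed.

Lemma crossing_sym e z w : near_pt e z w -> far_pt e z -> far_pt e w -> crossing z w = crossing w z.
Proof.
move=> zw fz fw; case E: (upper z (+) upper w); last by rewrite /crossing E addbC E.
have b := upper_near zw E; have wz : near_pt e w z by rewrite near_pt_sym.
have zz : near_pt e z z by apply/near_ptP; move/near_ptP: zw => [? ? ? ?]; split; lra.
by rewrite (@crossing_same_side e z w z) // (@crossing_same_side e w z z) // addbC.
Qed.

Fixpoint crossings z s := if s is w :: s' then crossing z w (+) crossings w s' else false.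

Lemma crossingsN e z s : path (near_pt e) z s -> all (far_pt e) (z :: s) ->
  crossings (- z) (map -%R s) = crossings z s (+) upper z (+) upper (last z s).
Proof.
elim: s z => [|w s IH] z /=; first by rewrite addbb.
move=> /andP[zw ps] /andP[fz fs]; rewrite (crossingN zw fz) IH //.
by case: (crossing z w); case: (crossings w s); case: (upper z); case: (upper w); case: (upper _).
Qed.

Lemma near_pt_shift e z w a : near_pt e (z - a) (w - a) = near_pt e z w.
Proof.
by rewrite /near_pt /=; congr (_ && _); congr (`|_| < _); ring.
Qed.

Lemma near_pt_flip e z w a : near_pt e (a - z) (a - w) = near_pt e z w.
Proof.
by rewrite near_pt_sym /near_pt /=; congr (_ && _); congr (`|_| < _); ring.
Qed.

Lemma near_pt_trans e z w a : near_pt e z w -> near_pt e w a -> near_pt (2 * e) z a.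
Proof.
move=> /near_ptP[h1 h2 h3 h4] /near_ptP[g1 g2 g3 g4]; apply/near_ptP; split; lra.
Qed.

Lemma near_ptW e z w : near_pt e z w -> near_pt (2 * e) z w.
Proof. by move=> /near_ptP[h1 h2 h3 h4]; apply/near_ptP; split; lra. Qed.

Definition chains_far e s t := all (fun z => all (fun w => far_pt e (z - w)) t) s.

Lemma crossing_strip e z z' w t :
  near_pt e z z' -> path (near_pt e) w t -> chains_far (2 * e) [:: z; z'] (w :: t) ->
  crossing (z - w) (z' - w) (+) crossings (z' - w) [seq z' - x | x <- t] (+)
  crossing (z - last w t) (z' - last w t) (+) crossings (z - w) [seq z - x | x <- t] = false.
Proof.
move=> zz; elim: t w => [|a t IH] w /=; first by rewrite !addbF addbb.
move=> /andP[wa pt]; rewrite /chains_far /= andbT => /andP[/and3P[f1 f2 f3] /and3P[f4 f5 f6]].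
have := IH a pt; rewrite /chains_far /= f2 f3 f5 f6 => /(_ isT).
have := @crossing_cell (2 * e) (z - w) (z' - w) (z' - a) (z - a).
rewrite /= f1 f2 f4 f5 /= !andbT.
rewrite !near_pt_shift !near_pt_flip (near_ptW zz) (near_ptW wa) /=.
have -> : near_pt (2 * e) (z - w) (z' - a).
  by apply: (@near_pt_trans _ _ (z' - w)); rewrite ?near_pt_shift ?near_pt_flip.
have -> : near_pt (2 * e) (z' - w) (z - a).
  by apply: (@near_pt_trans _ _ (z - w)); rewrite ?near_pt_shift ?near_pt_flip // near_pt_sym.
rewrite [near_pt _ z' z]near_pt_sym (near_ptW zz) => /(_ isT isT).
rewrite -(@crossing_sym (2 * e) (z - a)) // 1?near_pt_shift ?(near_ptW zz) //.
rewrite -(@crossing_sym (2 * e) (z - w)) // 1?near_pt_flip ?(near_ptW wa) //.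
set c1 := crossing (z - w) _; set c2 := crossing (z' - w) _; set c3 := crossing (z - a) _.
set c4 := crossing (z - w) (z - a); set c5 := crossings _ _; set c6 := crossing _ _; set c7 := crossings _ _.
by case: c1; case: c2; case: c3; case: c4; case: c5; case: c6; case: c7.
Qed.

(** The differences between points of the two chains form a grid that avoids the origin. Each cell
    has even crossing number and inner sides cancel, so the four outer sides add up to 0. Cells are
    treated at scale 2e because a diagonal combines two steps. *)
Lemma crossing_grid e z s w t :
  path (near_pt e) z s -> path (near_pt e) w t -> chains_far (2 * e) (z :: s) (w :: t) ->
  crossings (z - w) [seq x - w | x <- s] (+)
  crossings (last z s - w) [seq last z s - x | x <- t] (+)
  crossings (z - last w t) [seq x - last w t | x <- s] (+)
  crossings (z - w) [seq z - x | x <- t] = false.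
Proof.
move=> + pt; elim: s z => [|a s IH] z /=; first by rewrite addbF addbb.
move=> /andP[za ps] /andP[fz fs]; have := IH a ps fs.
have /andP[fa _] := fs.
have := @crossing_strip e z a w t za pt; rewrite /chains_far /= fz fa => /(_ isT).
set c1 := crossing _ _; set c2 := crossings _ _; set c3 := crossing _ _.
set c4 := crossings (z - w) _; set c5 := crossings (a - w) _; set c6 := crossings _ _; set c7 := crossings _ _.
by case: c1; case: c2; case: c3; case: c4; case: c5; case: c6; case: c7.
Qed.

(* A chain system for K5: a "drawing" by chains with steps smaller than e, two chains of
   disjoint edges being at distance at least 4 e. *)
Lemma no_K5_chains e (p : nat -> R * R) (c : nat -> nat -> seq (R * R)) : 0 < e ->
  (forall i j, i < j < 5 -> path (near_pt e) (p i) (c i j) /\ last (p i) (c i j) = p j)%N ->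
  (forall i j k l, i < j < 5 -> k < l < 5 -> i < k -> (k != j) && (l != j) ->
     chains_far (2 * e) (p i :: c i j) (p k :: c k l))%N -> False.
Proof.
move=> e0 cP cF.
have e20 : 0 < 2 * e by lra.
pose H a b := upper (p a - p b).
have ends i j k l : (i < j < 5)%N -> (k < l < 5)%N -> (i < k)%N -> (k != j) && (l != j) ->
    [/\ H k i = ~~ H i k, H l i = ~~ H i l, H k j = ~~ H j k & H l j = ~~ H j l].
  move=> ij kl ik kjlj; have /allP far := cF i j k l ij kl ik kjlj.
  have [_ lij] := cP i j ij; have [_ lkl] := cP k l kl.
  have main a b : a \in p i :: c i j -> b \in p k :: c k l -> upper (b - a) = ~~ upper (a - b).
    by move=> /far/allP h /h /(far_pt_neq0 e20) ab; rewrite -opprB upperN.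
  have mj : p j \in p i :: c i j by rewrite -lij mem_last.
  have ml : p l \in p k :: c k l by rewrite -lkl mem_last.
  by split; apply: main; rewrite ?mem_head.
pose n i j k := crossings (p i - p k) [seq x - p k | x <- c i j].
apply: (@K5_parity n H).
  exact: antisymmetric_of_disjoint ends.
move=> i j k l ij kl ik kjlj; have [pij lij] := cP i j ij; have [pkl lkl] := cP k l kl.
have far := cF i j k l ij kl ik kjlj.
have := crossing_grid pij pkl far; rewrite lij lkl -/(n i j k) -/(n i j l).
(* On the sides where the second point moves, the differences a - x are turned into x - a; this
   brings in the half-planes of both ends, the [H] terms of [K5_parity]. *)
have flip a : a \in p i :: c i j ->
    crossings (a - p k) [seq a - x | x <- c k l] =
    crossings (p k - a) [seq x - a | x <- c k l] (+) upper (p k - a) (+) upper (p l - a).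
  move=> ai; have /allP fara := allP far a ai.
  have -> : [seq a - x | x <- c k l] = map -%R [seq x - a | x <- c k l].
    by rewrite -map_comp; apply: eq_map => x /=; rewrite opprB.
  rewrite -[a - p k]opprB (@crossingsN (2 * e)).
  - by rewrite (last_map (fun x => x - a)) lkl.
  - have /= -> := @path_map _ _ (fun x => x - a) (near_pt (2 * e)) (p k) (c k l);
      apply: sub_path pkl => x y xy /=; by rewrite near_pt_shift near_ptW.
  - apply/allP=> z zin; have /mapP[x xkl ->] : z \in map (fun x => x - a) (p k :: c k l) by exact: zin.
    by have := fara x xkl; rewrite -[x - a]opprB /far_pt /= !normrN.
rewrite !flip ?mem_head //; last by rewrite -lij mem_last.
rewrite -/(n k l j) -/(n k l i) /H.
set c1 := n i j k; set c2 := n k l j; set c3 := n i j l; set c4 := n k l i.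
set h1 := upper _; set h2 := upper _; set h3 := upper _; set h4 := upper _.
by case: c1; case: c2; case: c3; case: c4; case: h1; case: h2; case: h3; case: h4.
Qed.
End Winding.

From mathcomp Require Import all_classical all_reals all_analysis.
Import numFieldNormedType.Exports.

Local Open Scope classical_set_scope.
Local Open Scope ring_scope.

(** * Planar graphs have no K5 minor *)

Local Notation edges V := {set {set V}}.

Section Drawing.
Variables (R : realType) (V : finType).
Implicit Types (E : edges V) (p : V -> R * R) (c : {set V} -> R -> R * R).

(** This is [plane_drawing] over any finite vertex type: subdivision and gluing produce graphs on
    [option] and sum types. *)
Definition drawn E p c : Prop :=
  [/\ injective p,
      (forall e, e \in E ->
         {within `[0, 1], continuous (c e)} /\
         {in `[0, 1] &, injective (c e)}),
      (forall e, e \in E -> [set c e 0; c e 1] = p @` [set` e]),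
      (forall e v t, e \in E -> t \in `]0, 1[ -> c e t <> p v) &
      (forall e e' s t, e \in E -> e' \in E -> e != e' ->
         s \in `]0, 1[ -> t \in `]0, 1[ -> c e s <> c e' t)].

Lemma near_ptE (e : R) (z w : R * R) : near_pt e z w = (`|z - w| < e).
Proof. by rewrite /near_pt prod_normE /= gt_max. Qed.

Lemma within_near (f : R -> R * R) x e : {within `[0, 1], continuous f} ->
  x \in `[0, 1] -> 0 < e ->
  exists2 d, 0 < d & forall t, t \in `[0, 1] -> `|t - x| < d -> near_pt e (f x) (f t).
Proof.
move=> /subspace_continuousP fc x01 e0.
have /cvgrPdist_lt/(_ e e0) := fc x x01.
rewrite /= /within /= => /nbhs_ballP[d /= d0 H]; exists d => // t t01 tx.
by rewrite near_ptE; apply: H => //=; rewrite /ball /= distrC.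
Qed.

(** The parameters reachable by such chains have a supremum; continuity there shows that it is
    reached and, if it were less than 1, that it could be passed. *)
Lemma arc_chain (f : R -> R * R) e : {within `[0, 1], continuous f} -> 0 < e ->
  exists s, [/\ path (near_pt e) (f 0) s, last (f 0) s = f 1 &
    forall z, z \in s -> exists2 t, t \in `[0, 1] & z = f t].
Proof.
move=> fc e0.
pose P t := exists s, [/\ path (near_pt e) (f 0) s, last (f 0) s = f t &
    forall z, z \in s -> exists2 t, t \in `[0, 1] & z = f t].
pose S := [set t | t \in `[0, 1] /\ P t].
have S0 : S 0 by split; [rewrite in_itv /= lexx ler01|exists [::]].
have Sub : ubound S 1 by move=> t [+ _]; rewrite in_itv /= => /andP[].
have hS : has_sup S by split; [exists 0|exists 1].
set u := sup S.
have u01 : u \in `[0, 1].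
  by rewrite in_itv /= (ub_le_sup _ S0) ?ge_sup //; [exists 0|exists 1].
have e20 : 0 < e / 2 by lra.
have [d d0 H] := within_near fc u01 e20.
have [t [t01 [s [ps ls sP]]] tu] := sup_adherent d0 hS.
have tu' : t <= u by apply: ub_le_sup; [exists 1|split=> //; exists s].
have all_near t' : t' \in `[0, 1] -> `|t' - u| < d -> S t'.
  move=> t'01 t'u; split=> //; exists (rcons s (f t')); split.
  - rewrite rcons_path ps ls /=.
    have -> : e = 2 * (e / 2) by field.
    apply: (@near_pt_trans _ _ _ (f u)); last exact: H.
    rewrite near_pt_sym; apply: H => //; rewrite ltr_norml; apply/andP; split; rewrite -/u in tu; lra.
  - by rewrite last_rcons.
  - by move=> z; rewrite mem_rcons inE => /orP[/eqP ->|/sP//]; exists t'.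
have u1 : u = 1.
  move: u01; rewrite in_itv /= => /andP[u0 u1].
  apply/eqP; rewrite eq_le u1 /= leNgt; apply/negP=> ult.
  pose t' := Num.min 1 (u + d / 2).
  have ut' : u < t' by rewrite lt_min ult; lra.
  have : t' <= u.
    apply: ub_le_sup; first by exists 1 => //.
    apply: all_near; first by rewrite in_itv /= ge_min lexx andbT; lra.
    rewrite gtr0_norm; last by lra.
    have : t' <= u + d / 2 by rewrite ge_min lexx orbT.
    lra.
  lra.
have h1 : (1 : R) \in `[0, 1] by rewrite in_itv /= lexx ler01.
have h2 : `|1 - u| < d by rewrite u1 subrr normr0.
by have [] := all_near 1 h1 h2.
Qed.

Lemma arc_compact (f : R -> R * R) : {within `[0, 1], continuous f} -> compact (f @` `[0, 1]).
Proof. by move=> fc; apply: continuous_compact => //; apply: segment_compact. Qed.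

(** The distance has a positive minimum on the product. It is halved because [far_pt d] means
    distance at least 2d. *)
Lemma compact_far (A B : set (R * R)) : compact A -> compact B -> A `&` B = set0 ->
  exists2 d, 0 < d & forall x y, A x -> B y -> far_pt d (x - y).
Proof.
move=> cA cB AB.
have [->|/set0P[a Aa]] := eqVneq A set0; first by exists 1 => //.
have [->|/set0P[b Bb]] := eqVneq B set0; first by exists 1 => //.
have AB0 : (A `*` B) !=set0 by exists (a, b).
have cAB : compact (A `*` B) by exact: compact_setX.
have fc : {within A `*` B, continuous (fun z : (R * R) * (R * R) => `|z.1 - z.2|)}.
  apply: continuous_subspaceT => z; apply: cvg_norm; apply: cvgB; [exact: cvg_fst|exact: cvg_snd].
have [[x y] /set_mem[/= Ax By] m] := compact_EVT_min AB0 cAB fc.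
exists (`|x - y| / 2).
  rewrite divr_gt0 // normr_gt0 subr_eq0; apply/eqP=> xy.
  have : (A `&` B) x by split=> //; rewrite xy.
  by rewrite AB.
move=> x' y' Ax' By'; have := m (x', y'); rewrite inE /= => /(_ (conj Ax' By')).
by rewrite prod_normE le_max /far_pt /= mulrCA mulfV ?mulr1 //.
Qed.
End Drawing.

Lemma finite_family_pos (R : realType) (I : finType) (P : I -> R -> Prop) :
  (forall i d d', P i d -> 0 < d' <= d -> P i d') -> (forall i, exists2 d, 0 < d & P i d) ->
  exists2 d, 0 < d & forall i, P i d.
Proof.
move=> mono ex.
have /choice[f fP] : forall i, exists d, 0 < d /\ P i d by move=> i; have [d d0 Pd] := ex i; exists d.
exists (\big[Num.min/1]_i f i); first by apply: lt_bigmin => // i _; have [] := fP i.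
move=> i; apply: mono (fP i).2 _; rewrite bigmin_le_cond // andbT.
by apply: lt_bigmin => // j _; have [] := fP j.
Qed.

Section PlanarMinor.
Variables (R : realType) (V : finType).
Implicit Types (E : edges V) (B : {set V}) (p : V -> R * R) (c : {set V} -> R -> R * R).

Definition arcs_of E : {set V * V} := [set u | (u.1 != u.2) && ([set u.1; u.2]%SET \in E)]%SET.

Lemma arcs_ofP E x y : reflect (x != y /\ [set x; y]%SET \in E) ((x, y) \in arcs_of E).
Proof. by rewrite inE /=; apply: andP. Qed.

Lemma arcs_of_on E : arcs_on [set: V]%SET (arcs_of E).
Proof.
apply/arcs_onP => x y /arcs_ofP[xy xyE]; rewrite xy !inE; split=> //=.
by rewrite eq_sym xy finset.setUC.
Qed.

Lemma in01_0 : (0 : R) \in `[0, 1]. Proof. by rewrite in_itv /= lexx ler01. Qed.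
Lemma in01_1 : (1 : R) \in `[0, 1]. Proof. by rewrite in_itv /= lexx ler01. Qed.

Lemma drawn_ends E p c e t : drawn E p c -> e \in E -> t \in `[0, 1] ->
  (t \in `]0, 1[) \/ exists2 v, v \in e & c e t = p v.
Proof.
case=> _ _ ends _ _ eE; rewrite in_itv /= => /andP[t0 t1].
have endv z : [set c e 0; c e 1] z -> exists2 v, v \in e & z = p v.
  by rewrite ends // => -[v /= ve <-]; exists v.
have [->|tn0] := eqVneq t 0; first by right; apply: endv; left.
have [->|tn1] := eqVneq t 1; first by right; apply: endv; right.
by left; rewrite in_itv /= !lt_neqAle eq_sym tn0 tn1 t0 t1.
Qed.

Lemma drawn_end_vertex E p c e v : drawn E p c -> e \in E -> v \in e ->
  c e 0 = p v \/ c e 1 = p v.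
Proof.
case=> _ _ ends _ _ eE ve; have : (p @` [set` e]) (p v) by exists v.
by rewrite -(ends e eE) => -[] ->; [left|right].
Qed.

Lemma drawn_disjoint E p c e e' s t : drawn E p c -> e \in E -> e' \in E -> [disjoint e & e']%B ->
  e != e' -> s \in `[0, 1] -> t \in `[0, 1] -> c e s <> c e' t.
Proof.
move=> dr eE eE' dis ne s01 t01; have [inj _ _ iv ii] := dr.
case: (drawn_ends dr eE s01) => [si|[v ve ->]]; case: (drawn_ends dr eE' t01) => [ti|[w we ->]].
- exact: ii.
- exact: iv.
- by move=> E'; apply: (iv e' v t) => //.
- by move=> /inj vw; move: (disjointFr dis ve); rewrite vw we.
Qed.

Lemma drawn_far E p c : drawn E p c -> exists2 d, 0 < d &
  forall e e' s t, e \in E -> e' \in E -> [disjoint e & e']%B -> e != e' ->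
    s \in `[0, 1] -> t \in `[0, 1] -> far_pt d (c e s - c e' t).
Proof.
move=> dr; have [_ cc _ _ _] := dr.
pose P (u : {set V} * {set V}) d := u.1 \in E -> u.2 \in E -> [disjoint u.1 & u.2]%B ->
  u.1 != u.2 -> forall s t, s \in `[0, 1] -> t \in `[0, 1] -> far_pt d (c u.1 s - c u.2 t).
have [||d d0 H] := @finite_family_pos R _ P.
- move=> u d d' Pd /andP[d'0 d'd] u1 u2 u3 u4 s t s01 t01.
  exact: far_ptW d'd (Pd u1 u2 u3 u4 s t s01 t01).
- move=> u; have [u1|] := boolP (u.1 \in E); last by move=> n; exists 1 => //; move=> n'; rewrite n' in n.
  have [u2|] := boolP (u.2 \in E); last by move=> n; exists 1 => //; move=> ? n'; rewrite n' in n.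
  have [u3|] := boolP [disjoint u.1 & u.2]%B; last by move=> n; exists 1 => //; move=> ? ? n'; rewrite n' in n.
  have [u4|] := eqVneq u.1 u.2; first by exists 1 => //; move=> ? ? ?; rewrite u4 eqxx.
  move=> ne.
  have [] := @compact_far R (c u.1 @` `[0, 1]) (c u.2 @` `[0, 1]).
  + by apply: arc_compact; have [] := cc _ u1.
  + by apply: arc_compact; have [] := cc _ u2.
  + rewrite -subset0 => z [[s /= s01 <-] [t /= t01 E']].
    by apply: (drawn_disjoint dr u1 u2 u3 ne s01 t01).
  + by move=> d d0 H; exists d => // _ _ _ _ s t s01 t01; apply: H; [exists s|exists t].
- by exists d => // e e' s t eE eE' dis ne; apply: (H (e, e')).
Qed.

Definition covered E c B (z : R * R) := exists e t, [/\ e \in E, e \subset B, t \in `[0, 1] & z = c e t].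

Lemma step_chain E p c B x y e : drawn E p c -> 0 < e ->
  step (arcs_of E) B x y ->
  exists s, [/\ path (near_pt e) (p x) s, last (p x) s = p y & forall z, z \in p x :: s -> covered E c B z].
Proof.
move=> dr e0 /and3P[/arcs_ofP[xy xyE] xB yB].
set f := [set x; y]%SET in xyE.
have fB : (f \subset B)%SET by rewrite finset.subUset !finset.sub1set xB yB.
have [_ cc _ _ _] := dr; have [fc fi] := cc f xyE.
have [s [ps ls sP]] := arc_chain fc e0.
have ne01 : c f 0 <> c f 1 by move=> /(fi _ _ in01_0 in01_1)/eqP; rewrite eq_sym oner_eq0.
have sC z : z \in c f 0 :: s -> covered E c B z.
  rewrite inE => /orP[/eqP ->|/sP[t t01 ->]]; first by exists f, 0; rewrite in01_0.
  by exists f, t.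
have ex : x \in f by rewrite !inE eqxx.
have ey : y \in f by rewrite !inE eqxx orbT.
have [inj _ _ _ _] := dr.
have pxy : p x <> p y by move=> /inj/eqP; rewrite (negPf xy).
case: (drawn_end_vertex dr xyE ex) => hx; case: (drawn_end_vertex dr xyE ey) => hy.
- by rewrite -hx -hy in pxy.
- by rewrite -hx -hy; exists s.
- rewrite -hx -hy -ls; exists (rev (belast (c f 0) s)); split.
  + by rewrite rev_path; apply: sub_path ps => a b; rewrite near_pt_sym.
  + by case: s {ps ls sP sC} => //= a s; rewrite rev_cons last_rcons.
  + move=> z zs; apply: sC; move: zs; rewrite inE mem_rev => /orP[/eqP ->|]; first exact: mem_last.
    exact: mem_belast.
- by rewrite -hx -hy in pxy.
Qed.

Lemma connect_chain E p c B x y e : drawn E p c -> 0 < e -> x != y ->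
  connect (step (arcs_of E) B) x y ->
  exists s, [/\ path (near_pt e) (p x) s, last (p x) s = p y & forall z, z \in p x :: s -> covered E c B z].
Proof.
move=> dr e0 xy /connectP[q pq lq]; move: xy; rewrite {}lq.
elim: q x pq => [x _|a q IH x /= /andP[xa pq] _]; first by rewrite eqxx.
have [s [ps ls sP]] := step_chain dr e0 xa.
have [E0|ne] := eqVneq a (last a q); first by rewrite -E0; exists s.
have [s' [ps' ls' sP']] := IH a pq ne.
exists (s ++ s'); split; first by rewrite cat_path ps ls.
  by rewrite last_cat ls.
move=> z; rewrite -cat_cons mem_cat => /orP[/sP //|zs']; apply: sP'; by rewrite inE zs' orbT.
Qed.

Lemma model_connect A (g : {set V * V}) (s : seq {set V}) i j x y : complete_model g A s -> (i < j < size s)%N ->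
  x \in nth finset.set0 s i -> y \in nth finset.set0 s j ->
  connect (step g (nth finset.set0 s i :|: nth finset.set0 s j)%SET) x y.
Proof.
move=> /andP[/allP sA /(pairwiseP finset.set0) sp] /andP[ij js] xi yj.
have is_ := ltn_trans ij js.
have /andP[_ /connP[_ ci]] := sA _ (mem_nth finset.set0 is_).
have /andP[_ /connP[_ cj]] := sA _ (mem_nth finset.set0 js).
have /andP[_ /touchP[a [b [ai bj ab]]]] := sp i j is_ js ij.
apply: connect_trans (step_connect_mono (subxx _) (finset.subsetUl _ _) (ci x a xi ai)) _.
apply: connect_trans (step_connect_mono (subxx _) (finset.subsetUr _ _) (cj b y bj yj)).
by apply: connect1; rewrite /step /= ab !inE ai bj orbT.
Qed.

(** Two branch sets give a chain between chosen representatives that runs along edges inside their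
    union. For four different branch sets the two chains use edges without common vertices, and
    compactness keeps those at a uniform distance [d]. Chains with a common branch set may overlap,
    which [no_K5_chains] permits. *)
Theorem drawn_Kfree E p c : drawn E p c -> Kfree 5 [set: V]%SET (arcs_of E).
Proof.
move=> dr; apply/KfreeP; split; first exact: arcs_of_on.
move=> [s s5 sm]; have [d d0 dfar] := drawn_far dr.
have /andP[/allP sA /(pairwiseP finset.set0) sp] := sm.
pose B i := nth finset.set0 s i.
have Bdis i j : (i < 5)%N -> (j < 5)%N -> i != j -> [disjoint B i & B j]%B.
  rewrite -s5 => i5 j5; rewrite neq_ltn => /orP[ij|ij]; first by have /andP[] := sp i j i5 j5 ij.
  by rewrite disjoint_sym; have /andP[] := sp j i j5 i5 ij.
have /choice[r rP] : forall i, exists v, (i < 5)%N -> v \in B i.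
  move=> i; have [i5|i5] := boolP (i < 5)%N.
    have /andP[_ /connP[/set0Pn[v vB] _]] : (B i \subset [set: V]%SET) && conn (arcs_of E) (B i).
      by apply: sA; apply: mem_nth; rewrite s5.
    by exists v.
  have /andP[_ /connP[/set0Pn[v vB] _]] : (B 0%N \subset [set: V]%SET) && conn (arcs_of E) (B 0%N).
    by apply: sA; apply: mem_nth; rewrite s5.
  by exists v.
have e0 : 0 < d / 2 by lra.
have /choice[ch chP] : forall u : nat * nat, exists t, (u.1 < u.2 < 5)%N ->
    [/\ path (near_pt (d / 2)) (p (r u.1)) t, last (p (r u.1)) t = p (r u.2) &
        forall z, z \in p (r u.1) :: t -> covered E c (B u.1 :|: B u.2)%SET z].
  move=> [i j] /=; have [ij5|] := boolP (i < j < 5)%N; last by exists [::].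
  have /andP[ij j5] := ij5; have i5 := ltn_trans ij j5.
  have rij : r i != r j.
    apply/eqP=> rr; have := disjointFr (Bdis i j i5 j5 (negbT (ltn_eqF ij))) (rP i i5).
    by rewrite rr rP.
  have [|t tP] := @connect_chain E p c (B i :|: B j)%SET (r i) (r j) (d / 2) dr e0 rij.
    by apply: model_connect sm _ _ _; rewrite ?s5 ?ij5 //; apply: rP.
  by exists t.
apply: (@no_K5_chains R (d / 2) (fun i => p (r i)) (fun i j => ch (i, j)) e0).
  by move=> i j ij; have [] := chP (i, j) ij.
move=> i j k l ij kl ik /andP[kj lj].
have [_ _ c1] := chP (i, j) ij; have [_ _ c2] := chP (k, l) kl.
have [/andP[ij' j5] /andP[kl' l5]] := (ij, kl).
have i5 := ltn_trans ij' j5; have k5 := ltn_trans kl' l5.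
have dis : [disjoint (B i :|: B j)%SET & (B k :|: B l)%SET]%B.
  have il : (i < l)%N := ltn_trans ik kl'.
  rewrite -setI_eq0 finset.setIUl !finset.setIUr.
  by rewrite !(disjoint_setI0 (Bdis _ _ _ _ _)) ?finset.setU0 // 1?eq_sym // ?(negbT (gtn_eqF _)).
apply/allP=> z /c1[e [s1 [eE eB s01 ->]]]; apply/allP=> w /c2[e' [t1 [eE' eB' t01 ->]]].
have -> : 2 * (d / 2) = d by field.
have dee : [disjoint e & e']%B by apply: disjointWl eB _; apply: disjointWr eB' dis.
apply: dfar => //; apply/eqP=> ee; move: dee; rewrite -ee -setI_eq0 finset.setIid => /eqP e_0.
have [_ _ ends _ _] := dr; have : [set c e 0; c e 1] (c e 0) by left.
by rewrite ends // e_0 => -[v /=]; rewrite finset.in_set0.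
Qed.
End PlanarMinor.

(** * Gluing drawings at a new vertex of an edge *)

Section Accessible.
Variable R : realType.
Implicit Types (f : R -> R * R) (x y z q u w : R * R).

(** Connectedness of [0, 1] in chain form: the parts of the path in [A] and in [B] are disjoint
    compact sets, and a chain with steps below their distance cannot change part. *)
Lemma path_stays f (A B : set (R * R)) : {within `[0, 1], continuous f} ->
  compact A -> compact B -> (forall t, t \in `[0, 1] -> A (f t) \/ B (f t)) ->
  (forall t, t \in `[0, 1] -> A (f t) -> ~ B (f t)) -> A (f 0) -> A (f 1).
Proof.
move=> fc cA cB AB nAB A0.
have cf := arc_compact fc.
have hR : hausdorff_space (R * R)%type by exact: norm_hausdorff.
have clf := compact_closed hR cf.
have cA' := compact_closedI cA clf; have cB' := compact_closedI cB clf.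
have [|d d0 far] := compact_far cA' cB'.
  by rewrite -subset0 => z [[Az [t /= t01 tz]] [Bz _]]; apply: (nAB t t01); rewrite tz.
have [s [ps ls sP]] := arc_chain fc d0.
have im t : t \in `[0, 1] -> (f @` `[0, 1]) (f t) by move=> t01; exists t.
rewrite -ls; have : forall z, z \in s -> exists2 t, t \in `[0, 1] & z = f t by [].
have : exists2 t, t \in `[0, 1] & f 0 = f t by exists 0; rewrite ?in01_0.
elim: s (f 0) A0 ps {ls sP} => //= z s IH y Ay /andP[yz ps] [t t01 yt] sP.
have [t' t'01 zt'] := sP z (mem_head _ _).
apply: (IH z) => //; last by move=> w ws; apply: sP; rewrite inE ws orbT.
  have [|Bz] := AB t' t'01; first by rewrite -zt'.
  have Ay' : (A `&` f @` `[0, 1]) y by split=> //; rewrite yt; apply: im.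
  have Bz' : (B `&` f @` `[0, 1]) z by split=> //; rewrite zt' //; apply: im.
  have /far_ptP := far y z Ay' Bz'; move/near_ptP: yz => /= [? ? ? ?] h.
  by exfalso; case: h => h; lra.
by exists t'.
Qed.

Lemma cvg_pt (T : Type) (F : set_system T) {FF : Filter F} (f g : T -> R) (a b : R) :
  f x @[x --> F] --> a -> g x @[x --> F] --> b -> ((f x, g x) : R * R) @[x --> F] --> ((a, b) : R * R).
Proof. by move=> fa gb; exact: (cvg_pair fa gb). Qed.

Lemma segment_continuous (a b : R * R) :
  continuous (fun t : R => (a.1 + t * (b.1 - a.1), a.2 + t * (b.2 - a.2)) : R * R).
Proof.
move=> t; apply: cvg_pt; apply: cvgD; try exact: cvg_cst; apply: cvgM; try exact: cvg_cst; exact: cvg_id.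
Qed.

Lemma convex_lt (u v m t : R) : 0 <= t <= 1 -> u < m -> v < m -> u + t * (v - u) < m.
Proof.
move=> /andP[t0 t1] um vm.
have a2 : 0 <= (1 - t) * (m - u) by rewrite mulr_ge0 ?subr_ge0 // ltW.
case: (ltP 0 t) => h; last first.
  have -> : t = 0 by lra.
  by rewrite mul0r addr0.
have : 0 < t * (m - v) by rewrite mulr_gt0 // subr_gt0.
lra.
Qed.

Lemma near_pt_convex d y (a b : R * R) t : 0 <= t <= 1 -> near_pt d y a -> near_pt d y b ->
  near_pt d y (a.1 + t * (b.1 - a.1), a.2 + t * (b.2 - a.2)).
Proof.
move=> t01 /near_ptP[a1 a2 a3 a4] /near_ptP[b1 b2 b3 b4]; apply/near_ptP => /=.
have h1 : a.1 + t * (b.1 - a.1) < d + y.1 by apply: convex_lt => //; lra.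
have h2 : a.2 + t * (b.2 - a.2) < d + y.2 by apply: convex_lt => //; lra.
have h3 : - a.1 + t * (- b.1 - - a.1) < d - y.1 by apply: convex_lt => //; lra.
have h4 : - a.2 + t * (- b.2 - - a.2) < d - y.2 by apply: convex_lt => //; lra.
split; lra.
Qed.

(** If the arc filled a neighbourhood of its midpoint y, its two closed halves would cover it and
    meet only in y. But points on both halves are joined there by two segments avoiding y, and by
    [path_stays] each segment remains in one half. *)
Lemma arc_interior f d : {within `[0, 1], continuous f} -> {in `[0, 1] &, injective f} -> 0 < d ->
  exists q, near_pt d (f (1 / 2)) q /\ forall t, t \in `[0, 1] -> f t <> q.
Proof.
move=> fc fi d0; apply: contrapT => /forallNP H.
set y := f (1 / 2).
have full q : near_pt d y q -> exists2 t, t \in `[0, 1] & f t = q.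
  move=> yq; have /not_andP[//|/existsNP[t /not_implyP[t01 /contrapT E]]] := H q.
  by exists t.
have h01 : (1 / 2 : R) \in `[0, 1] by rewrite in_itv /=; lra.
have [e e0 eP] := within_near fc h01 d0.
pose eta := Num.min (e / 2) (1 / 4).
have eta0 : 0 < eta by rewrite lt_min; apply/andP; split; lra.
have eta1 : eta <= e / 2 by rewrite ge_min lexx.
have eta2 : eta <= 1 / 4 by rewrite ge_min lexx orbT.
pose t1 := 1 / 2 - eta; pose t2 := 1 / 2 + eta.
have t101 : t1 \in `[0, 1] by rewrite in_itv /= /t1; lra.
have t201 : t2 \in `[0, 1] by rewrite in_itv /= /t2; lra.
have ya : near_pt d y (f t1).
  by apply: eP => //; rewrite (_ : t1 - _ = - eta) ?normrN ?gtr0_norm //; [lra|rewrite /t1; ring].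
have yb : near_pt d y (f t2).
  by apply: eP => //; rewrite (_ : t2 - _ = eta) ?gtr0_norm //; [lra|rewrite /t2; ring].
have fy t : t \in `[0, 1] -> t != 1 / 2 -> f t != y.
  by move=> t01; apply: contra => /eqP /(fi _ _ t01 h01) ->.
have a0 : f t1 != y by apply: fy => //; rewrite /t1 lt_eqF //; lra.
have b0 : f t2 != y by apply: fy => //; rewrite /t2 gt_eqF //; lra.
pose F1 := f @` `[0, 1 / 2]; pose F2 := f @` `[1 / 2, 1].
have cF1 : compact F1.
  apply: continuous_compact; last exact: segment_compact.
  by apply: continuous_subspaceW fc; apply: subset_itv; rewrite bnd_simp //; lra.
have cF2 : compact F2.
  apply: continuous_compact; last exact: segment_compact.
  by apply: continuous_subspaceW fc; apply: subset_itv; rewrite bnd_simp //; lra.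
have F12 z : F1 z -> F2 z -> z = y.
  move=> [s /= s01 <-] [t /= t01 E]; move: s01 t01; rewrite !in_itv /= => /andP[s0 s1] /andP[t0 t1'].
  have st : t = s by apply: fi E; rewrite in_itv /=; lra.
  by rewrite (_ : s = 1 / 2) //; lra.
have FF q : near_pt d y q -> F1 q \/ F2 q.
  move=> /full[t t01 <-]; move: t01; rewrite in_itv /= => /andP[u0 u1].
  by case: (leP t (1 / 2)) => ht; [left|right]; exists t => //=; rewrite in_itv /=; lra.
(* A nonzero value says that y, u, v are not collinear, so the segment from u to v avoids y. *)
pose cr (u v : R * R) := (u.1 - y.1) * (v.2 - y.2) - (u.2 - y.2) * (v.1 - y.1).
have seg a b : near_pt d y a -> near_pt d y b -> cr a b != 0 -> F1 a -> F1 b.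
  move=> na nb cab Fa.
  pose g t := (a.1 + t * (b.1 - a.1), a.2 + t * (b.2 - a.2)) : R * R.
  have -> : b = g 1 by rewrite /g !mul1r [b]surjective_pairing /=; congr pair; ring.
  have near_g t : t \in `[0, 1] -> near_pt d y (g t).
    by rewrite in_itv /= => s01; apply: near_pt_convex.
  apply: (path_stays _ cF1 cF2).
  - by apply: continuous_subspaceT; apply: segment_continuous.
  - by move=> t t01; apply: FF; apply: near_g.
  - move=> t t01 G1 G2; move: cab; have := F12 _ G1 G2; rewrite /g /cr => /(congr1 (fun z : R * R => (z.1, z.2))) [<- <-] /=.
    by apply/negP; rewrite negbK; apply/eqP; ring.
  - by rewrite /g !mul0r !addr0 -surjective_pairing.
have h2 : near_pt d y (y.1 + d / 2, y.2) by apply/near_ptP => /=; split; lra.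
have h3 : near_pt d y (y.1, y.2 + d / 2) by apply/near_ptP => /=; split; lra.
have h4 : near_pt d y (y.1 + d / 2, y.2 + d / 2) by apply/near_ptP => /=; split; lra.
have crC a b : cr a b != 0 -> cr b a != 0.
  by rewrite (_ : cr b a = - cr a b) ?oppr_eq0 // /cr; ring.
have dn0 : d != 0 by rewrite gt_eqF.
have coord a : a != y -> (a.1 - y.1 != 0) || (a.2 - y.2 != 0).
  rewrite -negb_and !subr_eq0; apply: contra => /andP[/eqP e1 /eqP e2].
  by rewrite [a]surjective_pairing e1 e2 -surjective_pairing.
(* The candidates lie in three pairwise non-parallel directions from y; [f t1] and [f t2] exclude at
   most one each. *)
have [z [nz c1 c2]] : exists z, [/\ near_pt d y z, cr (f t1) z != 0 & cr (f t2) z != 0].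
  have c1 a : cr a (y.1 + d / 2, y.2) = - ((a.2 - y.2) * (d / 2)) by rewrite /cr /=; ring.
  have c2 a : cr a (y.1, y.2 + d / 2) = (a.1 - y.1) * (d / 2) by rewrite /cr /=; ring.
  have c3 a : cr a (y.1 + d / 2, y.2 + d / 2) = ((a.1 - y.1) - (a.2 - y.2)) * (d / 2) by rewrite /cr /=; ring.
  have := coord _ a0; have := coord _ b0.
  have [A2|A2] := eqVneq ((f t1).2 - y.2) 0; have [B2|B2] := eqVneq ((f t2).2 - y.2) 0;
  rewrite ?A2 ?B2 ?eqxx ?orbF ?orbT => B1 A1.
  - by exists (y.1, y.2 + d / 2); rewrite !c2 !mulf_neq0.
  - have [B1'|B1'] := eqVneq ((f t2).1 - y.1) 0.
      exists (y.1 + d / 2, y.2 + d / 2); rewrite !c3 !mulf_neq0 // ?A2 ?subr0 // B1' sub0r oppr_eq0 //.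
    by exists (y.1, y.2 + d / 2); rewrite !c2 !mulf_neq0.
  - have [A1'|A1'] := eqVneq ((f t1).1 - y.1) 0.
      exists (y.1 + d / 2, y.2 + d / 2); rewrite !c3 !mulf_neq0 // ?B2 ?subr0 // A1' sub0r oppr_eq0 //.
    by exists (y.1, y.2 + d / 2); rewrite !c2 !mulf_neq0.
  - by exists (y.1 + d / 2, y.2); rewrite !c1 !oppr_eq0 !mulf_neq0.
have Fa : F1 (f t1) by exists t1 => //=; rewrite in_itv /= /t1; lra.
have Fb : F2 (f t2) by exists t2 => //=; rewrite in_itv /= /t2; lra.
have := seg _ _ nz yb (crC _ _ c2) (seg _ _ ya nz c1 Fa) => Fb'.
by move: b0; rewrite (F12 _ Fb' Fb) eqxx.
Qed.
End Accessible.

Section WedgeDrawing.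
Variables (R : realType) (V : finType).
Implicit Types (E : edges V) (p : V -> R * R) (c : {set V} -> R -> R * R).
Implicit Types (x y z q u w : R * R).

Definition sqnorm z : R := z.1 ^+ 2 + z.2 ^+ 2.

Lemma sqnorm_ge0 z : 0 <= sqnorm z.
Proof. by rewrite addr_ge0 // sqr_ge0. Qed.

Lemma sqnorm_gt0 z : z != 0 -> 0 < sqnorm z.
Proof.
move=> z0; rewrite lt_neqAle sqnorm_ge0 andbT eq_sym; apply: contra z0.
rewrite /sqnorm paddr_eq0 ?sqr_ge0 // !sqrf_eq0 => /andP[/eqP h1 /eqP h2].
by rewrite [z]surjective_pairing h1 h2.
Qed.

Lemma continuous_fst : continuous (fst : R * R -> R).
Proof. by move=> z; apply: cvg_fst. Qed.

Lemma continuous_snd : continuous (snd : R * R -> R).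
Proof. by move=> z; apply: cvg_snd. Qed.

Lemma sqnorm_sub_continuous q : continuous (fun z => sqnorm (z - q)).
Proof.
move=> z; rewrite /sqnorm /=; apply: cvgD; rewrite !expr2; apply: cvgM;
  apply: cvgB; by [apply: cvg_cst|apply: continuous_fst|apply: continuous_snd].
Qed.

Lemma in01W (t : R) : t \in `]0, 1[ -> t \in `[0, 1].
Proof. by rewrite !in_itv /= => /andP[/ltW -> /ltW ->]. Qed.

(* Take q off the arc of e, very close to its midpoint; the point of that arc nearest to q is
   then nearer than every other point of the drawing. *)
Lemma accessible_point E p c e : drawn E p c -> e \in E ->
  exists q tau, [/\ tau \in `]0, 1[, c e tau != q,
    forall e' t, e' \in E -> t \in `[0, 1] -> sqnorm (c e tau - q) <= sqnorm (c e' t - q) &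
    forall v, sqnorm (c e tau - q) <= sqnorm (p v - q)].
Proof.
move=> dr eE; have [inj cc ends iv ii] := dr; have [fc fi] := cc e eE.
have h01 : (1 / 2 : R) \in `]0, 1[ by rewrite in_itv /=; lra.
set y := c e (1 / 2).
have [d1 d10 far1] : exists2 d, 0 < d & forall e' : {set V}, e' \in E -> e' != e ->
    forall t, t \in `[0, 1] -> far_pt d (y - c e' t).
  apply: (@finite_family_pos R _ (fun e' d => e' \in E -> e' != e ->
      forall t, t \in `[0, 1] -> far_pt d (y - c e' t))).
    move=> e' d d' Pd /andP[d'0 d'd] e'E ne t t01; exact: far_ptW d'd (Pd e'E ne t t01).
  move=> e'; have [e'E|] := boolP (e' \in E); last by move=> n; exists 1 => //; move=> n'; rewrite n' in n.
  have [->|ne] := eqVneq e' e; first by exists 1.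
  have [||d d0 H] := @compact_far R [set y] (c e' @` `[0, 1]) (@compact_set1 _ y).
  - by apply: arc_compact; have [] := cc e' e'E.
  - rewrite -subset0 => z [-> [t /= t01 E']].
    case: (drawn_ends dr e'E t01) => [ti|[v ve E2]].
      by apply: (ii e' e t (1 / 2)).
    by apply: (iv e v (1 / 2)) => //; rewrite -E2.
  - by exists d => // _ _ t t01; apply: H => //; exists t.
have [d2 d20 far2] : exists2 d, 0 < d & forall v, far_pt d (y - p v).
  apply: (@finite_family_pos R _ (fun v d => far_pt d (y - p v))).
    by move=> v d d' h /andP[_ d'd]; apply: far_ptW h.
  move=> v; have [|d d0 H] := @compact_far R [set y] [set p v] (@compact_set1 _ y) (@compact_set1 _ _).
    by rewrite -subset0 => z [-> E']; apply: (iv e v (1 / 2)).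
  by exists d => //; apply: H.
pose d := Num.min d1 d2 / 2.
have dm : 0 < Num.min d1 d2 by rewrite lt_min d10.
have d0 : 0 < d by rewrite /d; lra.
have dd1 : 2 * d <= d1 by rewrite /d mulrCA mulfV // mulr1 ge_min lexx.
have dd2 : 2 * d <= d2 by rewrite /d mulrCA mulfV // mulr1 ge_min lexx orbT.
have [q [yq qf]] := arc_interior fc fi d0.
have cK := arc_compact fc.
have K0 : (c e @` `[0, 1]) !=set0 by exists y; exists (1 / 2) => //; apply: in01W.
have Nc : {within c e @` `[0, 1], continuous (fun z => sqnorm (z - q))}.
  by apply: continuous_subspaceT; apply: sqnorm_sub_continuous.
have [x /set_mem[tau /= tau01 xE] xmin] := compact_EVT_min K0 cK Nc.
have yqN : sqnorm (y - q) < 2 * d ^+ 2.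
  by move/near_ptP: yq => [? ? ? ?]; rewrite /sqnorm /=; nra.
have xy : sqnorm (x - q) <= sqnorm (y - q).
  by apply: xmin; apply/mem_set; exists (1 / 2) => //; apply: in01W.
(* In the maximum norm, a point at distance at least 4d from y is at distance at least 3d from q,
   while the Euclidean distance from y to q is less than d times the root of 2. *)
have farN D z : 2 * d <= D -> far_pt D (y - z) -> sqnorm (y - q) <= sqnorm (z - q).
  move=> dD /far_ptP h; apply: ltW; apply: lt_le_trans yqN _.
  move/near_ptP: yq => [? ? ? ?]; rewrite /sqnorm /= in h *.
  have := sqr_ge0 (z.1 - q.1); have := sqr_ge0 (z.2 - q.2).
  case: h => h.
  - have : 2 * d <= - (z.1 - q.1) by lra. nra.
  - have : 2 * d <= (z.1 - q.1) by lra. nra.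
  - have : 2 * d <= - (z.2 - q.2) by lra. nra.
  - have : 2 * d <= (z.2 - q.2) by lra. nra.
have tau_in : tau \in `]0, 1[.
  case: (drawn_ends dr eE tau01) => [//|[v _ E']]; exfalso.
  have /far_ptP h := far2 v; rewrite -E' xE in h.
  move/near_ptP: yq => [? ? ? ?]; rewrite /sqnorm /= in h xy yqN.
  have := sqr_ge0 (x.1 - q.1); have := sqr_ge0 (x.2 - q.2).
  case: h => h.
  - have : 2 * d <= - (x.1 - q.1) by lra. nra.
  - have : 2 * d <= (x.1 - q.1) by lra. nra.
  - have : 2 * d <= - (x.2 - q.2) by lra. nra.
  - have : 2 * d <= (x.2 - q.2) by lra. nra.
exists q, tau; rewrite xE; split=> //.
- by rewrite -xE; apply/eqP; apply: qf.
- move=> e' t e'E t01; have [->|ne] := eqVneq e' e; first by apply: xmin; apply/mem_set; exists t.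
  by apply: le_trans xy _; apply: farN (far1 e' e'E ne t t01).
- by move=> v; apply: le_trans xy _; apply: farN (far2 v).
Qed.
End WedgeDrawing.

(** * Subdividing an edge of a drawing *)

Section Subdivision.
Variables (R : realType) (V : finType).
Implicit Types (E : edges V) (p : V -> R * R) (c : {set V} -> R -> R * R).

Lemma edge_endpoints E p c e : drawn E p c -> e \in E ->
  exists u v, [/\ u != v, e = [set u; v]%SET, c e 0 = p u & c e 1 = p v].
Proof.
move=> dr eE; have [inj cc ends _ _] := dr; have [_ fi] := cc e eE.
have endv z : [set c e 0; c e 1] z -> exists2 v, v \in e & p v = z.
  by rewrite ends // => -[v /= ve <-]; exists v.
have [u ue cu] : exists2 u, u \in e & p u = c e 0 by apply: endv; left.
have [v ve cv] : exists2 v, v \in e & p v = c e 1 by apply: endv; right.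
exists u, v; split=> //.
  by apply/eqP=> uv; have /eqP := fi _ _ (in01_0 R) (in01_1 R) (etrans (esym cu) (etrans (congr1 p uv) cv));
    rewrite eq_sym oner_eq0.
apply/setP=> w; rewrite !inE; apply/idP/idP=> [we|/orP[/eqP ->|/eqP ->] //].
have : (p @` [set` e]) (p w) by exists w.
by rewrite -ends // -cu -cv => -[/inj ->|/inj ->]; rewrite eqxx ?orbT.
Qed.

Lemma drawn_transform E p c (Z : set (R * R)) (T : R * R -> R * R) :
  drawn E p c -> (forall v, Z (p v)) -> (forall e t, e \in E -> t \in `[0, 1] -> Z (c e t)) ->
  (forall z, Z z -> T x @[x --> z] --> T z) -> (forall z w, Z z -> Z w -> T z = T w -> z = w) ->
  drawn E (T \o p) (fun e => T \o c e).
Proof.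
move=> [inj cc ends iv ii] Zp Zc Tc Ti; split.
- by move=> u v /Ti h; apply: inj; apply: h.
- move=> e eE; have [fc fi] := cc e eE; split.
    move/subspace_continuousP in fc; apply/subspace_continuousP => t t01.
    by apply: cvg_comp (fc t t01) (Tc _ (Zc _ _ eE t01)).
  by move=> s t s01 t01 /Ti h; apply: fi => //; apply: h; apply: Zc.
- move=> e eE; have := congr1 (fun A => T @` A) (ends e eE).
  by rewrite image_comp image_setU !image_set1.
- move=> e v t eE t01 /Ti h; apply: (iv e v t eE t01); apply: h => //.
  by apply: Zc => //; apply: in01W.
- move=> e e' s t eE e'E ne s01 t01 /Ti h; apply: (ii e e' s t) => //.
  by apply: h; apply: Zc => //; apply: in01W.
Qed.

Definition subdivide E (e : {set V}) : edges (option V) :=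
  ([set [set Some v | v in f] | f : {set V} in E :\ e] :|:
   [set [set Some v; None] | v in e])%SET.

Lemma subdivideP E e (f : {set option V}) :
  reflect ((exists2 f0, f0 \in (E :\ e)%SET & f = [set Some v | v in f0]%SET) \/
           (exists2 v, v \in e & f = [set Some v; None]%SET))
          (f \in subdivide E e).
Proof.
rewrite inE; apply: (iffP orP) => -[].
- by move/imsetP; left.
- by move/imsetP; right.
- by move=> H; left; apply/imsetP.
- by move=> H; right; apply/imsetP.
Qed.

Lemma near_within (f : R -> R * R) :
  (forall x e, x \in `[0, 1] -> 0 < e ->
    exists2 d, 0 < d & forall t, t \in `[0, 1] -> `|t - x| < d -> near_pt e (f x) (f t)) ->
  {within `[0, 1], continuous f}.
Proof.
move=> H; apply/subspace_continuousP => x x01; apply/cvgrPdist_lt => e e0.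
have [d d0 P] := H x e x01 e0; rewrite /= /within /=; apply/nbhs_ballP; exists d => //= t.
by rewrite /ball /= distrC => xt t01; have := P t t01 xt; rewrite near_ptE.
Qed.

Lemma drawn_subdivide E p c e tau : drawn E p c -> e \in E -> tau \in `]0, 1[ ->
  exists c' : {set option V} -> R -> R * R, drawn (subdivide E e) (fun o => if o is Some v then p v else c e tau) c' /\
    forall f t, f \in subdivide E e -> t \in `[0, 1] ->
      exists e' t', [/\ e' \in E, t' \in `[0, 1] & c' f t = c e' t'].
Proof.
move=> dr eE tau01; have [inj cc ends iv ii] := dr.
have [u [v [uv euv c0 c1]]] := edge_endpoints dr eE.
have [tau0 tau1] : 0 < tau /\ tau < 1 by apply/andP; rewrite in_itv in tau01.
(* [par f] gives the old arc that carries [f] and the parameter interval that [f] covers: one side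
   of [tau] for the halves of [e], and [0, 1] for other edges. *)
pose par (f : {set option V}) : {set V} * R * R :=
  if None \in f then if Some u \in f then (e, 0, tau) else (e, tau, 1)
  else ([set w | Some w \in f]%SET, 0, 1).
have parS (f0 : {set V}) : par [set Some w | w in f0]%SET = (f0, 0, 1).
  rewrite /par; case: ifP => [/imsetP[]//|_]; congr (_, _, _).
  by apply/setP=> w; rewrite inE mem_imset //; apply: Some_inj.
have paru : par [set Some u; None]%SET = (e, 0, tau) by rewrite /par !inE !eqxx.
have parv : par [set Some v; None]%SET = (e, tau, 1).
  by rewrite /par !inE /= orbF eqE /= (negPf uv).
pose c' f t := c (par f).1.1 ((par f).1.2 + t * ((par f).2 - (par f).1.2)).
have cases f : f \in subdivide E e -> [\/ exists2 f0, f0 \in (E :\ e)%SET & f = [set Some w | w in f0]%SET,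
    f = [set Some u; None]%SET | f = [set Some v; None]%SET].
  move/subdivideP=> [H|[w]]; first by constructor 1.
  by rewrite euv !inE => /orP[/eqP ->|/eqP ->] ->; [constructor 2|constructor 3].
have par_in f : f \in subdivide E e -> [/\ (par f).1.1 \in E, 0 <= (par f).1.2, (par f).2 <= 1,
    (par f).1.2 < (par f).2 & (par f).1.1 = e -> ((par f).2 <= tau) || (tau <= (par f).1.2)].
  case/cases=> [[f0 f0E ->]|->|->]; rewrite ?parS ?paru ?parv /=; split=> //;
    rewrite ?eE ?lexx ?ler01 ?ltr01 ?orbT //; try exact: ltW.
  - by case/setD1P: f0E.
  - by move: f0E; rewrite in_setD1 => /andP[/eqP].
have mid f t : f \in subdivide E e -> t \in `[0, 1] ->
    (par f).1.2 + t * ((par f).2 - (par f).1.2) \in `[0, 1].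
  by move=> /par_in[_ h1 h2 h3 _]; rewrite !in_itv /= => /andP[t0 t1]; nra.
have mid' f t : f \in subdivide E e -> t \in `]0, 1[ ->
    (par f).1.2 < (par f).1.2 + t * ((par f).2 - (par f).1.2) < (par f).2.
  by move=> /par_in[_ h1 h2 h3 _]; rewrite !in_itv /= => /andP[t0 t1]; nra.
have mid'' f t : f \in subdivide E e -> t \in `]0, 1[ ->
    (par f).1.2 + t * ((par f).2 - (par f).1.2) \in `]0, 1[.
  move=> fS t01; have /andP[h1 h2] := mid' f t fS t01; have [_ h3 h4 _ _] := par_in f fS.
  by rewrite in_itv /= (le_lt_trans h3) //= (lt_le_trans h2).
have inj0 f s t : f \in subdivide E e -> s \in `[0, 1] -> t \in `[0, 1] -> c' f s = c' f t -> s = t.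
  move=> fS s01 t01; have [fE _ _ h3 _] := par_in f fS; have [_ fi] := cc _ fE.
  move=> /(fi _ _ (mid f s fS s01) (mid f t fS t01)) /addrI /mulIf; apply.
  by rewrite subr_eq0 gt_eqF.
exists c'; split; last first.
  move=> f t fS t01; exists (par f).1.1, ((par f).1.2 + t * ((par f).2 - (par f).1.2)); split=> //.
    by have [] := par_in f fS.
  exact: mid.
split.
- move=> [w|] [w'|] //=; first by move/inj->.
    by move=> E'; exfalso; apply: (iv e w tau).
  by move=> E'; exfalso; apply: (iv e w' tau).
- move=> f fS; split; last by move=> s t; apply: inj0.
  have [fE h1 h2 h3 _] := par_in f fS; have [fc _] := cc _ fE.
  apply: near_within => t d t01 d0; have [e1 e10 H] := within_near fc (mid f t fS t01) d0.
  exists e1 => // s s01 st; apply: H; first exact: mid.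
  rewrite opprD addrACA subrr add0r -mulrBl normrM [X in _ * X]gtr0_norm ?subr_gt0 //.
  apply: le_lt_trans st; rewrite ler_piMr //; lra.
- move=> f /cases[[f0 f0E ->]|->|->]; rewrite /c' ?parS ?paru ?parv /=.
  + rewrite !mul0r !addr0 subr0 mulr1 add0r ends; last by case/setD1P: f0E.
    apply/seteqP; split=> z /=.
      by move=> [w wf <-]; exists (Some w) => //=; apply: imset_f.
    by move=> [ow /imsetP[w wf ->] <-]; exists w.
  + rewrite !mul0r !mul1r !subr0 !add0r c0.
    apply/seteqP; split=> z /=.
      by move=> [-> | ->]; [exists (Some u)|exists None] => //=; rewrite !inE eqxx ?orbT.
    by move=> [ow]; rewrite !inE => /orP[/eqP ->|/eqP ->] <-; [left|right].
  + rewrite !mul0r !mul1r !addr0 addrCA subrr addr0 c1.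
    apply/seteqP; split=> z /=.
      by move=> [-> | ->]; [exists None|exists (Some v)] => //=; rewrite !inE eqxx ?orbT.
    by move=> [ow]; rewrite !inE => /orP[/eqP ->|/eqP ->] <-; [right|left].
- move=> f [w|] t fS t01; first by apply: iv (mid'' f t fS t01); have [] := par_in f fS.
  have /andP[m1 m2] := mid' f t fS t01; have [fE _ _ _ h] := par_in f fS.
  have [E'|ne] := eqVneq (par f).1.1 e; last exact: ii (mid'' f t fS t01) tau01.
  have [_ fi] := cc e eE; rewrite /c' E' => /fi; rewrite (in01W (mid'' f t fS t01)) (in01W tau01) => /(_ isT isT) Et.
  by move: (h E'); rewrite -Et => /orP[]; rewrite leNgt ?m1 ?m2.
- move=> f f' s t fS f'S ne s01 t01.
  have [fE _ _ _ _] := par_in f fS; have [f'E _ _ _ _] := par_in f' f'S.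
  have [E'|ne'] := eqVneq (par f).1.1 (par f').1.1; last exact: ii (mid'' f s fS s01) (mid'' f' t f'S t01).
  have /andP[m1 m2] := mid' f s fS s01; have /andP[m3 m4] := mid' f' t f'S t01.
  have E3 := E'; have : ((par f).2 <= (par f').1.2) || ((par f').2 <= (par f).1.2).
    move: E' ne; case/cases: (fS) => [[f0 /setD1P[f0e f0E] ->]|->|->]; case/cases: (f'S) => [[f1 /setD1P[f1e f1E] ->]|->|->];
      rewrite ?parS ?paru ?parv /= ?lexx ?orbT ?eqxx // => E'; try by rewrite E' eqxx in f0e.
    all: try by rewrite ?eqxx. all: try by rewrite E' eqxx.
    1,2: by rewrite -E' eqxx in f1e.
  have [_ fi] := cc _ fE; rewrite /c' -E3 => h /fi.
  rewrite (in01W (mid'' f s fS s01)) (in01W (mid'' f' t f'S t01)) => /(_ isT isT) Et.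
  by move: h => /orP[]; lra.
Qed.
End Subdivision.

(** * Bending the outside of a disc into a triangle *)

Section WedgeMap.
Variable R : realType.
Implicit Types (a b d q u z w : R * R).

Definition dot z w : R := z.1 * w.1 + z.2 * w.2.
Definition cross z w : R := z.1 * w.2 - z.2 * w.1.

Definition triangle a b d z := exists s t, [/\ 0 < s, 0 < t, s + t < 1 &
  z = (a.1 + s * (b.1 - a.1) + t * (d.1 - a.1), a.2 + s * (b.2 - a.2) + t * (d.2 - a.2))].

(** For the inverted point (z - q) / |z - q|^2, depth is the signed distance to the tangent line at
    the image of q + u and side is the position along that line, both scaled by |u|. *)
Definition wedge_depth q u z := 1 - dot (z - q) u / sqnorm (z - q).
Definition wedge_side q u z := cross u (z - q) / sqnorm (z - q).
(** (|s| + s) / 2 is the positive part of s, so the half-plane is bent into a quarter-plane. Outside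
    the circle the depth is at most 2 and |side| at most 1; dividing by 6 keeps left + right at most
    5/6, inside the triangle. *)
Definition wedge_left q u z := (wedge_depth q u z + (`|wedge_side q u z| + wedge_side q u z) / 2) / 6.
Definition wedge_right q u z := (wedge_depth q u z + (`|wedge_side q u z| - wedge_side q u z) / 2) / 6.

(* Inversion at q sends the exterior of the circle of centre q through q + u into a half-plane
   touched at the image of q + u only; the half-plane is then bent into the triangle a, b, d. *)
Definition wedge_map a b d q u z : R * R :=
  (a.1 + wedge_left q u z * (b.1 - a.1) + wedge_right q u z * (d.1 - a.1),
   a.2 + wedge_left q u z * (b.2 - a.2) + wedge_right q u z * (d.2 - a.2)).

Lemma wedge_map_continuous a b d q u z : z != q ->
  wedge_map a b d q u x @[x --> z] --> wedge_map a b d q u z.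
Proof.
move=> zq; have nz : sqnorm (z - q) != 0 by rewrite gt_eqF // sqnorm_gt0 // subr_eq0.
have c1 : fst x @[x --> z] --> z.1 by apply: continuous_fst.
have c2 : snd x @[x --> z] --> z.2 by apply: continuous_snd.
have cs : (sqnorm (x - q))^-1 @[x --> z] --> (sqnorm (z - q))^-1.
  by apply: cvgV => //; apply: sqnorm_sub_continuous.
have cd : wedge_depth q u x @[x --> z] --> wedge_depth q u z.
  apply: cvgB; first exact: cvg_cst.
  apply: cvgM => //; apply: cvgD; apply: cvgM; try exact: cvg_cst; apply: cvgB => //; exact: cvg_cst.
have ce : wedge_side q u x @[x --> z] --> wedge_side q u z.
  by apply: cvgM => //; apply: cvgB; apply: cvgM; try exact: cvg_cst; apply: cvgB => //; exact: cvg_cst.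
have cn : `|wedge_side q u x| @[x --> z] --> `|wedge_side q u z| by apply: cvg_norm.
have cl : wedge_left q u x @[x --> z] --> wedge_left q u z.
  by apply: cvgM; [apply: cvgD => //; apply: cvgM; [apply: cvgD|]|]; try exact: cvg_cst.
have cr : wedge_right q u x @[x --> z] --> wedge_right q u z.
  by apply: cvgM; [apply: cvgD => //; apply: cvgM; [apply: cvgB|]|]; try exact: cvg_cst.
by apply: cvg_pt; apply: cvgD; try (apply: cvgD; first exact: cvg_cst); apply: cvgM => //; exact: cvg_cst.
Qed.

Lemma affine_coordinates_inj a b d (l r l' r' : R) : cross (b - a) (d - a) != 0 ->
  a.1 + l * (b.1 - a.1) + r * (d.1 - a.1) = a.1 + l' * (b.1 - a.1) + r' * (d.1 - a.1) ->
  a.2 + l * (b.2 - a.2) + r * (d.2 - a.2) = a.2 + l' * (b.2 - a.2) + r' * (d.2 - a.2) ->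
  l = l' /\ r = r'.
Proof.
rewrite /cross /= => nd /eqP; rewrite -subr_eq0 => /eqP h1 /eqP; rewrite -subr_eq0 => /eqP h2.
split; apply/eqP; rewrite -subr_eq0 -(mulIr_eq0 _ (mulIf nd)); apply/eqP.
  have := congr1 (fun x => x * (d.2 - a.2)) h1; have := congr1 (fun x => x * (d.1 - a.1)) h2; lra.
have := congr1 (fun x => x * (b.2 - a.2)) h1; have := congr1 (fun x => x * (b.1 - a.1)) h2; lra.
Qed.

(** left - right determines the side, and then left determines the depth. These are coordinates of
    the inverted point with respect to u, and the norm of the inverted point gives back the norm of
    the original. *)
Lemma wedge_map_inj a b d q u z w : u != 0 -> cross (b - a) (d - a) != 0 -> z != q -> w != q ->
  wedge_map a b d q u z = wedge_map a b d q u w -> z = w.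
Proof.
move=> u0 nd zq wq [h1 h2].
have nz : sqnorm (z - q) != 0 by rewrite gt_eqF // sqnorm_gt0 // subr_eq0.
have nw : sqnorm (w - q) != 0 by rewrite gt_eqF // sqnorm_gt0 // subr_eq0.
have nu : sqnorm u != 0 by rewrite gt_eqF // sqnorm_gt0.
have [el er] := affine_coordinates_inj nd h1 h2.
have es : wedge_side q u z = wedge_side q u w.
  have : wedge_left q u z - wedge_right q u z = wedge_left q u w - wedge_right q u w by rewrite el er.
  rewrite /wedge_left /wedge_right; lra.
have ed : dot (z - q) u / sqnorm (z - q) = dot (w - q) u / sqnorm (w - q).
  by move: el; rewrite /wedge_left es /wedge_depth; lra.
move: es; rewrite /wedge_side => es.
have e1 : (z.1 - q.1) / sqnorm (z - q) = (w.1 - q.1) / sqnorm (w - q).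
  apply: (mulIf nu).
  have H x : (x.1 - q.1) / sqnorm (x - q) * sqnorm u =
    dot (x - q) u / sqnorm (x - q) * u.1 - cross u (x - q) / sqnorm (x - q) * u.2.
    by rewrite /dot /cross {2}/sqnorm /=; ring.
  by rewrite (H z) (H w) ed es.
have e2 : (z.2 - q.2) / sqnorm (z - q) = (w.2 - q.2) / sqnorm (w - q).
  apply: (mulIf nu).
  have H x : (x.2 - q.2) / sqnorm (x - q) * sqnorm u =
    dot (x - q) u / sqnorm (x - q) * u.2 + cross u (x - q) / sqnorm (x - q) * u.1.
    by rewrite /dot /cross {2}/sqnorm /=; ring.
  by rewrite (H z) (H w) ed es.
have en : (sqnorm (z - q))^-1 = (sqnorm (w - q))^-1.
  have H x : sqnorm (x - q) != 0 -> (sqnorm (x - q))^-1 =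
      ((x.1 - q.1) / sqnorm (x - q)) ^+ 2 + ((x.2 - q.2) / sqnorm (x - q)) ^+ 2.
    by move=> nx; rewrite !expr_div_n -mulrDl -[X in X / _]/(sqnorm (x - q)) expr2 invfM mulrA mulfV ?mul1r.
  by rewrite (H _ nz) (H _ nw) e1 e2.
move: e1 e2; rewrite en => /(mulIf (invr_neq0 nw)) /addIr e1 /(mulIf (invr_neq0 nw)) /addIr e2.
by rewrite [z]surjective_pairing e1 e2 -surjective_pairing.
Qed.

Lemma wedge_map_apex a b d q u : u != 0 -> wedge_map a b d q u (q + u) = a.
Proof.
move=> u0; have nu : sqnorm u != 0 by rewrite gt_eqF // sqnorm_gt0.
have qu : q + u - q = u by rewrite addrC addKr.
have s0 : wedge_side q u (q + u) = 0 by rewrite /wedge_side qu /cross [u.1 * _]mulrC subrr mul0r.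
have d0 : wedge_depth q u (q + u) = 0.
  by rewrite /wedge_depth qu (_ : dot u u = sqnorm u) ?divff ?subrr // /dot /sqnorm !expr2.
rewrite /wedge_map /wedge_left /wedge_right s0 d0 normr0 !(addr0, subr0, mul0r, add0r).
by rewrite -surjective_pairing.
Qed.

(** With w = z - q, all bounds come from squares: |w - u|^2 > 0 makes the depth positive, |w + u|^2
    >= 0 makes it at most 2, and two further sums of squares, pairing the coordinates of w with the
    swapped ones of u, bound the side by 1. *)
Lemma wedge_map_triangle a b d q u z : u != 0 -> sqnorm u <= sqnorm (z - q) -> z != q + u ->
  triangle a b d (wedge_map a b d q u z).
Proof.
move=> u0 nu zqu; have nu0 := sqnorm_gt0 u0.
have n0 : 0 < sqnorm (z - q) by apply: lt_le_trans nu.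
have zu : 0 < sqnorm (z - q - u).
  by apply: sqnorm_gt0; rewrite subr_eq0 subr_eq addrC.
set w := z - q in nu n0 zu *; set n := sqnorm w in nu n0 *.
have ext x y : sqnorm (x - y) = sqnorm x - 2 * dot x y + sqnorm y.
  by rewrite /sqnorm /dot /=; ring.
have d1 : dot w u < n by move: zu; rewrite ext -/n; lra.
have d2 : - n <= dot w u.
  have := sqnorm_ge0 (w - - u); rewrite ext -/n.
  have -> : dot w (- u) = - dot w u by rewrite /dot /=; ring.
  have -> : sqnorm (- u) = sqnorm u by rewrite /sqnorm /=; ring.
  lra.
have c12 : `|cross u w| <= n.
  rewrite ler_norml; apply/andP; split.
    have := addr_ge0 (sqr_ge0 (w.2 + u.1)) (sqr_ge0 (w.1 - u.2)).
    have -> : (w.2 + u.1) ^+ 2 + (w.1 - u.2) ^+ 2 = sqnorm w + sqnorm u + 2 * cross u w.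
      by rewrite /sqnorm /cross; ring.
    rewrite -/n; lra.
  have := addr_ge0 (sqr_ge0 (w.2 - u.1)) (sqr_ge0 (w.1 + u.2)).
  have -> : (w.2 - u.1) ^+ 2 + (w.1 + u.2) ^+ 2 = sqnorm w + sqnorm u - 2 * cross u w.
    by rewrite /sqnorm /cross; ring.
  rewrite -/n; lra.
have x0 : 0 < wedge_depth q u z by rewrite /wedge_depth subr_gt0 ltr_pdivrMr // mul1r.
have x1 : wedge_depth q u z <= 2.
  have : -1 <= dot w u / n by rewrite ler_pdivlMr // mulN1r.
  rewrite /wedge_depth -/w -/n; lra.
have y1 : `|wedge_side q u z| <= 1.
  by rewrite /wedge_side normrM normfV (gtr0_norm n0) ler_pdivrMr // mul1r.
have := ler_norm (wedge_side q u z); have := ler_norm (- wedge_side q u z); rewrite normrN => y2 y3.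
exists (wedge_left q u z), (wedge_right q u z); split=> //.
- by rewrite /wedge_left; lra.
- by rewrite /wedge_right; lra.
- rewrite /wedge_left /wedge_right; lra.
Qed.
End WedgeMap.

(** The open disc around q through the nearest point x misses the drawing. Subdividing at x makes x
    a vertex, which [wedge_map] puts at the apex, with all else in the open triangle. *)
Lemma wedge_drawing (R : realType) (V : finType) (E : edges V)
    (p : V -> R * R) (c : {set V} -> R -> R * R) e (a b d : R * R) :
  drawn E p c -> e \in E -> cross (b - a) (d - a) != 0 ->
  exists (p' : option V -> R * R) (c' : {set option V} -> R -> R * R), [/\ drawn (subdivide E e) p' c', p' None = a,
    forall v, triangle a b d (p' (Some v)) &
    forall f t, f \in subdivide E e -> t \in `]0, 1[ -> triangle a b d (c' f t)].
Proof.
move=> dr eE nd; have [q [tau [tau01 xq near_arc near_vertex]]] := accessible_point dr eE.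
have [c1 [dr1 c1E]] := drawn_subdivide dr eE tau01.
set p1 := fun o => _ in dr1.
set x := c e tau in xq near_arc near_vertex p1 dr1; pose u := x - q.
have u0 : u != 0 by rewrite subr_eq0.
have xE : q + u = x by rewrite /u addrC subrK.
pose Z z := sqnorm u <= sqnorm (z - q).
have Zq z : Z z -> z != q.
  by rewrite /Z; apply: contraTneq => ->; rewrite subrr -ltNge {1}/sqnorm /= expr0n addr0 sqnorm_gt0.
have Zp v : Z (p1 v) by case: v => [v|]; [apply: near_vertex|apply: lexx].
have Zc f t : f \in subdivide E e -> t \in `[0, 1] -> Z (c1 f t).
  by move=> fS t01; have [e' [t' [e'E t'01 ->]]] := c1E f t fS t01; apply: near_arc.
pose T := wedge_map a b d q u.
exists (T \o p1), (fun f => T \o c1 f); split.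
- apply: (@drawn_transform _ _ _ _ _ Z) => //.
    by move=> z /Zq; apply: wedge_map_continuous.
  by move=> z w /Zq zq /Zq wq; apply: wedge_map_inj.
- by rewrite /T /= -xE wedge_map_apex.
- have [inj _ _ _ _] := dr1; move=> v; apply: wedge_map_triangle => //; first exact: (Zp (Some v)).
  by rewrite xE; apply/eqP=> /(inj (Some v) None).
- have [_ _ _ iv _] := dr1; move=> f t fS t01; apply: wedge_map_triangle => //.
    by apply: Zc => //; apply: in01W.
  by rewrite xE; apply/eqP; apply: (iv f None t fS t01).
Qed.

(** * Drawings assembled from pieces in disjoint regions *)

Section Pieces.
Variables (R : realType) (W : finType).
Implicit Types (E : edges W) (p : W -> R * R) (c : {set W} -> R -> R * R) (Q : set (R * R)).

(** The placement [p] is shared by all pieces, so its injectivity is left to the final drawing; the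
    region [Q] is what keeps open arcs of different pieces apart. *)
Definition piece E p c Q : Prop :=
  [/\ (forall e, e \in E ->
         {within `[0, 1], continuous (c e)} /\ {in `[0, 1] &, injective (c e)}),
      (forall e, e \in E -> [set c e 0; c e 1] = p @` [set` e]),
      (forall e v t, e \in E -> t \in `]0, 1[ -> c e t <> p v),
      (forall e e' s t, e \in E -> e' \in E -> e != e' ->
         s \in `]0, 1[ -> t \in `]0, 1[ -> c e s <> c e' t) &
      (forall e t, e \in E -> t \in `]0, 1[ -> Q (c e t))].

Lemma piece_union E1 E2 p c1 c2 Q1 Q2 : piece E1 p c1 Q1 -> piece E2 p c2 Q2 ->
  (forall z, Q1 z -> ~ Q2 z) ->
  piece (E1 :|: E2)%SET p (fun e => if e \in E1 then c1 e else c2 e) (Q1 `|` Q2).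
Proof.
move=> [a1 a2 a3 a4 a5] [b1 b2 b3 b4 b5] dis.
have in2 e : e \in (E1 :|: E2)%SET -> e \notin E1 -> e \in E2 by rewrite inE => /orP[->|].
split.
- by move=> e eE; case: ifPn => [/a1//|/(in2 e eE)/b1].
- by move=> e eE; case: ifPn => [/a2//|/(in2 e eE)/b2].
- by move=> e v t eE t01; case: ifPn => [e1|/(in2 e eE) e2]; [apply: a3|apply: b3].
- move=> e e' s t eE e'E ne s01 t01; case: ifPn => [e1|/(in2 e eE) e2]; case: ifPn => [e'1|/(in2 e' e'E) e'2].
  + exact: a4.
  + by move=> E; apply: (dis (c1 e s)); [apply: a5|rewrite E; apply: b5].
  + by move=> E; apply: (dis (c1 e' t)); [apply: a5|rewrite -E; apply: b5].
  + exact: b4.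
- by move=> e t eE t01; case: ifPn => [e1|/(in2 e eE) e2]; [left; apply: a5|right; apply: b5].
Qed.

Definition push (V : finType) (j : V -> W) (F : edges V) : edges W :=
  [set [set j v | v in f] | f : {set V} in F]%SET.

Lemma preim_imset (V : finType) (j : V -> W) (f : {set V}) : injective j ->
  (j @^-1: (j @: f))%SET = f.
Proof. by move=> ji; apply/setP=> v; rewrite inE mem_imset. Qed.

Lemma piece_push (V : finType) (j : V -> W) (F : edges V) (q : V -> R * R)
    (k : {set V} -> R -> R * R) p Q :
  drawn F q k -> injective j -> (forall v, p (j v) = q v) ->
  (forall f t, f \in F -> t \in `]0, 1[ -> Q (k f t)) ->
  (forall w, (exists v, w = j v) \/ ~ Q (p w)) ->
  piece (push j F) p (fun e => k (j @^-1: e)%SET) Q.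
Proof.
move=> [qi kc ends iv ii] ji pj kQ out; split.
- by move=> _ /imsetP[f fF ->]; rewrite preim_imset //; apply: kc.
- move=> _ /imsetP[f fF ->]; rewrite preim_imset // ends //; apply/seteqP; split=> z /=.
    by move=> [v vf <-]; exists (j v); rewrite ?pj //=; apply: imset_f.
  by move=> [_ /imsetP[v vf ->] <-]; exists v.
- move=> _ w t /imsetP[f fF ->] t01; rewrite preim_imset //.
  case: (out w) => [[v ->]|nQ]; first by rewrite pj; apply: iv.
  by move=> E; apply: nQ; rewrite -E; apply: kQ.
- move=> _ _ s t /imsetP[f fF ->] /imsetP[f' f'F ->] ne s01 t01; rewrite !preim_imset //.
  by apply: ii => //; apply: contraNneq ne => ->.
- by move=> _ t /imsetP[f fF ->] t01; rewrite preim_imset //; apply: kQ.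
Qed.
End Pieces.

Section Glue.
Variables (V1 V2 S : finType).

(** The subdividing vertex [None] is identified with the gadget vertex [x], called a port below. *)
Definition left_in (x : S) (o : option V1) : V1 + V2 + S := if o is Some v then inl (inl v) else inr x.
Definition right_in (x : S) (o : option V2) : V1 + V2 + S := if o is Some v then inl (inr v) else inr x.

Definition gluing (F : edges S) (x1 x2 : S) (E1 : edges V1) e1 (E2 : edges V2) e2 :
    edges (V1 + V2 + S) :=
  (push (left_in x1) (subdivide E1 e1) :|: push (right_in x2) (subdivide E2 e2) :|:
   push (inr : S -> V1 + V2 + S) F)%SET.

Lemma left_in_inj x : injective (left_in x).
Proof. by move=> [v|] [w|] //= [->]. Qed.

Lemma right_in_inj x : injective (right_in x).
Proof. by move=> [v|] [w|] //= [->]. Qed.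

(** Each port is the apex of a triangle reserved for one part. As [triangle] is open, edges of the
    gadget may run along its boundary. *)
Definition gadget_room (R : realType) (F : edges S) (x1 x2 : S) : Prop :=
  exists (p : S -> R * R) (c : {set S} -> R -> R * R) b1 d1 b2 d2,
  let T z := triangle (p x1) b1 d1 z \/ triangle (p x2) b2 d2 z in
  [/\ drawn F p c,
      cross (b1 - p x1) (d1 - p x1) != 0 /\ cross (b2 - p x2) (d2 - p x2) != 0,
      (forall z, triangle (p x1) b1 d1 z -> ~ triangle (p x2) b2 d2 z),
      (forall s, ~ T (p s)) &
      (forall f t, f \in F -> t \in `]0, 1[ -> ~ T (c f t))].

(** Three pieces: each part in its triangle, the gadget in the complement of both triangles. *)
Lemma drawn_glue (R : realType) (F : edges S) x1 x2 E1 e1 E2 e2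
    (p1 : V1 -> R * R) c1 (p2 : V2 -> R * R) c2 :
  gadget_room R F x1 x2 -> drawn E1 p1 c1 -> e1 \in E1 -> drawn E2 p2 c2 -> e2 \in E2 ->
  exists (p : V1 + V2 + S -> R * R) c, drawn (gluing F x1 x2 E1 e1 E2 e2) p c.
Proof.
move=> [p [c [b1 [d1 [b2 [d2 [dF [nd1 nd2] T12 Tp Tc]]]]]]] dr1 e1E dr2 e2E.
have [q1 [k1 [D1 q1N q1S k1T]]] := wedge_drawing dr1 e1E nd1.
have [q2 [k2 [D2 q2N q2S k2T]]] := wedge_drawing dr2 e2E nd2.
pose P (w : V1 + V2 + S) := match w with
  | inl (inl v) => q1 (Some v) | inl (inr v) => q2 (Some v) | inr s => p s end.
have Pi : injective P.
  have [i1 _ _ _ _] := D1; have [i2 _ _ _ _] := D2; have [i3 _ _ _ _] := dF.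
  move=> [[v|v]|s] [[w|w]|r] /=.
  - by move/i1=> [->].
  - by move=> E; case: (T12 (q1 (Some v))); rewrite // E.
  - by move=> E; case: (Tp r); left; rewrite -E.
  - by move=> E; case: (T12 (q1 (Some w))); rewrite // -E.
  - by move/i2=> [->].
  - by move=> E; case: (Tp r); right; rewrite -E.
  - by move=> E; case: (Tp s); left; rewrite E.
  - by move=> E; case: (Tp s); right; rewrite E.
  - by move/i3=> ->.
have pc1 : piece (push (left_in x1) (subdivide E1 e1)) P (fun e => k1 (left_in x1 @^-1: e)%SET) (triangle (p x1) b1 d1).
  apply: piece_push D1 (@left_in_inj x1) _ k1T _; first by case.
  move=> [[v|v]|s]; first by left; exists (Some v).
    by right=> h; apply: (T12 _ h); apply: q2S.
  by right=> h; apply: (Tp s); left.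
have pc2 : piece (push (right_in x2) (subdivide E2 e2)) P (fun e => k2 (right_in x2 @^-1: e)%SET) (triangle (p x2) b2 d2).
  apply: piece_push D2 (@right_in_inj x2) _ k2T _; first by case.
  move=> [[v|v]|s]; last by right=> h; apply: (Tp s); right.
    by right; apply: T12; apply: q1S.
  by left; exists (Some v).
have pc3 : piece (push (inr : S -> V1 + V2 + S) F) P (fun e => c (inr @^-1: e)%SET)
    (fun z => ~ (triangle (p x1) b1 d1 z \/ triangle (p x2) b2 d2 z)).
  apply: piece_push dF _ _ Tc _ => //; first by move=> u v [].
  move=> [[v|v]|s]; last by left; exists s.
    by right=> h; apply: h; left; apply: q1S.
  by right=> h; apply: h; right; apply: q2S.
have [|h1 h2 h3 h4 h5] := piece_union (piece_union pc1 pc2 T12) pc3.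
  by move=> z [h|h] h'; apply: h'; [left|right].
exists P; eexists; split; [exact: Pi|exact: h1|exact: h2|exact: h3|exact: h4].
Qed.
End Glue.

Arguments left_in {V1 V2 S} x o.
Arguments right_in {V1 V2 S} x o.

(** * Straight-line drawings and gadgets *)

Section StraightLine.

Definition orient (a b z : int * int) : int :=
  (b.1 - a.1) * (z.2 - a.2) - (b.2 - a.2) * (z.1 - a.1).

(* A line through two of the points weakly separates A from B and misses one of the points. *)
Definition line_separated (A B : seq (int * int)) : bool :=
  has (fun a => has (fun b =>
    [&& all (fun z => 0 <= orient a b z) A, all (fun z => orient a b z <= 0) B &
        has (fun z => orient a b z != 0) (A ++ B)]) (A ++ B)) (A ++ B).

Definition grid_point (P : seq (nat * nat)) i : int * int :=
  ((nth (0, 0)%N P i).1%:Z, (nth (0, 0)%N P i).2%:Z).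

Definition grid_segment (P : seq (nat * nat)) (u : nat * nat) := [:: grid_point P u.1; grid_point P u.2].

(** A certificate decidable by integer computation. Edges with a common end are tested too: only
    relative interiors have to be disjoint, and a weakly separating line ensures this. *)
Definition straight_check n (L : seq (nat * nat)) (P : seq (nat * nat)) : bool :=
  [&& size P == n, uniq P, all (fun u => u.1 < u.2 < n)%N L,
      all (fun u => all (fun w => [|| w == u.1, w == u.2 | line_separated (grid_segment P u) [:: grid_point P w]])
                        (iota 0 n)) L &
      all (fun u => all (fun v => (u == v) || line_separated (grid_segment P u) (grid_segment P v)) L) L].

Definition edge_set n (L : seq (nat * nat)) : edges 'I_n :=
  [set e | [exists u : 'I_n * 'I_n, ((val u.1, val u.2) \in L) && (e == [set u.1; u.2])]]%SET.

Lemma edge_setP n L (e : {set 'I_n}) :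
  reflect (exists i j : 'I_n, (val i, val j) \in L /\ e = [set i; j]%SET) (e \in edge_set n L).
Proof.
rewrite inE; apply: (iffP existsP) => [[[i j] /andP[ij /eqP E]]|[i [j [ij ->]]]].
  by exists i, j.
by exists (i, j); rewrite ij /=.
Qed.

Variable R : realType.
Implicit Types (z w : R * R).

Definition between z w (t : R) : R * R := (z.1 + t * (w.1 - z.1), z.2 + t * (w.2 - z.2)).

Lemma between0 z w : between z w 0 = z.
Proof. by rewrite /between !mul0r !addr0 -surjective_pairing. Qed.

Lemma between1 z w : between z w 1 = w.
Proof. by rewrite /between !mul1r ![_ + (_ - _)]addrC !subrK -surjective_pairing. Qed.

Lemma between_inj z w : z != w -> injective (between z w).
Proof.
move=> zw s t [/addrI h1 /addrI h2].
have [E1|n1] := eqVneq (w.1 - z.1) 0; last exact: mulIf h1.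
have [E2|n2] := eqVneq (w.2 - z.2) 0; last exact: mulIf h2.
by move: zw; rewrite -[w](subrK z) -[w - z]/(w.1 - z.1, w.2 - z.2) E1 E2 add0r eqxx.
Qed.

Definition real_pt (a : int * int) : R * R := (a.1%:~R, a.2%:~R).

(* The relative interior of the convex hull, described by affine functionals. *)
Definition open_hull (A : seq (int * int)) z := forall al be ga : R,
  let f w := al * w.1 + be * w.2 + ga in
  (forall a, a \in A -> 0 <= f (real_pt a)) ->
  0 <= f z /\ ((exists2 a, a \in A & 0 < f (real_pt a)) -> 0 < f z).

Lemma line_separated_disjoint A B z : line_separated A B -> open_hull A z -> ~ open_hull B z.
Proof.
move=> /hasP[a _ /hasP[b _ /and3P[/allP hA /allP hB /hasP[c cAB c0]]]] zA zB.
pose al : R := - (b.2 - a.2)%:~R; pose be : R := (b.1 - a.1)%:~R.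
pose ga : R := (b.2 - a.2)%:~R * a.1%:~R - (b.1 - a.1)%:~R * a.2%:~R.
have fE (w : int * int) : al * (real_pt w).1 + be * (real_pt w).2 + ga = (orient a b w)%:~R.
  by rewrite /orient /real_pt /al /be /ga /= !(rmorphB, rmorphM) /=; ring.
have fE' (w : int * int) : - al * (real_pt w).1 + - be * (real_pt w).2 + - ga = - (orient a b w)%:~R.
  by rewrite -fE; ring.
have [|A1 A2] := zA al be ga; first by move=> w /hA; rewrite fE ler0z.
have [|B1 B2] := zB (- al) (- be) (- ga); first by move=> w /hB; rewrite fE' oppr_ge0 lerz0.
move: cAB; rewrite mem_cat => /orP[cA|cB].
  have : 0 < al * z.1 + be * z.2 + ga.
    by apply: A2; exists c => //; rewrite fE ltr0z lt_neqAle eq_sym c0; apply: hA.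
  move: B1; lra.
have : 0 < - al * z.1 + - be * z.2 + - ga.
  by apply: B2; exists c => //; rewrite fE' oppr_gt0 ltrz0 lt_neqAle c0; apply: hB.
move: A1; lra.
Qed.

Lemma open_hull_point a : open_hull [:: a] (real_pt a).
Proof.
move=> al be ga f H; split; first by apply: H; rewrite mem_head.
by move=> [b]; rewrite inE => /eqP ->.
Qed.

Lemma open_hull_segment a b (t : R) : 0 < t < 1 ->
  open_hull [:: a; b] (between (real_pt a) (real_pt b) t).
Proof.
move=> /andP[t0 t1] al be ga f H.
have Ha : 0 <= f (real_pt a) by apply: H; rewrite !inE eqxx.
have Hb : 0 <= f (real_pt b) by apply: H; rewrite !inE eqxx orbT.
have -> : f (between (real_pt a) (real_pt b) t) = (1 - t) * f (real_pt a) + t * f (real_pt b).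
  by rewrite /f /between /=; ring.
have t1' : 0 < 1 - t by lra.
split; first by rewrite addr_ge0 // mulr_ge0 // ltW.
move=> [w]; rewrite !inE => /orP[/eqP ->|/eqP ->] h.
  by rewrite ltr_pwDl ?mulr_gt0 // mulr_ge0 // ltW.
by rewrite ltr_wpDl ?mulr_gt0 // mulr_ge0 // ltW.
Qed.

Lemma open_hull_triangle a b d z : triangle (real_pt a) (real_pt b) (real_pt d) z ->
  open_hull [:: a; b; d] z.
Proof.
move=> [s [t [s0 t0 st ->]]] al be ga f H.
have Ha : 0 <= f (real_pt a) by apply: H; rewrite !inE eqxx.
have Hb : 0 <= f (real_pt b) by apply: H; rewrite !inE eqxx orbT.
have Hd : 0 <= f (real_pt d) by apply: H; rewrite !inE eqxx !orbT.
set z0 := (_, _).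
have -> : f z0 = (1 - s - t) * f (real_pt a) + s * f (real_pt b) + t * f (real_pt d).
  by rewrite /f /=; ring.
have st' : 0 < 1 - s - t by lra.
have A := mulr_ge0 (ltW st') Ha; have B := mulr_ge0 (ltW s0) Hb; have C := mulr_ge0 (ltW t0) Hd.
split; first by rewrite !addr_ge0.
move=> [w]; rewrite !inE => /or3P[] /eqP -> h.
- have := mulr_gt0 st' h; lra.
- have := mulr_gt0 s0 h; lra.
- have := mulr_gt0 t0 h; lra.
Qed.

Lemma real_pt_inj : injective real_pt.
Proof. by move=> [a b] [c d] [/intr_inj -> /intr_inj ->]. Qed.

Definition straight_arc n (L P : seq (nat * nat)) (e : {set 'I_n}) (t : R) : R * R :=
  if [pick u : 'I_n * 'I_n | ((val u.1, val u.2) \in L) && (e == [set u.1; u.2]%SET)]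
    is Some u then between (real_pt (grid_point P u.1)) (real_pt (grid_point P u.2)) t else (0, 0).

Lemma grid_point_inj n P (i j : 'I_n) : size P = n -> uniq P ->
  real_pt (grid_point P i) = real_pt (grid_point P j) -> i = j.
Proof.
move=> sP uP /real_pt_inj [] h1 h2; apply/val_inj/eqP.
rewrite -(nth_uniq (0, 0)%N _ _ uP) ?sP ?ltn_ord //; apply/eqP.
by rewrite [LHS]surjective_pairing [RHS]surjective_pairing h1 h2.
Qed.

Lemma straight_arcP n L P (e : {set 'I_n}) : e \in edge_set n L ->
  exists i j : 'I_n, [/\ (val i, val j) \in L, e = [set i; j]%SET &
   straight_arc L P e = between (real_pt (grid_point P i)) (real_pt (grid_point P j))].
Proof.
move=> /edge_setP[i [j [ij eE]]]; rewrite /straight_arc.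
case: pickP => [[a b] /= /andP[ab /eqP E]|/(_ (i, j)) /=]; last by rewrite ij eE eqxx.
by exists a, b; split=> //; apply/funext.
Qed.

Lemma straight_drawn n L P : straight_check n L P ->
  drawn (edge_set n L) (fun i : 'I_n => real_pt (grid_point P i)) (@straight_arc n L P).
Proof.
move=> /and5P[/eqP sP uP /allP Lo /allP Lv /allP Le].
have pinj := @grid_point_inj n P _ _ sP uP.
have neq (i j : 'I_n) : (val i, val j) \in L -> real_pt (grid_point P i) != real_pt (grid_point P j).
  by move=> /Lo /andP[ij _]; apply: contraTneq ij => /pinj ->; rewrite ltnn.
split.
- by move=> i j; apply: pinj.
- move=> e eE; have [i [j [ijL _ ->]]] := straight_arcP P eE.
  split; first by apply: continuous_subspaceT; apply: segment_continuous.
  by move=> s t _ _; apply: between_inj; apply: neq ijL.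
- move=> e eE; have [i [j [ijL eij ->]]] := straight_arcP P eE; rewrite between0 between1 eij.
  apply/seteqP; split=> z /=.
    by move=> [-> | ->]; [exists i|exists j] => //; rewrite !inE eqxx ?orbT.
  by move=> [w]; rewrite !inE => /orP[/eqP -> | /eqP ->] <-; [left|right].
- move=> e w t eE t01; have [i [j [ijL eij ->]]] := straight_arcP P eE.
  rewrite in_itv /= in t01; have hs := @open_hull_segment (grid_point P i) (grid_point P j) t t01.
  have /allP/(_ (val w)) := Lv _ ijL; rewrite mem_iota /= add0n ltn_ord => /(_ isT).
  case/or3P => [/eqP/val_inj ->|/eqP/val_inj ->|sp E].
  - by rewrite -[RHS](between0 _ (real_pt (grid_point P j))) => /(between_inj (neq _ _ ijL)) E; rewrite E ltxx in t01.
  - by rewrite -[RHS](between1 (real_pt (grid_point P i))) => /(between_inj (neq _ _ ijL)) E; rewrite E ltxx andbF in t01.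
  - by apply: (line_separated_disjoint sp hs); rewrite E; apply: open_hull_point.
- move=> e e' s t eE e'E ne; rewrite !in_itv /= => s01 t01.
  have [i [j [ijL eij cE]]] := straight_arcP P eE.
  have [k [l [klL ekl cE']]] := straight_arcP P e'E; rewrite cE cE'.
  have /allP/(_ _ klL) /orP[/eqP[ik jl]|sp] := Le _ ijL.
    by move: ne; rewrite eij ekl (val_inj ik) (val_inj jl) eqxx.
  move=> E; apply: (line_separated_disjoint sp (@open_hull_segment (grid_point P i) (grid_point P j) s s01)).
  by rewrite E; apply: open_hull_segment.
Qed.
End StraightLine.

(** * The graph class and its transport along maps of the vertices *)

Section GraphClass.
Implicit Types V W : finType.

Definition simple V (E : edges V) := [forall e in E, #|e| == 2%N].

Definition deg V (E : edges V) (v : V) := #|[set e in E | v \in e]%SET|.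

Definition adj V (E : edges V) : rel V := [rel x y | (x, y) \in arcs_of E].

Definition connected_graph V (E : edges V) := [forall x, forall y, connect (adj E) x y].

Definition good (R : realType) d D V (E : edges V) : bool :=
  [&& simple E, [forall v, (d <= deg E v <= D)%N] &
      `[< exists (p : V -> R * R) (c : {set V} -> R -> R * R), drawn E p c >]].

Lemma adjP V (E : edges V) x y : reflect (x != y /\ [set x; y]%SET \in E) (adj E x y).
Proof. exact: arcs_ofP. Qed.

Lemma adj_sym V (E : edges V) : symmetric (adj E).
Proof. by move=> x y; apply/adjP/adjP; rewrite eq_sym finset.setUC. Qed.

Lemma connect_adj_sym V (E : edges V) : connect_sym (adj E).
Proof. exact: sym_connect_sym (@adj_sym V E). Qed.

Lemma connected_rootP V (E : edges V) r : (forall x, connect (adj E) x r) -> connected_graph E.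
Proof.
move=> H; apply/forallP=> x; apply/forallP=> y; apply: connect_trans (H x) _.
by rewrite connect_adj_sym.
Qed.

Lemma connected_graphP V (E : edges V) x y : connected_graph E -> connect (adj E) x y.
Proof. by move=> /forallP/(_ x)/forallP/(_ y). Qed.

Lemma simple_in V (E : edges V) e : simple E -> e \in E ->
  exists x y, x != y /\ e = [set x; y]%SET.
Proof. by move=> /forall_inP H /H /cards2P. Qed.

Lemma push_adj V W (j : V -> W) (E : edges V) x y : injective j ->
  adj (push j E) (j x) (j y) = adj E x y.
Proof.
move=> ji; apply/adjP/adjP; rewrite (inj_eq ji) => -[xy H]; split=> //.
  move: H => /imsetP[f fE] H.
  suff -> : [set x; y]%SET = f by [].
  by rewrite -(preim_imset f ji) -H -[in RHS](imset_set1 j x) -(imset_set1 j y) -imsetU preim_imset.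
by apply/imsetP; exists [set x; y]%SET; rewrite // imsetU !imset_set1.
Qed.

Lemma push_connect V W (j : V -> W) (E : edges V) x y : injective j ->
  connect (adj E) x y -> connect (adj (push j E)) (j x) (j y).
Proof.
move=> ji /connectP[p]; elim: p x => [x _ -> //|a p IH x /= /andP[xa pp] yl].
by apply: (connect_trans (y := j a)); [apply: connect1; rewrite push_adj|exact: IH].
Qed.

Lemma push_simple V W (j : V -> W) (E : edges V) : injective j -> simple E -> simple (push j E).
Proof.
move=> ji /forall_inP H; apply/forall_inP=> _ /imsetP[f fE ->].
by rewrite card_imset //; apply: H.
Qed.

Lemma push_deg V W (j : V -> W) (E : edges V) v : injective j -> deg (push j E) (j v) = deg E v.
Proof.
move=> ji; rewrite /deg -(card_imset _ (imset_inj ji)); apply: eq_card => f; rewrite !inE.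
apply/andP/imsetP => [[/imsetP[f0 f0E ->]]|[f0]].
  by rewrite mem_imset // => v0; exists f0; rewrite // inE f0E.
by rewrite inE => /andP[f0E vf] ->; split; [exact: imset_f|rewrite mem_imset].
Qed.

Lemma push_deg_out V W (j : V -> W) (E : edges V) w : (forall v, w != j v) -> deg (push j E) w = 0%N.
Proof.
move=> out; apply/eqP; rewrite cards_eq0; apply/eqP/setP=> f; rewrite !inE.
by apply/negP=> /andP[/imsetP[f0 _ ->] /imsetP[v _ wv]]; move: (out v); rewrite wv eqxx.
Qed.

Lemma deg_union V (E E' : edges V) v : (E :&: E' = finset.set0)%SET ->
  deg (E :|: E')%SET v = (deg E v + deg E' v)%N.
Proof.
move=> dis; rewrite /deg -cardsUI.
have -> : ([set e in E | v \in e] :&: [set e in E' | v \in e])%SET = finset.set0.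
  apply/setP=> e; rewrite !inE; have := congr1 (fun A : {set _} => e \in A) dis.
  by rewrite !inE; case: (e \in E); case: (e \in E'); rewrite ?andbF.
rewrite cards0 addn0; apply: eq_card => e; rewrite !inE.
by rewrite andb_orl.
Qed.

Lemma push_inj V W (j : V -> W) : injective j -> injective (push j).
Proof. by move=> ji; apply: imset_inj; apply: imset_inj. Qed.

Lemma push_bij_good (R : realType) d D V W (j : V -> W) (E : edges V) : bijective j ->
  good R d D E -> good R d D (push j E).
Proof.
move=> [k jk kj] /and3P[Es Ed /asboolP[p [c dr]]]; have ji : injective j := can_inj jk.
apply/and3P; split; first exact: push_simple.
  by apply/forallP=> w; rewrite -[w]kj push_deg //; apply: (forallP Ed).
apply/asboolP; exists (p \o k); eexists.
have [h1 h2 h3 h4 _] := @piece_push R W V j E p c (p \o k) [set: R * R] dr ji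
  (fun v => congr1 p (jk v)) (fun _ _ _ _ => I) (fun w => or_introl (ex_intro _ (k w) (esym (kj w)))).
split; [|exact: h1|exact: h2|exact: h3|exact: h4].
by have [pi _ _ _ _] := dr; apply: inj_comp => //; exact: can_inj kj.
Qed.

Lemma push_bij_connected V W (j : V -> W) (E : edges V) : bijective j ->
  connected_graph E -> connected_graph (push j E).
Proof.
move=> [k jk kj] Ec; apply/forallP=> x; apply/forallP=> y; rewrite -[x]kj -[y]kj.
by apply: push_connect; [exact: can_inj jk|exact: connected_graphP].
Qed.
End GraphClass.

Section SubdivideDegree.
Variables (V : finType) (E : edges V) (e : {set V}).
Hypotheses (Es : simple E) (eE : e \in E).

Lemma subdivide_simple : simple (subdivide E e).
Proof.
apply/forall_inP=> f /subdivideP[[f0 /setD1P[_ f0E] ->]|[v _ ->]].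
  by rewrite card_imset; [exact: (forall_inP Es)|exact: Some_inj].
by rewrite cards2.
Qed.

Lemma subdivide_deg_Some v : deg (subdivide E e) (Some v) = deg E v.
Proof.
(* The bijection between the edges at v before and after: [e] becomes its half at v, every other
   edge is copied. *)
pose G := (fun f : {set V} => if f == e then [set Some v; None]%SET else [set Some w | w in f]%SET).
have Gi : {in [set f in E | v \in f]%SET &, injective G}.
  have key f : f != e -> [set Some v; None]%SET = [set Some w | w in f]%SET -> False.
    move=> _ H; have : None \in [set Some w | w in f]%SET by rewrite -H !inE eqxx.
    by case/imsetP.
  move=> f f' _ _; rewrite /G; case: eqVneq => [->|fe]; case: eqVneq => [->|f'e] //.
  - by move/(key _ f'e).
  - by move/esym/(key _ fe).
  - exact: (imset_inj Some_inj).
rewrite /deg -(card_in_imset Gi); apply: eq_card => f; rewrite [LHS]inE.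
apply/andP/imsetP.
  case=> /subdivideP[[f0 /setD1P[f0e f0E] ->]|[w we ->]].
    rewrite mem_imset; last exact: Some_inj.
    by move=> vf0; exists f0; rewrite ?inE ?f0E // /G (negPf f0e).
  rewrite !inE orbF => /eqP[vw]; rewrite -vw in we *.
  by exists e; rewrite ?inE ?eE // /G eqxx.
move=> [f0]; rewrite inE /G => /andP[f0E vf0] ->; case: eqVneq => [f0e|f0e].
  split; last by rewrite !inE eqxx.
  by apply/subdivideP; right; exists v; rewrite -?f0e.
split; last by apply: imset_f.
by apply/subdivideP; left; exists f0; rewrite // in_setD1 f0e.
Qed.

Lemma subdivide_deg_None : deg (subdivide E e) None = 2%N.
Proof.
have [x [y [xy exy]]] := simple_in Es eE.
have -> : 2%N = #|[set [set Some v; None]%SET | v in e]%SET|.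
  rewrite card_in_imset; first by rewrite exy cards2 xy.
  move=> v w _ _ H; have : Some v \in [set Some w; None]%SET by rewrite -H !inE eqxx.
  by rewrite !inE orbF => /eqP[].
apply: eq_card => f; rewrite [LHS]inE.
apply/andP/imsetP.
  case=> /subdivideP[[f0 /setD1P[f0e f0E] ->]|[w we ->]]; first by case/imsetP.
  by exists w.
move=> [v ve ->]; split; last by rewrite !inE eqxx orbT.
by apply/subdivideP; right; exists v.
Qed.
End SubdivideDegree.

Section GlueClass.
Variables (V1 V2 S : finType) (F : edges S) (x1 x2 : S).
Variables (E1 : edges V1) (e1 : {set V1}) (E2 : edges V2) (e2 : {set V2}).
Hypotheses (Fs : simple F) (E1s : simple E1) (E2s : simple E2) (e1E : e1 \in E1) (e2E : e2 \in E2).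

Let G := gluing F x1 x2 E1 e1 E2 e2.
Let W := (V1 + V2 + S)%type.

Lemma inr_inj : injective (inr : S -> W).
Proof. by move=> u v []. Qed.

Lemma glueP (f : {set W}) : reflect
  [\/ exists2 g, g \in subdivide E1 e1 & f = [set left_in x1 v | v in g]%SET,
      exists2 g, g \in subdivide E2 e2 & f = [set right_in x2 v | v in g]%SET |
      exists2 g, g \in F & f = [set inr v | v in g]%SET] (f \in G).
Proof.
rewrite /G /gluing !inE; apply: (iffP orP) => [[/orP[]|]|[]].
- by move=> /imsetP[g gE ->]; constructor 1; exists g.
- by move=> /imsetP[g gE ->]; constructor 2; exists g.
- by move=> /imsetP[g gE ->]; constructor 3; exists g.
- by move=> H; left; apply/orP; left; apply/imsetP.
- by move=> H; left; apply/orP; right; apply/imsetP.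
- by move=> H; right; apply/imsetP.
Qed.

Lemma glue_simple : simple G.
Proof.
apply/forall_inP=> f /glueP[] [g gE ->]; rewrite card_imset;
  [|exact: left_in_inj| |exact: right_in_inj| |exact: inr_inj].
- exact: (forall_inP (subdivide_simple e1 E1s)).
- exact: (forall_inP (subdivide_simple e2 E2s)).
- exact: (forall_inP Fs).
Qed.

Lemma subdivide_vertex (V : finType) (E : edges V) e f : simple E -> f \in subdivide E e ->
  exists v, Some v \in f.
Proof.
move=> Es /subdivideP[[f0 /setD1P[_ f0E] ->]|[v _ ->]]; last by exists v; rewrite !inE eqxx.
by have [x [y [_ ->]]] := simple_in Es f0E; exists x; rewrite imset_f // !inE eqxx.
Qed.

(** Every edge of a subdivided part contains an old vertex of that part, so the three edge sets are
    disjoint and degrees add. *)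
Lemma glue_deg w : deg G w = (deg (push (left_in x1) (subdivide E1 e1)) w +
  deg (push (right_in x2) (subdivide E2 e2)) w + deg (push (inr : S -> W) F) w)%N.
Proof.
rewrite /G /gluing !deg_union //.
  apply/setP=> f; rewrite !inE; apply/negP=> /andP[/imsetP[g gE fg] /imsetP[h hE fh]].
  have [v vg] := subdivide_vertex E1s gE.
  have : left_in x1 (Some v) \in f by rewrite fg imset_f.
  by rewrite fh => /imsetP[[ow|] _].
apply/setP=> f; rewrite !inE; apply/negP=> /andP[fE /imsetP[h hE fh]].
move: fE => /orP[] /imsetP[g gE fg].
  have [v vg] := subdivide_vertex E1s gE.
  have : left_in x1 (Some v) \in f by rewrite fg imset_f.
  by rewrite fh => /imsetP[ow _].
have [v vg] := subdivide_vertex E2s gE.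
have : right_in x2 (Some v) \in f by rewrite fg imset_f.
by rewrite fh => /imsetP[ow _].
Qed.

Lemma glue_deg_left v : deg G (inl (inl v)) = deg E1 v.
Proof.
rewrite glue_deg -[inl (inl v)]/(left_in x1 (Some v)) push_deg; last exact: left_in_inj.
by rewrite !push_deg_out ?addn0 ?subdivide_deg_Some //; case.
Qed.

Lemma glue_deg_right v : deg G (inl (inr v)) = deg E2 v.
Proof.
rewrite glue_deg -[inl (inr v)]/(right_in x2 (Some v)) [X in (_ + X + _)%N]push_deg; last exact: right_in_inj.
by rewrite !push_deg_out ?addn0 ?add0n ?subdivide_deg_Some //; case.
Qed.

(** The ends of the subdivided edge become neighbours of the port, hence the 2 for which a gadget
    must leave room. *)
Lemma glue_deg_gadget s : deg G (inr s) = ((s == x1) * 2 + (s == x2) * 2 + deg F s)%N.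
Proof.
rewrite glue_deg [X in (_ + X)%N]push_deg; last exact: inr_inj.
congr (_ + _ + _)%N.
  case: eqVneq => [->|sx].
    by rewrite -[inr x1]/(left_in x1 None) push_deg ?subdivide_deg_None //; exact: left_in_inj.
  by rewrite push_deg_out // => -[v|] //=; apply: contra sx => /eqP[->].
case: eqVneq => [->|sx].
  by rewrite -[inr x2]/(right_in x2 None) push_deg ?subdivide_deg_None //; exact: right_in_inj.
by rewrite push_deg_out // => -[v|] //=; apply: contra sx => /eqP[->].
Qed.

Lemma subdivide_connect (V : finType) (E : edges V) e u v : simple E -> e \in E ->
  connect (adj E) u v -> connect (adj (subdivide E e)) (Some u) (Some v).
Proof.
move=> Es eE /connectP[p]; elim: p u => [u _ -> //|a p IH u /= /andP[/adjP[ua uaE] pp] vl].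
apply: (connect_trans (y := Some a)); last exact: IH.
have [eua|ne] := eqVneq [set u; a]%SET e.
  apply: (connect_trans (y := None)).
    apply: connect1; apply/adjP; split=> //; apply/subdivideP; right; exists u => //.
    by rewrite -eua !inE eqxx.
  rewrite connect_adj_sym; apply: connect1; apply/adjP; split=> //; apply/subdivideP; right; exists a => //.
  by rewrite -eua !inE eqxx orbT.
apply: connect1; apply/adjP; split; first by apply: contra ua => /eqP[->].
apply/subdivideP; left; exists [set u; a]%SET; first by rewrite in_setD1 ne.
by rewrite imsetU !imset_set1.
Qed.

Lemma subdivide_connected (V : finType) (E : edges V) e (u : option V) : simple E -> e \in E ->
  connected_graph E -> connect (adj (subdivide E e)) u None.
Proof.
move=> Es eE Ec; case: u => [u|] //; have [x [y [xy exy]]] := simple_in Es eE.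
apply: (connect_trans (y := Some x)); first by apply: subdivide_connect => //; apply: connected_graphP.
apply: connect1; apply/adjP; split=> //; apply/subdivideP; right; exists x => //.
by rewrite exy !inE eqxx.
Qed.

Lemma adj_sub_connect (V : finType) (E E' : edges V) x y : E \subset E' ->
  connect (adj E) x y -> connect (adj E') x y.
Proof.
move=> /fintype.subsetP EE'; apply: connect_sub => a b /adjP[ab /EE' abE]; apply: connect1; exact/adjP.
Qed.

Lemma glue_connected : connected_graph E1 -> connected_graph E2 -> connected_graph F ->
  connected_graph G.
Proof.
move=> c1 c2 cF; apply: (@connected_rootP _ _ (inr x1)).
have s1 : push (left_in x1) (subdivide E1 e1) \subset G.
  by apply/fintype.subsetP=> f fE; rewrite /G /gluing !inE fE.
have s2 : push (right_in x2) (subdivide E2 e2) \subset G.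
  by apply/fintype.subsetP=> f fE; rewrite /G /gluing !inE fE orbT.
have s3 : push (inr : S -> W) F \subset G.
  by apply/fintype.subsetP=> f fE; rewrite /G /gluing !inE fE !orbT.
have hS s : connect (adj G) (inr s) (inr x1).
  by apply: (adj_sub_connect s3); apply: push_connect; [exact: inr_inj|exact: connected_graphP].
move=> [[v|v]|s] //.
  apply: (adj_sub_connect s1).
  exact: (push_connect (@left_in_inj V1 V2 S x1) (subdivide_connected (Some v) E1s e1E c1)).
apply: (connect_trans (y := inr x2)) (hS x2); apply: (adj_sub_connect s2).
exact: (push_connect (@right_in_inj V1 V2 S x2) (subdivide_connected (Some v) E2s e2E c2)).
Qed.

Lemma glue_good (R : realType) d D : gadget_room R F x1 x2 ->
  (forall s, (d <= (s == x1) * 2 + (s == x2) * 2 + deg F s <= D)%N) ->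
  good R d D E1 -> good R d D E2 -> good R d D G.
Proof.
move=> room degF /and3P[_ /forallP d1 /asboolP[p1 [c1 D1]]] /and3P[_ /forallP d2 /asboolP[p2 [c2 D2]]].
apply/and3P; split; first exact: glue_simple.
  apply/forallP=> -[[v|v]|s]; first by rewrite glue_deg_left.
    by rewrite glue_deg_right.
  by rewrite glue_deg_gadget.
by apply/asboolP; apply: drawn_glue D1 e1E D2 e2E.
Qed.
End GlueClass.

Section ListGraphs.
Implicit Types (n : nat) (L P : seq (nat * nat)).

Definition degree_in L v := count (fun u => (u.1 == v) || (u.2 == v)) L.

(** Edges are listed with the smaller end first, so the last clause gives every vertex but 0 a
    smaller neighbour; this is how connectedness is checked. *)
Definition graph_check n L P : bool :=
  [&& straight_check n L P, uniq L, n > 0 & all (fun i => has (fun u => u.2 == i) L) (iota 1 n.-1)]%N.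

Lemma straight_check_lt n L P u : straight_check n L P -> u \in L -> (u.1 < u.2 < n)%N.
Proof. by move=> /and5P[_ _ /allP H _ _] /H. Qed.

Lemma edge_set_simple n L P : straight_check n L P -> simple (edge_set n L).
Proof.
move=> ck; apply/forall_inP=> e /edge_setP[i [j [ijL ->]]].
have /andP[ij _] := straight_check_lt ck ijL.
by rewrite cards2 (_ : i != j) //; apply: contraTneq ij => ->; rewrite ltnn.
Qed.

Lemma edge_set_deg n L P (v : 'I_n) : straight_check n L P -> uniq L ->
  deg (edge_set n L) v = degree_in L v.
Proof.
move=> ck uL; rewrite /degree_in -size_filter.
pose mk (u : nat * nat) : {set 'I_n} := [set i : 'I_n | (val i == u.1) || (val i == u.2)]%SET.
set L' := [seq u <- L | _].
have mkE (i j : 'I_n) : mk (val i, val j) = [set i; j]%SET.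
  by apply/setP=> k; rewrite !inE /= !val_eqE.
have L'L u : u \in L' -> u \in L by rewrite mem_filter => /andP[].
have toI u : u \in L -> exists i j : 'I_n, u = (val i, val j).
  move=> /(straight_check_lt ck) /andP[h1 h2].
  by exists (Ordinal (ltn_trans h1 h2)), (Ordinal h2); rewrite /= -surjective_pairing.
have mki : {in L' &, injective mk}.
  move=> u w /L'L uL0 /L'L wL0; have [i [j ue]] := toI _ uL0; have [k [l we]] := toI _ wL0.
  have /andP[ij _] := straight_check_lt ck uL0; have /andP[kl _] := straight_check_lt ck wL0.
  rewrite ue we /= in ij kl *; rewrite !mkE => E.
  have := congr1 (fun A : {set 'I_n} => i \in A) E; have := congr1 (fun A : {set 'I_n} => j \in A) E.
  have := congr1 (fun A : {set 'I_n} => k \in A) E; rewrite !inE !eqxx ?orbT /=.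
  move=> /orP[/eqP ik|/eqP kj]; move=> /esym/orP[/eqP jk|/eqP jl]; move=> /esym/orP[/eqP ik'|/eqP il]; subst => //;
    by move: ij kl; rewrite ?ltnn // => h1 h2; have := ltn_trans h1 h2; rewrite ltnn.
have um : uniq (map mk L') by rewrite map_inj_in_uniq // filter_uniq.
rewrite -(size_map mk) -(card_uniqP um); apply: eq_card => e; rewrite [LHS]inE.
apply/andP/mapP => [[/edge_setP[i [j [ijL ->]]]]|[u uL' ->]].
  rewrite !inE => vij; exists (val i, val j); last by rewrite mkE.
  by rewrite mem_filter ijL andbT /= !val_eqE ![_ == v]eq_sym.
have [i [j ue]] := toI _ (L'L _ uL'); rewrite ue mkE; split.
  by apply/edge_setP; exists i, j; rewrite -ue L'L.
by move: uL'; rewrite mem_filter ue /= !val_eqE !inE ![_ == v]eq_sym => /andP[].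
Qed.

Lemma edge_set_connected n L P : graph_check n L P -> connected_graph (edge_set n L).
Proof.
move=> /and4P[ck _ n0 /allP H].
pose r := Ordinal n0; apply: (@connected_rootP _ _ r) => -[m mn].
elim/ltn_ind: m mn => m IH mn; have [m0|m0] := posnP m.
  by have -> : Ordinal mn = r by apply: val_inj.
have /hasP[u uL /eqP um] : has (fun u => u.2 == m) L.
  by apply: H; rewrite mem_iota m0 add1n prednK.
have /andP[u12 _] := straight_check_lt ck uL; rewrite um in u12.
have un := ltn_trans u12 mn.
apply: (connect_trans (y := Ordinal un)); last exact: IH.
apply: connect1; apply/adjP; split; first by rewrite -val_eqE /= gtn_eqF.
apply/edge_setP; exists (Ordinal un), (Ordinal mn); rewrite finset.setUC; split=> //=.
by rewrite -um -surjective_pairing.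
Qed.

Lemma edge_set_good (R : realType) d D n L P : graph_check n L P ->
  all (fun v => d <= degree_in L v <= D)%N (iota 0 n) -> good R d D (edge_set n L).
Proof.
move=> /and4P[ck uL n0 _] /allP H; apply/and3P; split; first exact: edge_set_simple ck.
  by apply/forallP=> v; rewrite (edge_set_deg _ ck) //; apply: H; rewrite mem_iota /=.
by apply/asboolP; exists (fun i : 'I_n => real_pt R (grid_point P i)), (@straight_arc R n L P); apply: straight_drawn.
Qed.

Definition room_check n L P (x1 x2 : nat) (b1 d1 b2 d2 : int * int) : bool :=
  let T1 := [:: grid_point P x1; b1; d1] in let T2 := [:: grid_point P x2; b2; d2] in
  [&& orient (grid_point P x1) b1 d1 != 0, orient (grid_point P x2) b2 d2 != 0, line_separated T1 T2,
      all (fun s => line_separated T1 [:: grid_point P s] && line_separated T2 [:: grid_point P s]) (iota 0 n) &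
      all (fun u => line_separated T1 (grid_segment P u) && line_separated T2 (grid_segment P u)) L].

Lemma edge_set_room (R : realType) n L P (x1 x2 : 'I_n) b1 d1 b2 d2 :
  straight_check n L P -> room_check n L P x1 x2 b1 d1 b2 d2 ->
  gadget_room R (edge_set n L) x1 x2.
Proof.
move=> ck /and5P[nd1 nd2 T12 /allP Tp /allP Ts].
exists (fun i : 'I_n => real_pt R (grid_point P i)), (@straight_arc R n L P).
exists (real_pt R b1), (real_pt R d1), (real_pt R b2), (real_pt R d2).
have crE a b d : cross (real_pt R b - real_pt R a) (real_pt R d - real_pt R a) = (orient a b d)%:~R.
  by rewrite /cross /orient /real_pt /= !(rmorphB, rmorphM).
split=> /=.
- exact: straight_drawn.
- by rewrite !crE !intr_eq0.
- by move=> z /open_hull_triangle h1 /open_hull_triangle; apply: line_separated_disjoint h1.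
- move=> s; have /andP[s1 s2] : line_separated [:: grid_point P x1; b1; d1] [:: grid_point P s] &&
      line_separated [:: grid_point P x2; b2; d2] [:: grid_point P s] by apply: Tp; rewrite mem_iota /=.
  by move=> [/open_hull_triangle h|/open_hull_triangle h];
    [apply: (line_separated_disjoint s1 h)|apply: (line_separated_disjoint s2 h)]; apply: open_hull_point.
- move=> f t fE; rewrite in_itv /= => t01; have [i [j [ijL _ ->]]] := straight_arcP R P fE.
  have /andP[s1 s2] := Ts _ ijL.
  by move=> [/open_hull_triangle h|/open_hull_triangle h];
    [apply: (line_separated_disjoint s1 h)|apply: (line_separated_disjoint s2 h)]; apply: open_hull_segment.
Qed.
End ListGraphs.

(** Small members of the classes, as edges and coordinates. All are regular except [wheel4], with
    degrees 3 and 4, and [dual_C30], with degrees 5 and 6. *)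
Definition K3 := ([:: (0, 1); (0, 2); (1, 2)], [:: (0, 0); (1, 0); (0, 1)])%N.
Definition K4 := ([:: (0, 1); (0, 2); (1, 2); (0, 3); (1, 3); (2, 3)],
  [:: (0, 0); (3, 0); (0, 3); (1, 1)])%N.
Definition wheel4 := ([:: (0, 1); (0, 2); (0, 3); (1, 3); (1, 4); (2, 3); (2, 4); (3, 4)],
  [:: (3, 0); (6, 4); (0, 3); (2, 3); (2, 7)])%N.
Definition octahedron := ([:: (0, 1); (0, 2); (0, 3); (0, 4); (1, 2); (1, 4); (1, 5); (2, 3); (2, 5);
    (3, 4); (3, 5); (4, 5)],
  [:: (6, 0); (4, 4); (0, 1); (3, 1); (4, 2); (3, 2)])%N.
Definition medial_prism := ([:: (0, 1); (0, 2); (0, 3); (0, 4); (1, 2); (1, 4); (1, 5); (2, 3); (2, 5);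
    (3, 6); (3, 7); (4, 6); (4, 8); (5, 7); (5, 8); (6, 7); (6, 8); (7, 8)],
  [:: (6, 6); (7, 5); (7, 6); (6, 8); (5, 4); (8, 5); (0, 7); (11, 10); (8, 0)])%N.
Definition icosahedron := ([:: (0, 1); (0, 2); (0, 3); (0, 4); (0, 5); (1, 2); (1, 5); (1, 6); (1, 7);
    (2, 3); (2, 7); (2, 8); (3, 4); (3, 8); (3, 9); (4, 5); (4, 9); (4, 10); (5, 6); (5, 10); (6, 7);
    (6, 10); (6, 11); (7, 8); (7, 11); (8, 9); (8, 11); (9, 10); (9, 11); (10, 11)],
  [:: (19, 0); (12, 18); (0, 3); (10, 4); (13, 5); (13, 8); (11, 10); (8, 9); (8, 6); (10, 6);
    (11, 7); (9, 8)])%N.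
(* The dual of the fullerene C30. *)
Definition dual_C30 := ([:: (0, 1); (0, 2); (0, 3); (0, 4); (0, 5); (1, 2); (1, 5); (1, 6); (1, 7);
    (2, 3); (2, 7); (2, 8); (3, 4); (3, 8); (3, 9); (4, 5); (4, 9); (4, 10); (5, 6); (5, 10); (6, 7);
    (6, 10); (6, 11); (6, 12); (7, 8); (7, 12); (7, 13); (8, 9); (8, 13); (8, 14); (9, 10); (9, 14);
    (9, 15); (10, 11); (10, 15); (11, 12); (11, 15); (11, 16); (12, 13); (12, 16); (13, 14); (13, 16);
    (14, 15); (14, 16); (15, 16)],
  [:: (0, 61); (14, 0); (59, 43); (27, 44); (18, 41); (14, 32); (22, 26); (30, 27); (33, 36); (25, 37);
    (22, 33); (24, 31); (27, 30); (29, 31); (28, 34); (25, 33); (26, 32)])%N.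

(** Both vertices are ports and have degree 3 once the parts are attached. *)
Definition K2 := ([:: (0, 1)], [:: (2, 1); (3, 1)])%N.
(* Two edges of the octahedron are subdivided, at vertices 6 and 7. *)
Definition octahedron_subdivided := ([:: (0, 1); (0, 2); (0, 3); (0, 4); (1, 4); (1, 5); (1, 6); (2, 3);
    (2, 5); (2, 6); (3, 5); (3, 7); (4, 5); (4, 7)],
  [:: (7, 1); (2, 7); (4, 3); (4, 2); (0, 0); (3, 3); (3, 4); (3, 1)])%N.
(** The ports are the ends of the missing edge: degree 4, hence 6 after gluing; all other vertices
    have degree 5. *)
Definition icosahedron_minus_edge := (rem (1, 2) icosahedron.1,
  [:: (7, 11); (4, 12); (7, 8); (8, 9); (8, 12); (5, 14); (0, 21); (3, 0); (10, 8); (12, 11); (9, 14);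
    (20, 12)])%N.

Lemma K3_check : graph_check 3 K3.1 K3.2. Proof. by vm_compute. Qed.
Lemma K4_check : graph_check 4 K4.1 K4.2. Proof. by vm_compute. Qed.
Lemma wheel4_check : graph_check 5 wheel4.1 wheel4.2. Proof. by vm_compute. Qed.
Lemma octahedron_check : graph_check 6 octahedron.1 octahedron.2. Proof. by vm_compute. Qed.
Lemma medial_prism_check : graph_check 9 medial_prism.1 medial_prism.2. Proof. by vm_compute. Qed.
Lemma icosahedron_check : graph_check 12 icosahedron.1 icosahedron.2. Proof. by vm_compute. Qed.
Lemma dual_C30_check : graph_check 17 dual_C30.1 dual_C30.2. Proof. by vm_compute. Qed.
Lemma K2_check : graph_check 2 K2.1 K2.2. Proof. by vm_compute. Qed.
Lemma octahedron_subdivided_check : graph_check 8 octahedron_subdivided.1 octahedron_subdivided.2.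
Proof. by vm_compute. Qed.
Lemma icosahedron_minus_edge_check : graph_check 12 icosahedron_minus_edge.1 icosahedron_minus_edge.2.
Proof. by vm_compute. Qed.

Lemma K2_room : room_check 2 K2.1 K2.2 0 1 (0, 0) (0, 2) (5, 0) (5, 2).
Proof. by vm_compute. Qed.
Lemma octahedron_subdivided_room :
  let G := octahedron_subdivided in
  room_check 8 G.1 G.2 6 7 (grid_point G.2 0) (grid_point G.2 1) (grid_point G.2 0) (grid_point G.2 3).
Proof. by vm_compute. Qed.
Lemma icosahedron_minus_edge_room :
  let G := icosahedron_minus_edge in
  room_check 12 G.1 G.2 1 2 (grid_point G.2 0) (grid_point G.2 2) (grid_point G.2 0) (grid_point G.2 3).
Proof. by vm_compute. Qed.

(** * Counting *)

Section Gluing.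
Variables (V1 V2 S : finType) (F : edges S) (x1 x2 : S).
Variables (E1 : edges V1) (e1 : {set V1}) (E2 : edges V2) (e2 : {set V2}).
Hypotheses (x12 : x1 != x2) (E1s : simple E1) (e1E : e1 \in E1).
Let G := gluing F x1 x2 E1 e1 E2 e2.
Let W := (V1 + V2 + S)%type.
Let inL (v : V1) : W := inl (inl v).
Let inR (v : V2) : W := inl (inr v).
Let inS (i : S) : W := inr i.

Lemma gluing_left_edge (f : {set V1}) : f != finset.set0 ->
  ([set inL v | v in f]%SET \in G) = (f \in E1) && (f != e1).
Proof.
move=> /set0Pn[v vf]; apply/glueP/andP.
  have vin : inL v \in [set inL v | v in f]%SET by apply: imset_f.
  case=> [[g /subdivideP[[f0 /setD1P[f0e f0E] ->]|[w _ ->]] E]|[g _ E]|[g _ E]].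
  - suff -> : f = f0 by [].
    apply: (@imset_inj _ _ inL); first by move=> a b [].
    by rewrite E -imset_comp.
  - have : inS x1 \in [set inL v | v in f]%SET.
      by rewrite E; apply/imsetP; exists None; rewrite // !inE eqxx.
    by case/imsetP.
  - by rewrite E in vin; case/imsetP: vin => -[].
  - by rewrite E in vin; case/imsetP: vin.
move=> [fE fe]; constructor 1; exists [set Some v | v in f]%SET; last by rewrite -imset_comp.
by apply/subdivideP; left; exists f; rewrite // in_setD1 fe.
Qed.

Lemma gluing_left_adj u v : adj G (inL u) (inL v) = (u != v) && ([set u; v]%SET \in (E1 :\ e1)%SET).
Proof.
have E : ([set inL u; inL v] = [set inL w | w in [set u; v]])%SET.
  by rewrite imsetU !imset_set1.
have n0 : [set u; v]%SET != finset.set0 by apply/set0Pn; exists u; rewrite !inE eqxx.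
by rewrite /adj /= inE /= E gluing_left_edge // in_setD1 [X in _ = _ && X]andbC.
Qed.

Lemma gluing_adj_cases w w' : adj G w w' ->
  [\/ exists a b, [/\ w = left_in x1 a, w' = left_in x1 b & [set a; b]%SET \in subdivide E1 e1],
     exists a b, w = right_in x2 a /\ w' = right_in x2 b | exists a b, w = inS a /\ w' = inS b].
Proof.
have wE : w \in [set w; w']%SET by rewrite !inE eqxx.
have wE' : w' \in [set w; w']%SET by rewrite !inE eqxx orbT.
move=> /adjP[_ /glueP[[g gE E]|[g _ E]|[g _ E]]]; rewrite E in wE wE';
  case/imsetP: wE => a ag wa; case/imsetP: wE' => b bg wb.
- constructor 1; exists a, b; split=> //; suff -> : [set a; b]%SET = g by [].
  by apply: (imset_inj (@left_in_inj V1 V2 _ x1)); rewrite -E imsetU !imset_set1 wa wb.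
- by constructor 2; exists a, b.
- by constructor 3; exists a, b.
Qed.

Lemma gluing_left_right u v : adj G (inL u) (inR v) = false.
Proof. by apply/negP=> /gluing_adj_cases[[a [[b|] []]]|[[a|] [b []]]|[a [b []]]]. Qed.

Lemma gluing_left_port u : adj G (inL u) (inS x1) = (u \in e1).
Proof.
apply/idP/idP => [/gluing_adj_cases[[[a|] [[b|] []]]|[[a|] [b []]]|[a [b []]]]|ue] //.
  move=> [<-] _ /subdivideP[[f0 _ E]|[v ve E]].
    have : None \in [set Some v | v in f0]%SET by rewrite -E !inE eqxx orbT.
    by case/imsetP.
  have : Some u \in [set Some v; None]%SET by rewrite -E !inE eqxx.
  by rewrite !inE orbF => /eqP[->].
apply/adjP; split=> //; apply/glueP; constructor 1; exists [set Some u; None]%SET.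
  by apply/subdivideP; right; exists u.
by rewrite imsetU !imset_set1.
Qed.

Lemma gluing_right_port u : adj G (inR u) (inS x1) = false.
Proof.
apply/negP=> /gluing_adj_cases[[[a|] [b []]]|[a [[b|] []]]|[a [b []]]] //.
by move=> _ [/eqP]; rewrite (negPf x12).
Qed.

(** Without [e1] the left part may fall apart, yet each component contains an end of [e1]: follow a
    path and restart at the far end whenever it uses [e1]. *)
Lemma gluing_left_reach v : connected_graph E1 -> exists2 u, u \in e1 &
  connect (fun a b => adj G (inL a) (inL b)) u v.
Proof.
move=> c1; have [x [y [xy exy]]] := simple_in E1s e1E.
have /connectP[p] := connected_graphP x v c1.
have : exists2 u, u \in e1 & connect (fun a b => adj G (inL a) (inL b)) u x.
  by exists x => //; rewrite exy !inE eqxx.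
elim: p x {xy exy} => [x H _ -> //|a p IH x [u ue ux] /= /andP[/adjP[xa xaE] pp] vl].
apply: (IH a _ pp vl); have [E|ne] := eqVneq [set x; a]%SET e1.
  by exists a => //; rewrite -E !inE eqxx orbT.
exists u => //; apply: connect_trans ux _; apply: connect1.
by rewrite gluing_left_adj xa in_setD1 ne.
Qed.

End Gluing.

(** The subdivided edge is read off as the set of left neighbours of the port; every other edge
    survives unchanged. *)
Lemma gluing_left_recover (V1 V2 S : finType) (F : edges S) (x1 x2 : S)
    (E1 E1' : edges V1) e1 e1' (E2 E2' : edges V2) e2 e2' :
  simple E1 -> simple E1' -> e1 \in E1 -> e1' \in E1' ->
  gluing F x1 x2 E1 e1 E2 e2 = gluing F x1 x2 E1' e1' E2' e2' -> E1 \subset E1'.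
Proof.
move=> s1 s1' eE eE' E; apply/fintype.subsetP => f fE.
have [x [y [xy fxy]]] := simple_in s1 fE.
have n0 : f != finset.set0 by apply/set0Pn; exists x; rewrite fxy !inE eqxx.
have ee : e1 = e1'.
  apply/setP=> u; by rewrite -(gluing_left_port F x1 x2 E1 e1 E2 e2) E gluing_left_port.
have [->|ne] := eqVneq f e1; first by rewrite ee.
have := gluing_left_edge F x1 x2 E1 e1 E2 e2 n0; rewrite fE ne E gluing_left_edge // => /esym.
by move=> /esym/andP[].
Qed.
Definition swap_parts (V1 V2 S : finType) (w : V1 + V2 + S) : V2 + V1 + S := match w with
  | inl (inl v) => inl (inr v) | inl (inr v) => inl (inl v) | inr i => inr i end.

Lemma push_comp (V W U : finType) (j : V -> W) (i : W -> U) (h : V -> U) (E : edges V) :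
  (forall v, i (j v) = h v) -> push i (push j E) = push h E.
Proof.
move=> ijh; rewrite /push -imset_comp; apply: eq_imset => f /=; rewrite -imset_comp.
by apply: eq_imset => v /=.
Qed.

Lemma gluing_swap (V1 V2 S : finType) (F : edges S) (x1 x2 : S) (E1 : edges V1) e1
    (E2 : edges V2) e2 :
  push (@swap_parts V1 V2 S) (gluing F x1 x2 E1 e1 E2 e2) = gluing F x2 x1 E2 e2 E1 e1.
Proof.
rewrite /gluing [LHS]/push !imsetU -!/(push _ _) (@push_comp _ _ _ _ _ (right_in x1)); last by case.
rewrite (@push_comp _ _ _ _ _ (left_in x2)); last by case.
rewrite (@push_comp _ _ _ _ _ inr) //.
by congr (_ :|: _)%SET; rewrite finset.setUC.
Qed.

Lemma gluing_right_recover (V1 V2 S : finType) (F : edges S) (x1 x2 : S) (E1 E1' : edges V1) e1 e1'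
    (E2 E2' : edges V2) e2 e2' :
  simple E2 -> simple E2' -> e2 \in E2 -> e2' \in E2' ->
  gluing F x1 x2 E1 e1 E2 e2 = gluing F x1 x2 E1' e1' E2' e2' -> E2 \subset E2'.
Proof.
move=> s2 s2' eE eE' /(congr1 (push (@swap_parts V1 V2 S))); rewrite !gluing_swap.
exact: gluing_left_recover.
Qed.

(** * Supermultiplicativity of the connected counts *)

Section SuperMultiplicative.
Variables (R : realType) (d D : nat).

Definition class (V : finType) : {set {set {set V}}} := [set E | good R d D E]%SET.

Definition connected_class (V : finType) : {set {set {set V}}} :=
  [set E in class V | connected_graph E]%SET.

Definition graph_count n := #|class 'I_n|.

Definition connected_count n := #|connected_class 'I_n|.

Variables (s : nat) (F : edges 'I_s) (x1 x2 : 'I_s).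
Hypotheses (Fs : simple F) (Fc : connected_graph F) (x12 : x1 != x2) (room : gadget_room R F x1 x2).
Hypothesis Fdeg : forall v, (d <= (v == x1) * 2 + (v == x2) * 2 + deg F v <= D)%N.

(** A fixed choice, so that gluing is a function of the two graphs; the default does not occur for
    connected graphs with at least two vertices. *)
Definition some_edge (V : finType) (E : edges V) := odflt finset.set0 [pick e in E].

Lemma connected_class_edge n E : (1 < n)%N -> E \in connected_class 'I_n ->
  [/\ simple E, some_edge E \in E, good R d D E & connected_graph E].
Proof.
rewrite -[n in (1 < n)%N]card_ord !inE => n1 /andP[g Ec]; split=> //; first by case/andP: g.
move: n1 => /card_gt1P[x [y [_ _ xy]]]; rewrite /some_edge; case: pickP => [e //|E0].
have /connectP[[|a p] /= pp yl] := connected_graphP x y Ec; first by rewrite yl eqxx in xy.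
by move: pp => /andP[/adjP[_]]; have := E0 [set x; a]%SET; rewrite /= => ->.
Qed.

Variable k : nat.
Implicit Types M : {set 'I_k}.

(** [M] and its complement receive the parts in the order of enumeration. The gadget always takes
    the last [s] labels, so only [M] has to be decoded. *)
Definition place M (w : 'I_#|M| + 'I_#|~: M|%SET + 'I_s) : 'I_(k + s) := match w with
  | inl (inl i) => lshift s (enum_val i)
  | inl (inr i) => lshift s (enum_val i)
  | inr i => rshift k i end.

Lemma place_bij M : bijective (@place M).
Proof.
apply: inj_card_bij; last first.
  by rewrite !card_sum !card_ord cardsC card_ord.
move=> [[i|i]|i] [[j|j]|j] /= /eqP; rewrite eq_shift // => /eqP h.
- by rewrite (enum_val_inj h).
- by have := enum_valP j; rewrite finset.in_setC -h => /negP[]; exact: enum_valP.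
- by have := enum_valP i; rewrite finset.in_setC h => /negP[]; exact: enum_valP.
- by rewrite (enum_val_inj h).
- by rewrite h.
Qed.

Definition assemble M (E1 : edges 'I_#|M|) (E2 : edges 'I_#|~: M|%SET) :
    edges 'I_(k + s) :=
  push (@place M) (gluing F x1 x2 E1 (some_edge E1) E2 (some_edge E2)).

(** [M] is what can be reached within the first [k] labels from the neighbours of the port [x1]: the
    right part is attached to [x2] only and has no edge to the left one. *)
Definition decode (E : edges 'I_(k + s)) : {set 'I_k} :=
  [set v | [exists u, adj E (lshift s u) (rshift k x1) &&
                      connect (fun a b => adj E (lshift s a) (lshift s b)) u v]]%SET.

Lemma assemble_good M E1 E2 : (1 < #|M|)%N -> (1 < #|~: M|%SET)%N ->
  E1 \in connected_class 'I_#|M| -> E2 \in connected_class 'I_#|~: M|%SET ->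
  @assemble M E1 E2 \in connected_class 'I_(k + s).
Proof.
move=> M1 M2 /(connected_class_edge M1)[s1 e1 g1 c1] /(connected_class_edge M2)[s2 e2 g2 c2].
rewrite !inE; apply/andP; split; first by apply: push_bij_good (place_bij M) _; apply: glue_good.
by apply: push_bij_connected (place_bij M) _; apply: glue_connected.
Qed.

Lemma assemble_decode M E1 E2 : (1 < #|M|)%N ->
  E1 \in connected_class 'I_#|M| -> decode (@assemble M E1 E2) = M.
Proof.
move=> M1 /(connected_class_edge M1)[s1 e1 g1 c1].
have pi := bij_inj (place_bij M).
set G := gluing F x1 x2 E1 (some_edge E1) E2 (some_edge E2).
have inM v : v \in M -> exists i : 'I_#|M|, lshift s v = place (inl (inl i)).
  by move=> vM; exists (enum_rank_in vM v); rewrite /= enum_rankK_in.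
have inMC v : v \notin M -> exists i : 'I_#|~: M|%SET, lshift s v = place (inl (inr i)).
  move=> vM; have vC : v \in (~: M)%SET by rewrite inE.
  by exists (enum_rank_in vC v); rewrite /= enum_rankK_in.
have port : rshift k x1 = @place M (inr x1) by [].
apply/setP=> v; rewrite inE; apply/existsP/idP.
  move=> [u /andP[ux1]].
  have uM : u \in M.
    apply: contraTT ux1 => /inMC[i ->]; rewrite port /assemble push_adj //.
    by rewrite gluing_right_port.
  move=> /connectP[p]; elim: p u {ux1} uM => [u uM _ -> //|a p IH u uM /= /andP[ua pp] vl].
  apply: (IH a _ pp vl); apply: contraTT ua => /inMC[i ->]; have [j ->] := inM u uM.
  by rewrite /assemble push_adj // gluing_left_right.
move=> vM; have [j vj] := inM v vM.
have [u ue /connectP[p pp pl]] := gluing_left_reach F x1 x2 E2 (some_edge E2) s1 e1 j c1.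
have enum_place (i : 'I_#|M|) : lshift s (enum_val i) = place (inl (inl i)) by [].
exists (enum_val u); rewrite enum_place port /assemble push_adj // gluing_left_port ue /=.
have -> : v = enum_val j by apply: (@lshift_inj _ s); rewrite vj.
apply/connectP; exists (map enum_val p); last by rewrite pl last_map.
rewrite path_map; apply: sub_path pp => a b ab /=.
by rewrite !enum_place push_adj.
Qed.

Lemma assemble_inj M : (1 < #|M|)%N -> (1 < #|~: M|%SET)%N ->
  {in [set u | (u.1 \in connected_class 'I_#|M|) && (u.2 \in connected_class 'I_#|~: M|%SET)]%SET &,
    injective (fun u => @assemble M u.1 u.2)}.
Proof.
move=> M1 M2 [E1 E2] [E1' E2']; rewrite ![(_, _) \in _]inE /=.
move=> /andP[/(connected_class_edge M1)[s1 e1 _ _] /(connected_class_edge M2)[s2 e2 _ _]].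
move=> /andP[/(connected_class_edge M1)[s1' e1' _ _] /(connected_class_edge M2)[s2' e2' _ _]].
move=> /(push_inj (bij_inj (place_bij M))) E.
congr pair; apply/eqP; rewrite finset.eqEsubset; apply/andP; split.
- exact: gluing_left_recover E.
- exact: gluing_left_recover (esym E).
- exact: gluing_right_recover E.
- exact: gluing_right_recover (esym E).
Qed.

(** Sort the graphs on k + s labels by [decode]; a set of size m accounts for at least as many
    graphs as there are pairs of parts. Parts have two vertices or more, so that each has an edge to
    subdivide. *)
Lemma connected_count_super m : (1 < m)%N -> (1 < k - m)%N ->
  ('C(k, m) * (connected_count m * connected_count (k - m)) <= connected_count (k + s))%N.
Proof.
move=> m1 km1; rewrite [X in (_ <= X)%N]/connected_count -sum1_card.
rewrite (partition_big decode xpredT) //=.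
rewrite (bigID (fun M : {set 'I_k} => #|M| == m)) /= -[X in (X <= _)%N]addn0 leq_add //.
have -> : 'C(k, m) = #|[set M : {set 'I_k} | #|M| == m]%SET| by rewrite card_draws card_ord.
rewrite -sum_nat_const /= big_set /=; apply: leq_sum => M /eqP Mm.
rewrite sum1dep_card.
have Mm' : #|~: M|%SET = (k - m)%N by rewrite cardsCs finset.setCK card_ord Mm.
have M1 : (1 < #|M|)%N by rewrite Mm.
have M2 : (1 < #|~: M|%SET)%N by rewrite Mm'.
have -> : (connected_count m * connected_count (k - m))%N =
    #|[set u | (u.1 \in connected_class 'I_#|M|) && (u.2 \in connected_class 'I_#|~: M|%SET)]%SET|.
  by rewrite -Mm' -[in LHS]Mm /connected_count -cardsX; apply: eq_card => u; rewrite !inE.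
rewrite -(card_in_imset (@assemble_inj M M1 M2)) subset_leq_card //.
apply/fintype.subsetP=> _ /imsetP[u + ->]; rewrite inE => /andP[u1 u2].
by rewrite inE /= assemble_good //= assemble_decode.
Qed.
End SuperMultiplicative.

(** * Cutting out the component of a vertex *)

Section Components.
Variables (R : realType) (d D : nat).

Definition pull (V W : finType) (j : W -> V) (E : edges V) : edges W :=
  [set f : {set W} | [set j w | w in f]%SET \in E]%SET.

Lemma drawn_pull (V W : finType) (j : W -> V) (E : edges V) (p : V -> R * R) c : injective j ->
  drawn E p c -> drawn (pull j E) (p \o j) (fun f => c [set j w | w in f]%SET).
Proof.
move=> ji [pi cc ends iv ii]; split.
- exact: inj_comp.
- by move=> f; rewrite inE => /cc.
- move=> f; rewrite inE => /ends ->; apply/seteqP; split=> z /=.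
    by move=> [v /imsetP[w wf ->] <-]; exists w.
  by move=> [w wf <-]; exists (j w) => //; apply: imset_f.
- by move=> f w t; rewrite inE => fE t01; apply: iv.
- move=> f f' s t; rewrite !inE => fE fE' ne; apply: ii => //.
  by apply: contra ne => /eqP /(imset_inj ji) ->.
Qed.

Definition edge_closed (V : finType) (E : edges V) (A : {set V}) :=
  forall x y, adj E x y -> (x \in A) = (y \in A).

Lemma edge_closed_sub (V W : finType) (j : W -> V) (E : edges V) (A : {set V}) e v : simple E ->
  injective j -> (forall v, v \in A -> exists w, v = j w) -> edge_closed E A ->
  e \in E -> v \in e -> v \in A -> exists f : {set W}, e = [set j w | w in f]%SET.
Proof.
move=> Es ji jA cA eE ve vA; have [x [y [xy exy]]] := simple_in Es eE.
have axy : adj E x y by apply/adjP; rewrite -exy.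
have xyA := cA x y axy.
have [xA yA] : x \in A /\ y \in A.
  by move: ve; rewrite exy !inE => /orP[] /eqP E'; move: vA; rewrite E'; move: xyA => -> // h; rewrite h.
have [a xa] := jA x xA; have [b yb] := jA y yA.
by exists [set a; b]%SET; rewrite exy imsetU !imset_set1 xa yb.
Qed.

Lemma good_pull (V W : finType) (j : W -> V) (E : edges V) (A : {set V}) : injective j ->
  (forall v, v \in A -> exists w, v = j w) -> (forall w, j w \in A) -> edge_closed E A ->
  good R d D E -> good R d D (pull j E).
Proof.
move=> ji jA Aj cA /and3P[Es /forallP Ed /asboolP[p [c dr]]]; apply/and3P; split.
- by apply/forall_inP=> f; rewrite inE => fE; rewrite -(card_imset _ ji); apply: (forall_inP Es).
- apply/forallP=> w; suff -> : deg (pull j E) w = deg E (j w) by [].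
  rewrite /deg -(card_imset _ (imset_inj ji)); apply: eq_card => e; rewrite [RHS]inE.
  apply/imsetP/andP => [[f]|[eE je]].
    by rewrite inE => /andP[]; rewrite inE => fE wf ->; split=> //; apply: imset_f.
  have [f ef] := edge_closed_sub Es ji jA cA eE je (Aj w).
  by exists f => //; rewrite inE inE -ef eE; move: je; rewrite ef mem_imset.
- by apply/asboolP; exists (p \o j); eexists; apply: drawn_pull dr.
Qed.

Definition component (V : finType) (E : edges V) v : {set V} := [set w | connect (adj E) v w]%SET.

Lemma component_closed (V : finType) (E : edges V) v : edge_closed E (component E v).
Proof.
move=> x y xy; rewrite !inE; apply/idP/idP => h; apply: connect_trans h (connect1 _) => //.
by rewrite adj_sym.
Qed.

Lemma edge_closedC (V : finType) (E : edges V) A : edge_closed E A -> edge_closed E (~: A)%SET.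
Proof. by move=> H x y /H; rewrite !inE => ->. Qed.

Lemma pull_adj (V W : finType) (j : W -> V) (E : edges V) x y : injective j ->
  adj (pull j E) x y = adj E (j x) (j y).
Proof.
move=> ji; apply/adjP/adjP; rewrite inE imsetU !imset_set1 (inj_eq ji); exact.
Qed.

Lemma component_connected (V W : finType) (j : W -> V) (E : edges V) v : injective j ->
  (forall x, x \in component E v -> exists w, x = j w) -> (forall w, j w \in component E v) ->
  connected_graph (pull j E).
Proof.
move=> ji jA Aj; have vA : v \in component E v by rewrite inE.
have [r vr] := jA v vA; apply: (@connected_rootP _ _ r) => w; rewrite connect_adj_sym.
have : connect (adj E) (j r) (j w) by have := Aj w; rewrite inE vr.
move=> /connectP[p]; elim: p r {vr} => [|a p IH] r /=; first by move=> _ /ji ->.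
move=> /andP[ra pp] wl; have [b ab] : exists b, a = j b.
  by apply: jA; rewrite -(component_closed v ra).
rewrite ab in ra pp wl; apply: (connect_trans (y := b)); last exact: IH.
by apply: connect1; rewrite pull_adj.
Qed.

(** Count pairs of a graph and a vertex by the component [K] of the vertex. A graph with component
    [K] occurs once per vertex of [K], and it is determined by its restrictions to [K] and to the
    complement, as no edge joins the two. *)
Lemma graph_count_components n :
  (n * graph_count R d D n <= \sum_(K : {set 'I_n}) #|K| *
     (connected_count R d D #|K| * graph_count R d D #|~: K|%SET))%N.
Proof.
rewrite /graph_count -{1}(card_ord n) mulnC -sum_nat_const.
rewrite (eq_bigr (fun E : edges 'I_n => \sum_(v : 'I_n) 1)%N); last by move=> E _; rewrite sum1_card.
rewrite (eq_bigr (fun E : edges 'I_n => \sum_(K : {set 'I_n}) \sum_(v | component E v == K) 1)%N); last first.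
  by move=> E _; rewrite (partition_big (component E) xpredT).
rewrite exchange_big /=; apply: leq_sum => K _.
pose X := [set E in class R d D 'I_n | [exists v, component E v == K]]%SET.
apply: (@leq_trans (\sum_(E in X) #|K|)).
  rewrite [leqRHS]big_mkcond /= [leqLHS]big_mkcond /=; apply: leq_sum => E _.
  case: ifP => // EC; rewrite sum1dep_card.
  case: (boolP (E \in X)) => EX.
    apply: subset_leq_card; apply/fintype.subsetP=> v; rewrite inE => /eqP <-.
    by rewrite inE connect0.
  rewrite leqn0 cards_eq0; apply/eqP/setP=> v; rewrite !inE; apply: contraNF EX => h.
  by rewrite inE EC; apply/existsP; exists v.
rewrite sum_nat_const mulnC leq_mul2l; apply/orP; right.
pose jK := @enum_val _ (mem K); pose jC := @enum_val _ (mem (~: K)%SET).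
have jKi : injective jK by exact: enum_val_inj.
have jCi : injective jC by exact: enum_val_inj.
have jKs v : v \in K -> exists w, v = jK w.
  by move=> vK; exists (enum_rank_in vK v); rewrite /jK enum_rankK_in.
have jCs v : v \in (~: K)%SET -> exists w, v = jC w.
  by move=> vK; exists (enum_rank_in vK v); rewrite /jC enum_rankK_in.
have inj : {in X &, injective (fun E => (pull jK E, pull jC E))}.
  have sub (E E' : edges 'I_n) : E \in X -> pull jK E = pull jK E' -> pull jC E = pull jC E' -> E \subset E'.
    rewrite !inE => /andP[/and3P[Es _ _] /existsP[v /eqP vK]] eK eC.
    have cK : edge_closed E K by rewrite -vK; apply: component_closed.
    apply/fintype.subsetP => e eE; have [x [y [xy exy]]] := simple_in Es eE.
    have xe : x \in e by rewrite exy !inE eqxx.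
    case: (boolP (x \in K)) => xK.
      have [f ef] := edge_closed_sub Es jKi jKs cK eE xe xK.
      have : f \in pull jK E by rewrite inE -ef.
      by rewrite eK inE -ef.
    have xC : x \in (~: K)%SET by rewrite inE.
    have [f ef] := edge_closed_sub Es jCi jCs (edge_closedC cK) eE xe xC.
    have : f \in pull jC E by rewrite inE -ef.
    by rewrite eC inE -ef.
  move=> E E' EX E'X [eK eC]; apply/eqP; rewrite finset.eqEsubset.
  by apply/andP; split; [apply: sub|apply: sub].
rewrite -(card_in_imset inj) /connected_count -cardsX subset_leq_card //.
apply/fintype.subsetP=> _ /imsetP[E + ->]; rewrite !inE /= => /andP[gE /existsP[v /eqP vK]].
have cK : edge_closed E K by rewrite -vK; apply: component_closed.
have jKin w : jK w \in K by exact: enum_valP.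
have jCin w : jC w \in (~: K)%SET by exact: enum_valP.
rewrite (good_pull jKi jKs jKin cK gE) (good_pull jCi jCs jCin (edge_closedC cK) gE) andbT /=.
by apply: (@component_connected _ _ jK E v) => //; rewrite vK.
Qed.

End Components.

Lemma graph_count_bound (R : realType) : exists2 C, (0 < C)%N &
  forall d D n, (graph_count R d D n <= C ^ n * n`!)%N.
Proof.
have [C C0 H] := count_Kfree 5; exists C => // d D n.
have := H 'I_n [set: 'I_n]%SET; rewrite cardsT card_ord; apply: leq_trans.
have inj : {in class R d D 'I_n &, injective (@arcs_of 'I_n)}.
  move=> E E'; rewrite !inE => /andP[Es _] /andP[Es' _] EE'.
  have sub (E1 E2 : edges 'I_n) : simple E1 -> arcs_of E1 = arcs_of E2 -> E1 \subset E2.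
    move=> s1 e12; apply/fintype.subsetP=> e eE; have [x [y [xy exy]]] := simple_in s1 eE.
    have : (x, y) \in arcs_of E1 by apply/arcs_ofP; rewrite -exy.
    by rewrite e12 exy => /arcs_ofP[].
  by apply/eqP; rewrite finset.eqEsubset !sub.
rewrite /graph_count -(card_in_imset inj) subset_leq_card //.
apply/fintype.subsetP=> _ /imsetP[E + ->]; rewrite !inE => /and3P[_ _ /asboolP[p [c dr]]].
exact: drawn_Kfree dr.
Qed.

(** * Growth rates *)

Section Growth.
Variable R : realType.

Lemma bernoulli (x : R) n : 0 <= x -> 1 + n%:R * x <= (1 + x) ^+ n.
Proof.
move=> x0; elim: n => [|n IH]; first by rewrite mul0r addr0 expr0.
rewrite exprS; apply: le_trans (ler_wpM2l _ IH); last by rewrite addr_ge0.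
rewrite -natr1; have : 0 <= n%:R * x ^+ 2 by rewrite mulr_ge0 // ?sqr_ge0.
nra.
Qed.

(** Write b = c^2. One factor c^n absorbs n^s and the constant by induction, the other absorbs (c -
    1) n by Bernoulli's inequality. *)
Lemma poly_le_exp (b K : R) s : 1 < b -> exists N, forall n, (N <= n)%N -> K * n%:R ^+ s <= b ^+ n.
Proof.
elim: s b K => [|s IH] b K b1.
  have [N KN] : exists N, K <= N%:R * (b - 1).
    exists (Num.bound `|K / (b - 1)|); have b10 : 0 < b - 1 by lra.
    rewrite -ler_pdivrMr //; apply: ltW; apply: le_lt_trans (ler_norm _) _.
    by apply: archi_boundP.
  exists N => n Nn; rewrite expr0 mulr1; have := @bernoulli (b - 1) n.
  rewrite subrKC => /(_ _); have b10 : 0 <= b - 1 by lra.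
  move=> /(_ b10); apply: le_trans; apply: le_trans KN _.
  by apply: ler_wpDl => //; rewrite ler_wpM2r // ler_nat.
pose c := Num.sqrt b.
have b0 : 0 <= b by lra.
have cE : c ^+ 2 = b by rewrite sqr_sqrtr.
have c1 : 1 < c by rewrite -(sqrtr1 R) ltr_sqrt //; lra.
have x0 : 0 < c - 1 by lra.
have [N H] := IH c (`|K| / (c - 1)) c1.
exists N => n Nn; apply: (@le_trans _ _ (`|K| / (c - 1) * n%:R ^+ s * c ^+ n)); last first.
  by rewrite -cE -exprM mul2n -addnn exprD ler_wpM2r ?H // exprn_ge0 //; lra.
apply: (@le_trans _ _ (`|K| * n%:R ^+ s.+1)).
  by rewrite ler_wpM2r ?exprn_ge0 // ler_norm.
rewrite -!mulrA ler_wpM2l // mulrCA exprSr ler_wpM2l ?exprn_ge0 // ler_pdivlMl // mulrC.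
have := @bernoulli (c - 1) n (ltW x0); rewrite subrKC; apply: le_trans.
by rewrite lerDr.
Qed.

(** Halving the number of blocks keeps the accumulated loss exponential in q; adding blocks one by
    one would cost a power of a factorial. The factor (q+1)^s on the left carries the induction, and
    5 is the least integer constant in (q1 + q2)^2 <= 5 q1 q2 for 1 <= q1 <= q2 <= q1 + 1, as q1 =
    1, q2 = 2 shows. *)
Lemma blocks_growth (w : nat -> R) s M : (forall n, 0 <= w n) -> (s.+1 < M)%N ->
  (forall m n, (s.+1 < m)%N -> (s.+1 < n)%N -> w m * w n <= w (m + n)%N * (m + n)%:R ^+ s) ->
  forall q, w M ^+ q.+1 * q.+1%:R ^+ s <= w (q.+1 * M)%N * (5 * M)%:R ^+ (q * s).
Proof.
move=> w0 sM H; elim/ltn_ind => -[|q] IH.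
  by rewrite expr1 expr1n mulr1 mul1n mul0n expr0 mulr1.
pose q1 := (q.+2)./2; pose q2 := uphalf q.+2.
have q12 : (q1 + q2 = q.+2)%N by rewrite /q1 /q2 uphalf_half; have := odd_double_half q.+2; lia.
have q1q2 : (q1 <= q2 <= q1.+1)%N by rewrite /q1 /q2 uphalf_half; case: (odd _); rewrite /=; lia.
have q1_0 : (0 < q1)%N by lia.
have h1 := IH q1.-1 ltac:(lia); have h2 := IH q2.-1 ltac:(lia).
rewrite !prednK in h1 h2; try lia.
have big q' : (0 < q')%N -> (s.+1 < q' * M)%N by move=> q'0; apply: leq_trans sM _; rewrite leq_pmull.
have h3 := H (q1 * M)%N (q2 * M)%N (big _ q1_0) (big q2 ltac:(lia)).
rewrite -mulnDl q12 in h3.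
have M0 : (0 < M)%N by lia.
have q0 : (0 : R) < q.+2%:R ^+ s by rewrite exprn_gt0 // ltr0n.
rewrite -(ler_pM2r q0).
have A1 := ler_pM (mulr_ge0 (exprn_ge0 _ (w0 _)) (exprn_ge0 _ (ler0n _ _)))
                  (mulr_ge0 (exprn_ge0 _ (w0 _)) (exprn_ge0 _ (ler0n _ _))) h1 h2.
have Kpos k : 0 <= (5 * M)%:R ^+ k :> R by rewrite exprn_ge0.
have A2 := ler_wpM2r (mulr_ge0 (Kpos (q1.-1 * s)%N) (Kpos (q2.-1 * s)%N)) h3.
have A3 : w M ^+ q.+2 * (q1 * q2)%:R ^+ s <= w (q.+2 * M)%N * (q.+2 * M)%:R ^+ s * (5 * M)%:R ^+ (q * s).
  apply: le_trans (_ : _ <= w M ^+ q1 * q1%:R ^+ s * (w M ^+ q2 * q2%:R ^+ s)) _.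
    by rewrite -q12 exprD natrM exprMn; lra.
  apply: le_trans A1 _; apply: le_trans (_ : _ <= w (q1 * M)%N * w (q2 * M)%N *
    ((5 * M)%:R ^+ (q1.-1 * s) * (5 * M)%:R ^+ (q2.-1 * s))) _; first by lra.
  apply: le_trans A2 _; rewrite -exprD -mulnDl (_ : (q1.-1 + q2.-1 = q)%N) //; lia.
have A4 : q.+2%:R ^+ s * q.+2%:R ^+ s <= 5%:R ^+ s * (q1 * q2)%:R ^+ s :> R.
  rewrite -!exprMn lerXn2r ?nnegrE ?mulr_ge0 // -!natrM ler_nat -q12.
  have [->|->] : q2 = q1 \/ q2 = q1.+1 by lia.
    by nia.
  by nia.
apply: le_trans (_ : _ <= w M ^+ q.+2 * (5%:R ^+ s * (q1 * q2)%:R ^+ s)) _.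
  by rewrite -mulrA ler_wpM2l // exprn_ge0.
rewrite mulrCA; apply: le_trans (ler_wpM2l (exprn_ge0 _ (ler0n _ _)) A3) _.
rewrite [(q.+1 * s)%N]mulSn exprD !natrM !exprMn le_eqVlt; apply/orP; left; apply/eqP; ring.
Qed.

Variables (u a : nat -> nat -> R) (s : nat) (C : R).
Hypotheses (C1 : 1 <= C) (u0 : forall i n, 0 <= u i n) (ua : forall i n, u i n <= a i n)
  (aC : forall i n, a i n <= C ^+ n) (umono : forall i j n, (i <= j)%N -> u i n <= u j n)
  (usup : forall i m n, (1 < m)%N -> (1 < n)%N ->
     u i m * u i n <= u i (m + n + s)%N * (m + n + s)%:R ^+ s)
  (upos : exists n0, forall n, (n0 <= n)%N -> 0 < u 0 n)
  (acomp : forall i n, n%:R * a i n <= \sum_(1 <= k < n.+1) k%:R * u i k * a i (n - k)%N).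

(** M = m + s is a block length and (5M)^s the loss per block in [blocks_growth], so every positive
    value below an attained one is a lower bound for the growth ([attained_lower]). *)
Definition attained (rho : R) := exists i m,
  (1 < m)%N /\ rho ^+ (m + s) * (5 * (m + s))%:R ^+ s <= u i m.

Lemma finite_pos_lower (f : nat -> R) T K : (forall r, (T <= r)%N -> 0 < f r) ->
  exists2 mu, 0 < mu & forall r, (T <= r < T + K)%N -> mu <= f r.
Proof.
move=> fpos; elim: K => [|K [mu mu0 IH]].
  by exists 1 => // r; rewrite addn0 => /andP[h1]; rewrite ltnNge h1.
exists (Num.min mu (f (T + K)%N)); first by rewrite lt_min mu0 fpos // leq_addr.
move=> r /andP[Tr]; rewrite addnS ltnS leq_eqVlt => /orP[/eqP ->|rK]; first by rewrite ge_min lexx orbT.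
by apply: le_trans (IH r _); rewrite ?ge_min ?lexx // Tr.
Qed.

Lemma block_decomposition (n T s' M : nat) : (0 < M)%N -> (s' < T)%N -> (T + M + s' <= n)%N ->
  exists q r, [/\ n + s' = q.+1 * M + r, T <= r < T + M, n = q.+1 * M + (r - s'),
    r - s' <= T + M & n <= q.+1 * M + (T + M)]%N.
Proof.
move=> M0 sT hn; have [q qE] : exists q, ((n + s' - T) %/ M = q.+1)%N.
  exists ((n + s' - T) %/ M).-1; rewrite prednK // divn_gt0 //; lia.
exists q, (T + (n + s' - T) %% M)%N.
have := divn_eq (n + s' - T) M; have := ltn_pmod (n + s' - T) M0; rewrite qE.
move: ((n + s' - T) %% M)%N (q.+1 * M)%N => r k rM E; split; lia.
Qed.

(** Full blocks give a power of [rho1], and the remainder, kept in a finite range where u is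
    positive, a constant [mu]. The gap between [rho] and [rho1] pays for this constant, for the
    polynomial factor and for the length of the remainder. *)
Lemma attained_lower rho rho1 : 0 < rho -> rho < rho1 -> attained rho1 ->
  exists i N, forall n, (N <= n)%N -> rho ^+ n <= u i n.
Proof.
move=> r0 rr1 [i [m [m1 hm]]]; have [n0 npos] := upos.
(* The shift by s makes [usup] a relation between w at two arguments and w at their plain sum. *)
pose M := (m + s)%N; pose w n := u i (n - s)%N.
have r10 : 0 < rho1 by apply: lt_trans rr1.
have sM : (s.+1 < M)%N by rewrite /M; lia.
have wsup k l : (s.+1 < k)%N -> (s.+1 < l)%N -> w k * w l <= w (k + l)%N * (k + l)%:R ^+ s.
  move=> hk hl; have := usup i (_ : 1 < k - s)%N (_ : 1 < l - s)%N.
  rewrite (_ : (k - s + (l - s) + s)%N = (k + l - s)%N); last by lia.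
  move=> /(_ ltac:(lia) ltac:(lia)) h; apply: le_trans h _; rewrite /w ler_wpM2l // lerXn2r ?nnegrE ?ler_nat //; lia.
have M0 : (0 < M)%N by lia.
have p1 k : (0 : R) < (5 * M)%:R ^+ k by rewrite exprn_gt0 // ltr0n muln_gt0.
have wM : rho1 ^+ M * (5 * M)%:R ^+ s <= w M by rewrite /w /M addnK.
have wq q : rho1 ^+ (q.+1 * M) <= w (q.+1 * M)%N.
  have h := @blocks_growth w s M (fun n => u0 i _) sM wsup q.
  rewrite -(ler_pM2r (p1 (q * s)%N)); apply: le_trans h.
  have h2 : (rho1 ^+ M * (5 * M)%:R ^+ s) ^+ q.+1 <= w M ^+ q.+1.
    by rewrite lerXn2r ?nnegrE ?u0 // mulr_ge0 ?exprn_ge0 // ltW.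
  apply: le_trans (_ : _ <= w M ^+ q.+1) _; last first.
    by rewrite ler_peMr ?exprn_ge0 ?u0 // exprn_ege1 // ler1n.
  apply: le_trans h2; rewrite exprMn -!exprM [(M * _)%N]mulnC [(s * _)%N]mulnC ler_wpM2l ?exprn_ge0 ?(ltW r10) //.
  by rewrite ler_weXn2l // ?ler1n ?muln_gt0 // leq_mul.
pose T := (n0 + s + 2)%N.
have [mu mu0 hmu] : exists2 mu, 0 < mu & forall r, (T <= r < T + M)%N -> mu <= w r.
  apply: finite_pos_lower => r Tr; apply: lt_le_trans (umono _ (leq0n i)).
  by apply: npos; rewrite /T in Tr; lia.
pose b := rho1 / rho.
have b1 : 1 < b by rewrite ltr_pdivlMr // mul1r.
have b0 : 0 < b by lra.
pose A := (Num.max 1 rho) ^+ (T + M) * b ^+ (T + M) * 2%:R ^+ s / mu.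
have [N1 HN1] := poly_le_exp A s b1.
exists i, (N1 + (T + M + s))%N => n hn.
have sT : (s < T)%N by rewrite /T -addnA ltn_addl // addn2 ltnS ltnW.
have [|q [r [Nqr rT nqr rs nle]]] := @block_decomposition n T s M M0 sT.
  by apply: leq_trans hn; rewrite leq_addl.
have N1n : (N1 <= n)%N by apply: leq_trans hn; rewrite leq_addr.
have sn : (s <= n)%N by apply: leq_trans hn; rewrite addnA leq_addl.
have n_gt0 : (0 < n)%N by rewrite nqr addn_gt0 muln_gt0 M0.
pose N := (n + s)%N.
have sr : (s.+1 < r)%N.
  by move: rT => /andP[+ _]; apply: leq_trans; rewrite /T -addnA addn2 leq_addl.
have hN : rho1 ^+ (q.+1 * M) * mu <= u i n * N%:R ^+ s.
  have -> : u i n = w N by rewrite /w /N addnK.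
  rewrite /N Nqr; apply: le_trans (wsup _ _ _ sr); last by apply: leq_trans sM _; rewrite leq_pmull.
  apply: ler_pM; [by rewrite exprn_ge0 // ltW|exact: ltW|exact: wq|exact: hmu].
have Np : 0 < N%:R ^+ s :> R by rewrite exprn_gt0 // ltr0n addn_gt0 n_gt0.
rewrite -(ler_pM2r Np); apply: le_trans hN.
have e1 : rho ^+ n = rho ^+ (q.+1 * M) * rho ^+ (r - s) by rewrite -exprD -nqr.
have e2 : rho1 ^+ (q.+1 * M) = rho ^+ (q.+1 * M) * b ^+ (q.+1 * M).
  by rewrite -exprMn /b mulrCA mulfV ?mulr1 // gt_eqF.
rewrite e1 e2 -!mulrA ler_wpM2l ?exprn_ge0 ?(ltW r0) //.
have m1' : 1 <= Num.max 1 rho by rewrite le_max lexx.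
have h1 : rho ^+ (r - s) <= (Num.max 1 rho) ^+ (T + M).
  apply: le_trans (_ : _ <= (Num.max 1 rho) ^+ (r - s)) _.
    by rewrite lerXn2r ?nnegrE ?le_max ?lexx ?orbT ?(ltW r0) ?ler01.
  by rewrite ler_weXn2l.
have h2 : b ^+ n <= b ^+ (q.+1 * M) * b ^+ (T + M).
  by rewrite -exprD ler_weXn2l ?(ltW b1).
have h3 : N%:R ^+ s <= 2%:R ^+ s * n%:R ^+ s :> R.
  by rewrite -exprMn lerXn2r ?nnegrE ?mulr_ge0 // -natrM ler_nat mul2n -addnn leq_add2l.
have h4 := HN1 n N1n.
have bT : 0 < b ^+ (T + M) by rewrite exprn_gt0.
apply: le_trans (ler_pM _ _ h1 h3) _; rewrite ?exprn_ge0 ?(ltW r0) //.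
rewrite -(ler_pM2r bT); apply: le_trans (_ : _ <= b ^+ n * mu) _; last first.
  by rewrite mulrAC ler_pM2r.
apply: le_trans (_ : _ <= A * n%:R ^+ s * mu) _; last by rewrite ler_pM2r.
rewrite /A le_eqVlt; apply/orP; left; apply/eqP; field; lra.
Qed.

Definition growth_rate : R := sup [set rho | 0 <= rho /\ attained rho].

Lemma five_ge1 m : (1 < m)%N -> 1 <= (5 * (m + s))%:R ^+ s :> R.
Proof. by move=> m1; rewrite exprn_ege1 // ler1n muln_gt0 addn_gt0 (ltnW m1). Qed.

Lemma attained_le rho : 0 <= rho -> attained rho -> rho <= C.
Proof.
move=> r0 [i [m [m1 h]]].
have m_gt0 : (0 < m + s)%N by rewrite addn_gt0 (ltnW m1).
have C0 : 0 <= C by apply: le_trans C1.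
rewrite -(@ler_pXn2r _ (m + s)) ?nnegrE //.
apply: le_trans (_ : _ <= u i m) _.
  by apply: le_trans h; rewrite ler_peMr ?exprn_ge0 // five_ge1.
apply: le_trans (ua i m) _; apply: le_trans (aC i m) _.
by rewrite ler_weXn2l // leq_addr.
Qed.

Lemma attained_has_ubound : has_ubound [set rho | 0 <= rho /\ attained rho].
Proof. by exists C => rho [r0 /(attained_le r0)]. Qed.

Lemma attained_root i m : (1 < m)%N ->
  exists2 rho, 0 <= rho & attained rho /\ rho ^+ (m + s) * (5 * (m + s))%:R ^+ s = u i m.
Proof.
move=> m1; have m_gt0 : (0 < m + s)%N by rewrite addn_gt0 (ltnW m1).
pose x := u i m / (5 * (m + s))%:R ^+ s.
have P0 : (5 * (m + s))%:R ^+ s != 0 :> R by rewrite gt_eqF // (lt_le_trans ltr01) // five_ge1.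
have x0 : 0 <= x by rewrite divr_ge0 // exprn_ge0.
have rE : (x `^ (m + s)%:R^-1) ^+ (m + s) = x.
  rewrite -powR_mulrn ?powR_ge0 // -powRrM mulVf ?powRr1 //.
  by rewrite pnatr_eq0 -lt0n.
have e : (x `^ (m + s)%:R^-1) ^+ (m + s) * (5 * (m + s))%:R ^+ s = u i m by rewrite rE mulfVK.
exists (x `^ (m + s)%:R^-1); first exact: powR_ge0.
by split=> //; exists i, m; rewrite e.
Qed.

(** The supremum runs over all stages, so this bound is uniform in i, as [growth_upper] requires. *)
Lemma growth_rate_upper i m : (1 < m)%N -> u i m <= (5 * (m + s))%:R ^+ s * growth_rate ^+ (m + s).
Proof.
move=> m1; have [rho r0 [ra <-]] := attained_root i m1; rewrite mulrC ler_wpM2l ?exprn_ge0 //.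
have rg : rho <= growth_rate by apply: ub_le_sup => //; exact: attained_has_ubound.
by rewrite lerXn2r ?nnegrE // (le_trans r0).
Qed.

Lemma growth_rate_gt0 : 0 < growth_rate.
Proof.
have [n0 npos] := upos; pose m := (n0 + 2)%N.
have m1 : (1 < m)%N by rewrite /m addn2.
have [rho r0 [ra e]] := attained_root 0 m1.
have um : 0 < u 0 m by apply: npos; rewrite leq_addr.
apply: lt_le_trans (_ : rho <= _); last by apply: ub_le_sup => //; exact: attained_has_ubound.
rewrite lt_neqAle r0 andbT; apply/eqP=> E; move: um.
have ms : (0 < m + s)%N by rewrite addn_gt0 (ltnW m1).
by rewrite -e -E expr0n (gtn_eqF ms) mul0r ltxx.
Qed.

Lemma growth_rate_lower rho : 0 < rho -> rho < growth_rate ->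
  exists i N, forall n, (N <= n)%N -> rho ^+ n <= u i n.
Proof.
move=> r0 rg; have hS : has_sup [set rho | 0 <= rho /\ attained rho].
  split; last exact: attained_has_ubound.
  by have [r r00 [ra _]] := @attained_root 0 2 isT; exists r.
have [|r1 [r10 ra]] := @sup_adherent R _ (growth_rate - rho) _ hS; first by rewrite subr_gt0.
rewrite -/growth_rate subKr => rr1; exact: attained_lower rr1 ra.
Qed.

Lemma term_le_sum (f : nat -> R) n k : (forall j, 0 <= f j) -> (k < n)%N -> f k <= \sum_(j < n) f j.
Proof.
move=> f0 kn; rewrite (bigD1 (Ordinal kn)) //= lerDl; exact: sumr_ge0.
Qed.

(** For large k the gap between the growth rate and [tau] absorbs the polynomial. The finitely many
    small k are covered by the a priori bound C^k; the sum in [K] serves as a crude maximum. *)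
Lemma growth_rate_poly tau : growth_rate < tau ->
  exists2 K, 0 <= K & forall i k, (0 < k)%N -> k%:R * u i k <= K * tau ^+ k.
Proof.
move=> gt; have g0 := growth_rate_gt0; have t0 : 0 < tau by apply: lt_trans gt.
pose b := tau / growth_rate; have b1 : 1 < b by rewrite ltr_pdivlMr // mul1r.
pose A := (5 * s.+1)%:R ^+ s * growth_rate ^+ s.
have [N HN] := poly_le_exp A s.+1 b1.
pose f k := k%:R * C ^+ k / tau ^+ k.
have C0 : 0 <= C by apply: le_trans C1.
have f0 k : 0 <= f k by rewrite divr_ge0 ?mulr_ge0 ?exprn_ge0 // ltW.
exists (1 + \sum_(j < N.+2) f j); first by rewrite addr_ge0 // sumr_ge0.
move=> i k k0; have tk : 0 < tau ^+ k by rewrite exprn_gt0.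
have [kN|kN] := ltnP k N.+2.
  apply: le_trans (_ : _ <= f k * tau ^+ k) _.
    rewrite /f mulfVK ?gt_eqF // ler_wpM2l //; apply: le_trans (ua i k) (aC i k).
  by rewrite ler_wpM2r ?(ltW tk) // (le_trans (term_le_sum f0 kN)) // lerDr.
have k1 : (1 < k)%N by apply: leq_trans kN.
have Nk : (N <= k)%N by apply: leq_trans kN; rewrite -addn2 leq_addr.
apply: le_trans (_ : _ <= tau ^+ k) _; last first.
  by rewrite ler_peMl ?(ltW tk) // lerDl sumr_ge0.
apply: le_trans (ler_wpM2l (ler0n _ k) (growth_rate_upper i k1)) _.
have -> : tau ^+ k = b ^+ k * growth_rate ^+ k by rewrite -exprMn /b mulfVK // gt_eqF.
rewrite exprD [growth_rate ^+ k * _]mulrC !mulrA ler_wpM2r ?exprn_ge0 ?(ltW g0) //.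
apply: le_trans (HN k Nk); rewrite /A exprS.
have h : (5 * (k + s))%:R ^+ s <= (5 * s.+1)%:R ^+ s * k%:R ^+ s :> R.
  rewrite -exprMn lerXn2r ?nnegrE ?mulr_ge0 // -natrM ler_nat -mulnA leq_mul2l /= mulSn leq_add2l.
  by rewrite leq_pmulr.
have := ler_wpM2l (mulr_ge0 (ler0n R k) (exprn_ge0 s (ltW g0))) h; lra.
Qed.

Lemma geometric_sum_le (x : R) n : 0 <= x -> x < 1 -> \sum_(1 <= k < n.+1) x ^+ k <= (1 - x)^-1.
Proof.
move=> x0 x1; have h : 0 < 1 - x by rewrite subr_gt0.
rewrite -[leRHS]mul1r ler_pdivlMr // mulrC.
elim: n => [|n IH]; first by rewrite big_nil mulr0.
suff : (1 - x) * \sum_(1 <= k < n.+2) x ^+ k <= 1 - x ^+ n.+2.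
  by move/le_trans; apply; rewrite gerBl exprn_ge0.
elim: n {IH} => [|n IH]; first by rewrite big_nat1 expr1 expr2; nra.
rewrite big_nat_recr //= mulrDr; apply: le_trans (lerD IH (lexx _)) _.
by rewrite mulrBl mul1r -exprS addrA subrK.
Qed.

(** Induction gives a i n <= L s1^n: in the component inequality the sum turns into a geometric
    series in x = tau / s1, and its factor K / (1 - x) is cancelled by the n on the left once n >=
    [n2]. *)
Lemma growth_upper sigma : growth_rate < sigma ->
  exists N, forall i n, (N <= n)%N -> a i n <= sigma ^+ n.
Proof.
move=> gs; have g0 := growth_rate_gt0.
(* Two values one third and two thirds of the way to [sigma]: the first bounds u, the second bounds
   a up to the constant [L], and the last gap removes [L]. *)
pose tau := growth_rate + (sigma - growth_rate) / 3; pose s1 := growth_rate + 2 * (sigma - growth_rate) / 3.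
have gt : growth_rate < tau by rewrite /tau; lra.
have t0 : 0 < tau by apply: lt_trans gt.
have ts : tau < s1 by rewrite /tau /s1; lra.
have ss : s1 < sigma by rewrite /s1; lra.
have s10 : 0 < s1 by apply: lt_trans ts.
have [K K0 HK] := growth_rate_poly gt.
pose x := tau / s1.
have x0 : 0 <= x by rewrite divr_ge0 // ltW.
have x1 : x < 1 by rewrite ltr_pdivrMr // mul1r.
have C0 : 0 <= C by apply: le_trans C1.
pose n2 := (Num.bound (K / (1 - x))).+1.
have Kn2 : K / (1 - x) <= n2%:R.
  apply: ltW; apply: lt_le_trans (archi_boundP _) _; last by rewrite ler_nat.
  by rewrite divr_ge0 // subr_ge0 ltW.
pose f k := C ^+ k / s1 ^+ k.
have f0 k : 0 <= f k by rewrite divr_ge0 ?exprn_ge0 // ltW.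
pose L := 1 + \sum_(j < n2) f j.
have L0 : 0 <= L by rewrite addr_ge0 // sumr_ge0.
have main i n : a i n <= L * s1 ^+ n.
  elim/ltn_ind: n => n IH; have sn : 0 < s1 ^+ n by rewrite exprn_gt0.
  have [nn|nn] := ltnP n n2.
    apply: le_trans (aC i n) _; apply: le_trans (_ : _ <= f n * s1 ^+ n) _.
      by rewrite /f mulfVK // gt_eqF.
    by rewrite ler_wpM2r ?(ltW sn) // (le_trans (term_le_sum f0 nn)) // lerDr.
  have n_gt0 : (0 < n)%N by apply: leq_trans nn.
  rewrite -(ler_pM2l (_ : 0 < n%:R)) ?ltr0n //; apply: le_trans (acomp i n) _.
  apply: le_trans (_ : _ <= \sum_(1 <= k < n.+1) (K * L * s1 ^+ n) * x ^+ k) _.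
    apply: ler_sum_nat => k /andP[k0 kn].
    have nk : (n - k < n)%N by rewrite ltn_subrL k0.
    have hk := HK i k k0; have ha := IH (n - k)%N nk.
    have a0 : 0 <= a i (n - k)%N by apply: le_trans (ua i _); apply: u0.
    apply: le_trans (ler_pM _ a0 hk ha) _; first by rewrite mulr_ge0.
    have -> : s1 ^+ n = s1 ^+ k * s1 ^+ (n - k) by rewrite -exprD subnKC.
    rewrite /x expr_div_n le_eqVlt; apply/orP; left; apply/eqP; field.
    by rewrite gt_eqF // exprn_gt0.
  rewrite -big_distrr /=; apply: le_trans (_ : _ <= (K * L * s1 ^+ n) * (1 - x)^-1) _.
    by rewrite ler_wpM2l ?geometric_sum_le // !mulr_ge0 // ltW.
  have -> : K * L * s1 ^+ n / (1 - x) = K / (1 - x) * (L * s1 ^+ n) by ring.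
  rewrite ler_wpM2r ?mulr_ge0 ?(ltW sn) //; apply: le_trans Kn2 _; by rewrite ler_nat.
have b1 : 1 < sigma / s1 by rewrite ltr_pdivlMr // mul1r.
have [N HN] := poly_le_exp L 0 b1; exists N => i n Nn.
apply: le_trans (main i n) _; have := HN n Nn; rewrite expr0 mulr1 expr_div_n.
by rewrite ler_pdivlMr // exprn_gt0.
Qed.

Lemma large_index N1 N2 N0 i n : (N1 + N2 + (N0 + i) + 1 <= n)%N ->
  [/\ N1 <= n, N2 <= n, i <= n - N0 & 0 < n]%N.
Proof. by move=> h; split; lia. Qed.

(* The stage may depend on n: only its lower bound, through umono, and the uniformity in i of
   growth_upper matter. *)
Theorem growth_limit (N0 : nat) :
  (fun n => a (n - N0)%N n `^ n%:R^-1) @ \oo --> growth_rate.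
Proof.
have g0 := growth_rate_gt0.
have amono i j n : (i <= j)%N -> u i n <= a j n by move=> ij; apply: le_trans (ua j n); apply: umono.
apply/cvgrPdist_le => e e0.
have [N1 HN1] : exists N, forall i n, (N <= n)%N -> a i n <= (growth_rate + e) ^+ n.
  by apply: growth_upper; rewrite ltrDl.
pose rho := Num.max (growth_rate / 2) (growth_rate - e).
have r0 : 0 < rho by rewrite lt_max divr_gt0.
have rg : rho < growth_rate by rewrite gt_max; apply/andP; split; lra.
have [i [N2 HN2]] := growth_rate_lower r0 rg.
exists (N1 + N2 + (N0 + i) + 1)%N => // n /= hn.
have [h1 h2 h3 h4] := large_index hn.
have up := HN1 (n - N0)%N n h1.
have lo : rho ^+ n <= a (n - N0)%N n by apply: le_trans (HN2 n h2) (amono _ _ _ h3).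
have a0 : 0 <= a (n - N0)%N n by apply: le_trans lo; rewrite exprn_ge0 // ltW.
have root (y : R) : 0 <= y -> (y ^+ n) `^ n%:R^-1 = y.
  by move=> y0; rewrite -powR_mulrn // -powRrM mulfV ?powRr1 // pnatr_eq0 -lt0n.
have up' : a (n - N0)%N n `^ n%:R^-1 <= growth_rate + e.
  have ge0 : 0 <= growth_rate + e by rewrite ltW // addr_gt0.
  by rewrite -(root _ ge0); apply: ge0_ler_powR; rewrite ?nnegrE ?exprn_ge0.
have lo' : rho <= a (n - N0)%N n `^ n%:R^-1.
  by rewrite -(root _ (ltW r0)); apply: ge0_ler_powR; rewrite ?nnegrE ?exprn_ge0 // ltW.
have re : growth_rate - e <= rho by rewrite le_max lexx orbT.
rewrite ler_norml; apply/andP; split; lra.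
Qed.
End Growth.

(** * Application to planar graphs *)

Lemma good_mono (R : realType) d d' D D' (V : finType) (E : edges V) : (d' <= d)%N -> (D <= D')%N ->
  good R d D E -> good R d' D' E.
Proof.
move=> dd DD /and3P[Es /forallP H dr]; apply/and3P; split=> //; apply/forallP=> v.
by have /andP[h1 h2] := H v; rewrite (leq_trans dd) // (leq_trans h2).
Qed.

Lemma connected_count_mono (R : realType) d D D' n : (D <= D')%N ->
  (connected_count R d D n <= connected_count R d D' n)%N.
Proof.
move=> DD; apply: subset_leq_card; apply/fintype.subsetP=> E.
rewrite !inE => /andP[h ->]; rewrite andbT; exact: good_mono h.
Qed.

Lemma connected_count_le (R : realType) d D n : (connected_count R d D n <= graph_count R d D n)%N.
Proof. by apply: subset_leq_card; apply/fintype.subsetP=> E; rewrite !inE => /andP[]. Qed.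

Lemma connected_count_gt0 (R : realType) d d' D D' n L P : (d' <= d)%N -> (D <= D')%N ->
  graph_check n L P -> all (fun v => d <= degree_in L v <= D)%N (iota 0 n) ->
  (0 < connected_count R d' D' n)%N.
Proof.
move=> dd DD ck dg; apply/card_gt0P; exists (edge_set n L); rewrite !inE.
by rewrite (good_mono dd DD (edge_set_good R ck dg)) (edge_set_connected ck).
Qed.

(** Take c below ab with c = 0 modulo a and c = n modulo b; then n - c is a nonnegative multiple of
    b. *)
Lemma coprime_combination a b n : (0 < a)%N -> (0 < b)%N -> coprime a b -> (a * b <= n)%N ->
  exists x y, n = (x * a + y * b)%N.
Proof.
move=> a0 b0 co ab; exists ((chinese a b 0 n %% (a * b)) %/ a)%N.
set c := (chinese a b 0 n %% (a * b))%N.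
have cab : (c < a * b)%N by rewrite ltn_pmod // muln_gt0 a0.
have ca : (a %| c)%N.
  have := chinese_modl co 0 n; rewrite mod0n => h.
  by rewrite /dvdn /c modn_dvdm ?dvdn_mulr // h.
have cb : (c = n %[mod b])%N by rewrite /c modn_dvdm ?dvdn_mull // chinese_modr.
have cn : (c <= n)%N by apply: leq_trans ab; apply: ltnW.
exists ((n - c) %/ b)%N; rewrite !divnK ?subnKC //.
by rewrite -eqn_mod_dvd //; apply/eqP.
Qed.

(** The least maximum degree that the hypotheses of the theorem allow for each d; excluding (3, 3)
    and (5, 5) is what raises it to 4 and 6 there. *)
Definition degree_cap (d : nat) : nat := (if d <= 2 then 3 else if d <= 4 then 4 else 6)%N.

(** The orders increased by s are 5 and 6 for d <= 2, 6 and 7 for d = 3, 14 and 17 for d = 4, 24 and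
    29 for d = 5. One gadget and two graphs serve every degree bound from [degree_cap d] on. *)
Lemma gadgets (R : realType) d : (d <= 5)%N -> exists s a b : nat,
  [/\ (1 < a)%N, (1 < b)%N, coprime (a + s) (b + s) &
    forall D, (degree_cap d <= D)%N ->
      [/\ (0 < connected_count R d D a)%N, (0 < connected_count R d D b)%N &
       forall k m, (1 < m)%N -> (1 < k - m)%N ->
       ('C(k, m) * (connected_count R d D m * connected_count R d D (k - m)) <=
         connected_count R d D (k + s))%N]].
Proof.
have super s (x1 x2 : 'I_s) L P (d0 D0 d' D : nat) (room : gadget_room R (edge_set s L) x1 x2) :
    graph_check s L P -> x1 != x2 ->
    all (fun v => d0 <= (v == val x1) * 2 + (v == val x2) * 2 + degree_in L v <= D0)%N (iota 0 s) ->
    (d' <= d0)%N -> (D0 <= D)%N -> forall k m, (1 < m)%N -> (1 < k - m)%N ->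
    ('C(k, m) * (connected_count R d' D m * connected_count R d' D (k - m)) <=
         connected_count R d' D (k + s))%N.
  move=> ck x12 /allP dg dd DD k m; have /and4P[sc uL _ _] := ck.
  apply: (connected_count_super (edge_set_simple sc) (edge_set_connected ck) x12 room) => v.
  rewrite (edge_set_deg _ sc) //; have := dg v; rewrite mem_iota /= !val_eqE => /(_ (ltn_ord v)) /andP[h1 h2].
  by rewrite (leq_trans dd h1) (leq_trans h2 DD).
have K2_super d' D := super _ _ _ _ _ 3%N 3%N d' D (edge_set_room R (x1 := Ordinal (isT : 0 < 2)%N)
  (x2 := Ordinal (isT : 1 < 2)%N) (proj1 (andP K2_check)) K2_room) K2_check isT isT.
move=> d5; have [d2|d2] := leqP d 2%N; last have [d3|d3] := leqP d 3%N; last have [d4|d4] := leqP d 4%N.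
- exists 2%N, 3%N, 4%N; split=> // D; rewrite /degree_cap d2 => hD; split.
  + by apply: (connected_count_gt0 R _ _ K3_check (d := 2%N) (D := 3%N)) => //; lia.
  + by apply: (connected_count_gt0 R _ _ K4_check (d := 3%N) (D := 3%N)) => //; lia.
  + by apply: K2_super; lia.
- exists 2%N, 4%N, 5%N; split=> // D; rewrite /degree_cap (leqNgt d 2) d2 (leqW d3) /= => hD; split.
  + by apply: (connected_count_gt0 R _ _ K4_check (d := 3%N) (D := 3%N)) => //; lia.
  + by apply: (connected_count_gt0 R _ _ wheel4_check (d := 3%N) (D := 4%N)) => //; lia.
  + by apply: K2_super; lia.
- exists 8%N, 6%N, 9%N; split=> // D; rewrite /degree_cap (leqNgt d 2) d2 d4 /= => hD; split.
  + by apply: (connected_count_gt0 R _ _ octahedron_check (d := 4%N) (D := 4%N)) => //; lia.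
  + by apply: (connected_count_gt0 R _ _ medial_prism_check (d := 4%N) (D := 4%N)) => //; lia.
  + by apply: (super _ _ _ _ _ 4%N 4%N _ _ (edge_set_room R (x1 := Ordinal (isT : 6 < 8)%N)
      (x2 := Ordinal (isT : 7 < 8)%N) (proj1 (andP octahedron_subdivided_check))
      octahedron_subdivided_room) octahedron_subdivided_check) => //; lia.
- exists 12%N, 12%N, 17%N; split=> // D; rewrite /degree_cap (leqNgt d 2) d2 (leqNgt d 4) d4 /= => hD; split.
  + by apply: (connected_count_gt0 R _ _ icosahedron_check (d := 5%N) (D := 5%N)) => //; lia.
  + by apply: (connected_count_gt0 R _ _ dual_C30_check (d := 5%N) (D := 6%N)) => //; lia.
  + by apply: (super _ _ _ _ _ 5%N 6%N _ _ (edge_set_room R (x1 := Ordinal (isT : 1 < 12)%N)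
      (x2 := Ordinal (isT : 2 < 12)%N) (proj1 (andP icosahedron_minus_edge_check))
      icosahedron_minus_edge_room) icosahedron_minus_edge_check) => //; lia.
Qed.

Lemma sum_by_card n (f : nat -> nat) :
  (\sum_(K : {set 'I_n}) f #|K| = \sum_(k < n.+1) 'C(n, k) * f k)%N.
Proof.
have cK (K : {set 'I_n}) : (#|K| < n.+1)%N by rewrite ltnS -[leqRHS]card_ord max_card.
rewrite (partition_big (fun K : {set 'I_n} => Ordinal (cK K)) xpredT) //=; apply: eq_bigr => k _.
rewrite (eq_bigr (fun=> f k)); last by move=> K /eqP <-.
rewrite sum_nat_const; congr (_ * _)%N.
have -> : 'C(n, k) = #|[set K : {set 'I_n} | #|K| == k]%SET| by rewrite card_draws card_ord.
by apply: eq_card => K; rewrite [RHS]inE.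
Qed.

Lemma fact_add_le k s : ((k + s)`! <= k`! * (k + s) ^ s)%N.
Proof.
elim: s => [|s IH]; first by rewrite addn0 muln1.
rewrite addnS factS expnS mulnCA leq_mul2l /=; apply: leq_trans IH _.
by rewrite leq_mul2l; apply/orP; right; case: s => [|s] //; rewrite leq_exp2r // addnS leqnSn.
Qed.

Section Ratios.
Variables (R : realType) (d : nat) (D : nat -> nat).
Hypothesis Dmono : forall i j, (i <= j)%N -> (D i <= D j)%N.
Let u i n : R := (connected_count R d (D i) n)%:R / n`!%:R.
Let a i n : R := (graph_count R d (D i) n)%:R / n`!%:R.

Let fact_gt0R n : 0 < n`!%:R :> R. Proof. by rewrite ltr0n fact_gt0. Qed.

(** The binomial coefficient turns counts into ratios to factorials; the labels of the gadget cost
    (m+n+s)! / (m+n)!, which is at most (m+n+s)^s. *)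
Lemma connected_ratio_super s i m n :
  ('C(m + n, m) * (connected_count R d (D i) m * connected_count R d (D i) (m + n - m)) <=
     connected_count R d (D i) (m + n + s))%N ->
  u i m * u i n <= u i (m + n + s)%N * (m + n + s)%:R ^+ s.
Proof.
rewrite addKn /u; move: (connected_count _ _ _ m) (connected_count _ _ _ n)
  (connected_count _ _ _ (m + n + s)) => x y z h.
have h1 : (m + n)`!%:R = 'C(m + n, m)%:R * (m`!%:R * n`!%:R) :> R.
  by rewrite -!natrM -(bin_fact (leq_addr n m)) addKn.
have C0 : 'C(m + n, m)%:R != 0 :> R by rewrite pnatr_eq0 -lt0n bin_gt0 leq_addr.
have -> : x%:R / m`!%:R * (y%:R / n`!%:R) = 'C(m + n, m)%:R * (x%:R * y%:R) / (m + n)`!%:R :> R.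
  by rewrite h1; field; rewrite C0 !gt_eqF.
apply: le_trans (_ : _ <= z%:R / (m + n)`!%:R) _.
  by rewrite ler_pM2r ?invr_gt0 // -!natrM ler_nat.
rewrite -mulrA ler_wpM2l // ler_pdivlMl // ler_pdivrMr // mulrC -natrX -natrM ler_nat.
by rewrite fact_add_le.
Qed.

Lemma ratio_components i n : n%:R * a i n <= \sum_(1 <= k < n.+1) k%:R * u i k * a i (n - k)%N.
Proof.
have h := graph_count_components R d (D i) n.
pose f k := (k * (connected_count R d (D i) k * graph_count R d (D i) (n - k)))%N.
rewrite (eq_bigr (fun K : {set 'I_n} => f #|K|)) in h; last first.
  by move=> K _; rewrite [#|~: K|%SET]cardsCs finset.setCK card_ord.
rewrite sum_by_card -(ler_nat R) in h; rewrite /a mulrA ler_pdivrMr // -natrM; apply: le_trans h _.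
rewrite big_ord_recl /= /f mul0n muln0 add0n natr_sum big_add1 /= big_mkord mulr_suml.
apply: ler_sum => -[k kn] _ /=; rewrite le_eqVlt; apply/orP; left; apply/eqP.
rewrite /bump add1n -(bin_fact kn) /u; have := fact_gt0R k.+1; move: (k.+1)`! => w w0.
rewrite !natrM; field.
by rewrite !gt_eqF.
Qed.

(** Shifted by s, the orders of connected graphs are closed under addition: orders m - s and n - s
    glue to m + n - s. Two coprime members generate all large numbers. *)
Lemma connected_ratio_gt0 s x y : (1 < x)%N -> (1 < y)%N -> coprime (x + s) (y + s) ->
  (0 < connected_count R d (D 0) x)%N -> (0 < connected_count R d (D 0) y)%N ->
  (forall k m, (1 < m)%N -> (1 < k - m)%N ->
     ('C(k, m) * (connected_count R d (D 0) m * connected_count R d (D 0) (k - m)) <=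
       connected_count R d (D 0) (k + s))%N) ->
  exists n0, forall n, (n0 <= n)%N -> 0 < u 0 n.
Proof.
move=> x1 y1 co cx cy H; pose P n := ((s.+1 < n) && (0 < connected_count R d (D 0) (n - s)))%N.
have PD m n : P m -> P n -> P (m + n)%N.
  move=> /andP[m1 cm] /andP[n1 cn]; apply/andP; split; first by rewrite ltn_addr.
  have := H ((m - s) + (n - s))%N (m - s)%N; rewrite addKn !ltn_subRL addn1.
  move=> /(_ m1 n1); rewrite (_ : (m - s + (n - s) + s = m + n - s)%N); last by lia.
  by apply: leq_trans; rewrite !muln_gt0 cm cn bin_gt0 leq_addr.
have Px : P (x + s)%N by rewrite /P addnK cx andbT; rewrite -(ltn_add2r s 1 x) in x1.
have Py : P (y + s)%N by rewrite /P addnK cy andbT; rewrite -(ltn_add2r s 1 y) in y1.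
have Pk z k : P z -> P (k.+1 * z)%N.
  by move=> Pz; elim: k => [|k IH]; rewrite ?mul1n // mulSn PD.
exists ((x + s) * (y + s))%N => n hn.
have xs : (0 < x + s)%N by rewrite addn_gt0 (ltnW x1).
have ys : (0 < y + s)%N by rewrite addn_gt0 (ltnW y1).
have [k [l e]] := coprime_combination xs ys co (leq_trans hn (leq_addr s n)).
have : P (n + s)%N.
  rewrite e; case: k l e => [|k] [|l] e.
  - by move: (leq_trans hn (leq_addr s n)); rewrite e leqNgt !muln_gt0 xs ys.
  - by rewrite mul0n add0n Pk.
  - by rewrite mul0n addn0 Pk.
  - by apply: PD; apply: Pk.
by rewrite /P addnK => /andP[_ h]; rewrite divr_gt0 // ltr0n.
Qed.

Theorem graph_ratio_limit (N0 : nat) : (d <= 5)%N -> (degree_cap d <= D 0)%N ->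
  exists2 g : R, 0 < g & (fun n => a (n - N0)%N n `^ n%:R^-1) @ \oo --> g.
Proof.
move=> d5 cap; have [s [x [y [x1 y1 co H]]]] := gadgets R d5.
have capi i : (degree_cap d <= D i)%N by apply: leq_trans cap (Dmono _).
have [C C0 CH] := graph_count_bound R.
have C1 : 1 <= C%:R :> R by rewrite ler1n.
have u0 i n : 0 <= u i n by rewrite divr_ge0.
have ua i n : u i n <= a i n by rewrite ler_pM2r ?invr_gt0 // ler_nat connected_count_le.
have aC i n : a i n <= C%:R ^+ n by rewrite ler_pdivrMr // -natrX -natrM ler_nat.
have umono i j n : (i <= j)%N -> u i n <= u j n.
  by move=> ij; rewrite ler_pM2r ?invr_gt0 // ler_nat connected_count_mono // Dmono.
have usup i m n : (1 < m)%N -> (1 < n)%N -> u i m * u i n <= u i (m + n + s)%N * (m + n + s)%:R ^+ s.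
  move=> m1 n1; apply: connected_ratio_super; have [_ _] := H _ (capi i); apply=> //.
  by rewrite addKn.
have upos : exists n0, forall n, (n0 <= n)%N -> 0 < u 0 n.
  have [cx cy Hs] := H _ cap; exact: connected_ratio_gt0 x1 y1 co cx cy Hs.
exists (growth_rate u s).
  exact: growth_rate_gt0 C1 u0 ua aC upos.
exact: growth_limit C1 u0 ua aC umono usup upos ratio_components N0.
Qed.
End Ratios.

Lemma planar_graphs_class (R : realType) n d (D : nat -> int) : 0 <= D n ->
  planar_graphs R n d D = class R d `|D n|%N 'I_n.
Proof.
move=> D0; apply/setP=> E; rewrite !inE; congr andb.
rewrite andbA; congr andb; apply/andP/forallP => [[/forallP h1 /forallP h2] v|h].
  by rewrite -[X in _ && X]lez_nat gez0_abs // h1 h2.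
by split; apply/forallP=> v; have := h v; rewrite -[X in _ && X]lez_nat gez0_abs // => /andP[].
Qed.

Lemma degree_cap_le d (m : int) : (d <= 5)%N -> (maxn d 3)%:Z <= m ->
  (d%:Z, m) \notin [:: (3%:Z, 3%:Z); (5%:Z, 5%:Z)] -> (degree_cap d)%:Z <= m.
Proof.
case: m => // m d5; rewrite !lez_nat geq_max !inE !negb_or !xpair_eqE !eqz_nat /degree_cap.
by move=> /andP[dm m3] /andP[h3 h5]; case: ifP => // d2; case: ifP => d4; lia.
Qed.

Theorem theorem2 (R : realType) (d : nat) (D : nat -> int)
  (hd : (d <= 5)%N)
  (hmono : forall m n : nat, (0 < m)%N -> (m <= n)%N -> D m <= D n)
  (hD : \forall n \near \oo,
          (maxn d 3)%:Z <= D n /\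
          (d%:Z, D n) \notin [:: (3%:Z, 3%:Z); (5%:Z, 5%:Z)]) :
  exists gamma : R, 0 < gamma /\
    (fun n : nat =>
       ((#|planar_graphs R n d D|)%:R / (n`!)%:R : R) `^ (n%:R)^-1)
      @ \oo --> gamma.
Proof.
(* N0 = N + 1 keeps all indices positive, as [hmono] asks, and beyond the threshold. Stage i of the
   bound is D(N0 + i), so D(n) is stage n - N0. *)
have [N _ HN] := hD; pose N0 := N.+1.
have cap n : (N0 <= n)%N -> (degree_cap d)%:Z <= D n.
  by move=> /ltnW /HN /= [h1 h2]; apply: degree_cap_le.
have D0 n : (N0 <= n)%N -> 0 <= D n by move=> /cap; apply: le_trans.
pose D' i := `|D (N0 + i)|%N.
have D'mono i j : (i <= j)%N -> (D' i <= D' j)%N.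
  by move=> ij; rewrite -lez_nat !gez0_abs ?D0 ?leq_addr // hmono ?leq_add2l.
have D'cap : (degree_cap d <= D' 0)%N by rewrite -lez_nat gez0_abs ?D0 ?cap ?leq_addr.
have [g g0 lim] := @graph_ratio_limit R d D' D'mono N0 hd D'cap.
exists g; split=> //; apply: cvg_trans lim; apply: near_eq_cvg; exists N0 => // n /= hn.
by rewrite /graph_count planar_graphs_class ?D0 // /D' subnKC.
Qed.
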